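(* Let $p$ be an integer with $1\le p<\infty$. Every abstract-definable $\mathcal{C}^p$ manifold $M$ admits an abstract-definable $\mathcal{C}^p$ embedding $g\colon M\to R^n$ for some positive integer $n$.
   Context: Fix an o-minimal expansion $\mathcal{R}$ of a real closed field $R$; ''definable'' means definable in $\mathcal{R}$ with parameters from $R$, and $R^k$ carries the order (product) topology. An abstract-definable $\mathcal{C}^p$ atlas of dimension $m$ on a set $M$ is a finite family of bijections $\phi_i\colon U_i\to\phi_i(U_i)\subseteq R^m$ ($U_i\subseteq M$) with $M=\bigcup_i U_i$, each $\phi_i(U_i)$ definable open, each $\phi_i(U_i\cap U_j)$ definable open, and each transition map $\phi_j\circ\phi_i^{-1}\colon\phi_i(U_i\cap U_j)\to\phi_j(U_i\cap U_j)$ a definable $\mathcal{C}^p$ diffeomorphism. Two atlases are compatible if their union is an atlas. An abstract-definable $\mathcal{C}^p$ manifold of dimension $m$ is a set $M$ with a compatibility class of such atlases whose induced topology (the unique one making each $U_i$ open and each $\phi_i$ a homeomorphism) is Hausdorff. A map $f\colon M\to N$ between such manifolds is abstract-definable $\mathcal{C}^p$ (resp. an abstract-definable $\mathcal{C}^p$ diffeomorphism) if all its chart representations $\psi\circ f\circ\phi^{-1}$ are definable $\mathcal{C}^p$ maps (resp. definable $\mathcal{C}^p$ diffeomorphisms); $R^n$ is regarded as a manifold with the identity chart. Tangent spaces $T_xM$ and differentials $d_xf$ are defined as usual via chart derivatives of definable $\mathcal{C}^p$ curves. An abstract-definable $\mathcal{C}^p$ immersion is an abstract-definable $\mathcal{C}^p$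 map with $d_xf$ injective for all $x$; an abstract-definable $\mathcal{C}^p$ embedding is an immersion that is a homeomorphism onto its image (with the subspace topology). *)

(* Defs.v *)
From HB Require Import structures.
From mathcomp Require Import all_boot all_order all_algebra.
From mathcomp Require Import all_classical all_reals all_analysis.
Import Order.TTheory GRing.Theory Num.Theory numFieldNormedType.Exports.
Local Open Scope classical_set_scope.
Local Open Scope ring_scope.

Section Defs.
Context {R : rcfType}.

(** * O-minimal structures on R (van den Dries' axiomatic description).
   [S n] is the family of definable subsets of R^n = 'rV[R]_n.  The axioms say
   exactly that S is the collection of sets definable with parameters in an
   o-minimal expansion of the ordered field R. *)
Definition ominimal_structure (S : forall n : nat, set (set 'rV[R]_n)) : Prop :=
  (
      (forall n, S n setT) /\
      (forall n (A : set 'rV[R]_n), S n A -> S n (~` A)) /\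
      (forall n (A B : set 'rV[R]_n), S n A -> S n B -> S n (A `|` B)) /\
      (forall n (A : set 'rV[R]_n), S n A ->
          S (1 + n)%N [set x : 'rV[R]_(1 + n) | A (rsubmx x)]) /\
      (forall n (A : set 'rV[R]_n), S n A ->
          S (n + 1)%N [set x : 'rV[R]_(n + 1) | A (lsubmx x)]) /\
      (forall n (i j : 'I_n), S n [set x : 'rV[R]_n | x ord0 i = x ord0 j]) /\
      (forall n (A : set 'rV[R]_(n + 1)), S (n + 1)%N A ->
          S n [set y : 'rV[R]_n | exists t : 'rV[R]_1, A (row_mx y t)]) /\
   (
      (forall r : R, S 1%N [set x : 'rV[R]_1 | x ord0 ord0 = r]) /\
      S 2%N [set x : 'rV[R]_2 | x ord0 (inord 0) < x ord0 (inord 1)] /\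
      S 3%N [set x : 'rV[R]_3 | x ord0 (inord 0) + x ord0 (inord 1) = x ord0 (inord 2)] /\
      S 3%N [set x : 'rV[R]_3 | x ord0 (inord 0) * x ord0 (inord 1) = x ord0 (inord 2)] /\
      (* o-minimality: definable subsets of R are finite unions of intervals
         and points (points are degenerate closed intervals) *)
      (forall A : set 'rV[R]_1, S 1%N A ->
          exists s : seq (interval R),
            forall x : 'rV[R]_1, A x <-> has (fun I => x ord0 ord0 \in I) s))).

Variable S : forall n : nat, set (set 'rV[R]_n).

Definition definable_map {m k} (U : set 'rV[R]_m) (f : 'rV[R]_m -> 'rV[R]_k) : Prop :=
  S (m + k)%N [set z : 'rV[R]_(m + k) | U (lsubmx z) /\ rsubmx z = f (lsubmx z)].

Fixpoint Cp {m k} (p : nat) (U : set 'rV[R]_m) (f : 'rV[R]_m -> 'rV[R]_k) : Prop :=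
  match p with
  | 0%N => forall x, U x -> {for x, continuous f}
  | p'.+1 => (forall x, U x -> differentiable f x) /\
             (forall i : 'I_m, Cp p' U (fun x => 'd f x (delta_mx ord0 i)))
  end.

Definition definable_Cp_map {m k} p (U : set 'rV[R]_m) (f : 'rV[R]_m -> 'rV[R]_k) :=
  definable_map U f /\ Cp p U f.

Definition definable_Cp_diffeo {m} p (V W : set 'rV[R]_m) (f : 'rV[R]_m -> 'rV[R]_m) :=
  definable_Cp_map p V f /\ f @` V = W /\
  exists g : 'rV[R]_m -> 'rV[R]_m, definable_Cp_map p W g /\
    (forall x, V x -> g (f x) = x) /\ (forall y, W y -> f (g y) = y).

Section Manifold.
Context {M : Type} {m : nat} {I : finType}.
Variables (U : I -> set M)
          (phi : I -> M -> 'rV[R]_m).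

Definition is_atlas (p : nat) : Prop :=
  [/\ (forall x : M, exists i, U i x),
      (forall i x y, U i x -> U i y -> phi i x = phi i y -> x = y),
      (forall i, S m (phi i @` U i) /\ open (phi i @` U i)),
      (forall i j, S m (phi i @` (U i `&` U j)) /\ open (phi i @` (U i `&` U j))) &
      (forall i j, exists t : 'rV[R]_m -> 'rV[R]_m,
         (forall x, U i x -> U j x -> t (phi i x) = phi j x) /\
         definable_Cp_diffeo p (phi i @` (U i `&` U j)) (phi j @` (U i `&` U j)) t)].

Definition man_open (O : set M) : Prop := forall i, open (phi i @` (O `&` U i)).

Definition man_hausdorff : Prop :=
  forall x y : M, x <> y -> exists O1 O2 : set M,
    [/\ man_open O1, man_open O2, O1 x, O2 y & O1 `&` O2 = set0].

Definition is_manifold (p : nat) : Prop := is_atlas p /\ man_hausdorff.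

(** Abstract-definable C^p immersion into R^n (with the identity chart on R^n):
   every chart representation g o phi_i^{-1} is a definable C^p map whose
   differential is injective at every point. *)
Definition is_immersion (p : nat) {n : nat} (g : M -> 'rV[R]_n) : Prop :=
  forall i, exists h : 'rV[R]_m -> 'rV[R]_n,
    (forall x, U i x -> h (phi i x) = g x) /\
    definable_Cp_map p (phi i @` U i) h /\
    (forall x, U i x -> forall v : 'rV[R]_m, 'd h (phi i x) v = 0 -> v = 0).

Definition is_embedding (p : nat) {n : nat} (g : M -> 'rV[R]_n) : Prop :=
  [/\ is_immersion p g,
      injective g,
      (forall V : set 'rV[R]_n, open V -> man_open (g @^-1` V)) &
      (forall O : set M, man_open O ->
         exists V : set 'rV[R]_n, open V /\ g @` O = g @` setT `&` V)].

End Manifold.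
End Defs.

(* Main.v *)
(** Every open definable [V] is the positivity set of a definable [C^p] function
    [a : R^m -> [0, 1]].  This rests on uniform finiteness: a definable set is a finite union of
    smooth graphs over open subsets of coordinate subspaces, each such graph has a tubular
    neighbourhood inside [V], and one sums the corresponding functions.

    Let [a_i] be such a function for the image of the chart [phi_i], divided by [1 + |y|^2].
    Since [M] is Hausdorff, the function [a_i o phi_i], extended by zero outside [U_i], is
    continuous on [M]: where [a_i >= e] the chart image is definably compact.  In another
    chart, every derivative of [a_i] and of the transition map is dominated by [1 / b(a_i)] for
    some definable [b > 0], so that [lambda_i = rho_i o a_i o phi_i] and the products
    [lambda_i * phi_i,k], extended by zero, are [C^p] as soon as [rho_i > 0] is flat enough at
    [0].  Such a definable [rho_i] exists for every gauge [b], because a definable function of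
    one variable is [C^p] near [0+] with monotone derivatives.  The map
    [g = (lambda_i, lambda_i * phi_i)_i] is the embedding: [U_i] is the set [lambda_i > 0] and
    there [phi_i] is a quotient of components of [g]. *)
Require Import Defs.
From HB Require Import structures.
From mathcomp Require Import all_boot all_order all_algebra.
From mathcomp Require Import all_classical all_reals all_analysis.
From mathcomp Require Import lra ring zify.
Import Order.TTheory GRing.Theory Num.Theory numFieldNormedType.Exports.
Local Open Scope classical_set_scope.
Local Open Scope ring_scope.
Set Implicit Arguments.
Unset Strict Implicit.
Unset Printing Implicit Defensive.

(* [R] is an arbitrary real closed field: it may be neither complete nor Archimedean, and closed
   boxes need not be compact. Suprema, mean value estimates, limit points and choices of witnesses
   are therefore taken for definable data only, and definability has to be tracked throughout. The
   obstacle to extending by zero is that transition maps and their derivatives may blow up at the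
   boundary of an overlap, while exponential bump functions need not be definable. Since [p] is
   finite, a rescaled [t^(p+1) b(t)] is flat enough. The extended functions [rho(A) u] have partial
   derivatives [rho'(A) (dA) u + rho(A) du], again sums of functions of this form; hence a
   first-order estimate, repeated by induction on [p], replaces any formula for higher derivatives.
   The same device also produces the functions with prescribed positivity set. Finite unions of
   smooth charts, whose images may overlap, take the place of a cell decomposition. *)
Existing Class ominimal_structure.

(* Linear arithmetic from the premises of the goal only: [lra] is slow in large contexts. *)
Ltac lin := repeat match goal with
  | H : is_true _ |- _ => clear H
  | H : _ /\ _ |- _ => clear H
  | H : @eq _ _ _ |- _ => clear H
  | H : ~ _ |- _ => clear H end; intros; lra.

(** * Definable sets and maps *)

Section Definability.
Context {R : rcfType} (S : forall n : nat, set (set 'rV[R]_n)).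
Arguments S : clear implicits.
Context {HS : ominimal_structure S}.

Lemma S_setT n : S n setT. Proof. by case: HS. Qed.
Lemma S_setC n A : S n A -> S n (~` A).
Proof. by case: HS => _ [h _]; apply: h. Qed.
Lemma S_setU n A B : S n A -> S n B -> S n (A `|` B).
Proof. by case: HS => _ [_ [h _]]; apply: h. Qed.
Lemma S_setI n A B : S n A -> S n B -> S n (A `&` B).
Proof.
by move=> sA sB; rewrite -[A]setCK -[B]setCK -setCU; apply/S_setC/S_setU; apply: S_setC.
Qed.
Lemma S_finI n (T : finType) (A : T -> set 'rV[R]_n) :
  (forall i, S n (A i)) -> S n [set x | forall i, A i x].
Proof.
move=> sA; suff h (s : seq T) : S n [set x | forall i, i \in s -> A i x].
  have -> : [set x | forall i, A i x] = [set x | forall i, i \in enum T -> A i x].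
    by apply/seteqP; split=> x /= h' i; [move=> _; exact: h'|apply: h'; rewrite mem_enum].
  exact: h.
elim: s => [|i s ih].
  have -> : [set x | forall i, i \in [::] -> A i x] = setT by apply/seteqP; split.
  exact: S_setT.
have -> : [set x | forall j, j \in i :: s -> A j x] =
   A i `&` [set x | forall j, j \in s -> A j x].
  apply/seteqP; split=> x /=.
    by move=> h; split=> [|j js]; apply: h; rewrite inE ?eqxx ?js ?orbT.
  by move=> [h1 h2] j; rewrite inE => /orP[/eqP->//|]; exact: h2.
exact: S_setI.
Qed.

Lemma S_cast n k (e : n = k) (A : set 'rV[R]_k) :
  S n [set x | A (castmx (erefl, e) x)] -> S k A.
Proof.
by case: k / e A => A; congr (S _); apply/seteqP; split=> x /=; rewrite castmx_id.
Qed.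

Lemma S_rsub k n (A : set 'rV[R]_n) : S n A -> S (k + n)%N [set x | A (rsubmx x)].
Proof.
move=> sA; elim: k => [|k ih].
  rewrite (_ : [set x : 'rV_(0 + n) | A (rsubmx x)] = A)//.
  have e (x : 'rV[R]_(0 + n)) : rsubmx x = x.
    by apply/rowP => i; rewrite mxE; congr (x _ _); apply: val_inj.
  by apply/seteqP; split=> x /=; rewrite e.
have [_ [_ [_ [h _]]]] := HS; have := h _ _ ih.
rewrite (_ : [set x | _] = [set x : 'rV_(k.+1 + n) | A (rsubmx x)])//.
apply/seteqP; split=> x /=;
  rewrite (_ : rsubmx (rsubmx (x : 'rV_(1 + (k + n)))) = rsubmx (x : 'rV_(k.+1 + n)))//;
  by apply/rowP => i; rewrite !mxE; congr (x _ _); apply: val_inj.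
Qed.

(** The axiom removes one coordinate at a time. Induction on [k] removes the last one; the rest is
    transport along [n + k.+1 = (n + k) + 1]. *)
Lemma S_proj n k (A : set 'rV[R]_(n + k)) : S (n + k)%N A ->
  S n [set y | exists t : 'rV[R]_k, A (row_mx y t)].
Proof.
elim: k A => [|k ih] A sA.
  apply: (S_cast (e := addn0 n)); rewrite (_ : [set x | _] = A)//.
  apply/seteqP; split=> x /=.
    case=> t; rewrite (_ : row_mx _ _ = x)//; apply/rowP => i.
    rewrite mxE; case: splitP => j e; last by case: j e => -[].
    by rewrite castmxE; congr (x _ _); apply: val_inj.
  move=> Ax; exists 0; rewrite (_ : row_mx _ _ = x)//; apply/rowP => i.
  rewrite mxE; case: splitP => j e; last by case: j e => -[].
  by rewrite castmxE; congr (x _ _); apply: val_inj.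
have e : (n + k.+1 = (n + k) + 1)%N by rewrite addn1 addnS.
have sA' : S (n + k + 1)%N [set x | A (castmx (erefl, esym e) x)].
  apply: (S_cast (e := e)); rewrite (_ : [set x | _] = A)//.
  have K (x : 'rV[R]_(n + k.+1)) : castmx (erefl, esym e) (castmx (erefl, e) x) = x.
    by apply/rowP => i; rewrite !castmxE; congr (x _ _); apply: val_inj.
  by apply/seteqP; split=> x /=; rewrite K.
have [_ [_ [_ [_ [_ [_ [h _]]]]]]] := HS.
have := ih _ (h _ _ sA'); congr (S _); apply/seteqP; split=> x /=.
  case=> t [u Au]; exists (castmx (erefl, addn1 k) (row_mx t u)).
  congr (A _): Au; apply/rowP => i; rewrite castmxE !mxE.
  case: splitP => j /= ej.
    rewrite mxE; case: splitP => l /= el.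
      case: splitP => l' /= el'; first by congr (x _ _); apply: val_inj => /=; lia.
      by have := ltn_ord l; lia.
    case: splitP => l' /= el'; first by have := ltn_ord l'; lia.
    rewrite castmxE mxE; case: splitP => l'' /= el''.
      by congr (t _ _); apply: val_inj => /=; lia.
    by have := ltn_ord l; lia.
  case: splitP => l /= el; first by have := ltn_ord l; lia.
  rewrite castmxE mxE; case: splitP => l'' /= el''; first by have := ltn_ord l''; lia.
  by rewrite !ord1.
case=> t At; exists (lsubmx (castmx (erefl, esym (addn1 k)) t)).
exists (rsubmx (castmx (erefl, esym (addn1 k)) t)).
congr (A _): At; apply/rowP => i; rewrite castmxE !mxE.
case: splitP => l /= el.
  case: splitP => j /= ej; last by have := ltn_ord l; lia.
  rewrite mxE; case: splitP => l' /= el'; first by congr (x _ _); apply: val_inj => /=; lia.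
  by have := ltn_ord l; lia.
case: splitP => j /= ej.
  rewrite mxE; case: splitP => l' /= el'; first by have := ltn_ord l'; lia.
  by rewrite mxE castmxE; congr (t _ _); apply: val_inj => /=; lia.
rewrite mxE castmxE; congr (t _ _); apply: val_inj => /=; have := ltn_ord j; have := ltn_ord l; lia.
Qed.

(** Substitution of variables: the set is the projection of all [(x, t)] with [A t] and
    [t_j = x_(s j)] for every [j]. One statement thus covers permuting, dropping and duplicating
    coordinates. *)
Lemma S_reindex n k (s : 'I_k -> 'I_n) (A : set 'rV[R]_k) : S k A ->
  S n [set x | A (\row_j x ord0 (s j))].
Proof.
move=> sA.
have [_ [_ [_ [_ [_ [he _]]]]]] := HS.
have := S_proj (S_setI (S_rsub n sA)
  (S_finI (fun j : 'I_k => he (n + k)%N (rshift n j) (lshift k (s j))))).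
congr (S _); apply/seteqP; split=> x /=.
  case=> t; rewrite row_mxKr => -[At h]; rewrite (_ : \row_j _ = t)//.
  by apply/rowP => j; rewrite mxE; have := h j; rewrite row_mxEr row_mxEl.
move=> Ax; exists (\row_j x ord0 (s j)); rewrite row_mxKr; split=> // j.
by rewrite row_mxEr row_mxEl mxE.
Qed.

(** * A typed language of definable predicates and functions *)

(** Types coded bijectively by some [R^ddim]. They let formulas speak of scalars, vectors and nested
    pairs directly, so that definability can be proved by recursion on the shape of a formula,
    without index arithmetic. *)
Class DT (X : Type) := {
  ddim : nat; denc : X -> 'rV[R]_ddim; ddec : 'rV[R]_ddim -> X;
  dencK : cancel denc ddec; ddecK : cancel ddec denc }.

#[global] Program Instance DT_R : DT R :=
  {| ddim := 1%N; denc x := const_mx x; ddec v := v ord0 ord0 |}.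
Next Obligation. by move=> x; rewrite mxE. Qed.
Next Obligation. by move=> x; apply/matrixP => i j; rewrite mxE !ord1. Qed.
#[global] Instance DT_rV n : DT 'rV[R]_n :=
  @Build_DT _ n (fun x => x) (fun v => v) (fun=> erefl) (fun=> erefl).
#[global] Program Instance DT_prod X Y `{DT X} `{DT Y} : DT (X * Y) :=
  {| ddim := (@ddim X _ + @ddim Y _)%N; denc p := row_mx (denc p.1) (denc p.2);
     ddec v := (ddec (lsubmx v), ddec (rsubmx v)) |}.
Next Obligation. by move=> X Y ? ? [x y] /=; rewrite row_mxKl row_mxKr !dencK. Qed.
Next Obligation. by move=> X Y ? ? v /=; rewrite !ddecK hsubmxK. Qed.

Definition Def {X} `{DT X} (P : X -> Prop) : Prop := S ddim [set v | P (ddec v)].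
Definition Deff {X Y} `{DT X} `{DT Y} (f : X -> Y) : Prop :=
  Def (fun p : X * Y => p.2 = f p.1).
(* The maps that only permute, drop or duplicate real coordinates. *)
Definition Coord {X Y} `{DT X} `{DT Y} (f : X -> Y) : Prop :=
  exists s : 'I_(@ddim Y _) -> 'I_(@ddim X _),
    forall x j, denc (f x) ord0 j = denc x ord0 (s j).

Section Closure.
Context {X Y Z : Type} `{DT X} `{DT Y} `{DT Z}.

Lemma Def_ext (P Q : X -> Prop) : (forall x, P x <-> Q x) -> Def P -> Def Q.
Proof. by move=> PQ; congr (S _); apply/seteqP; split=> x /=; rewrite PQ. Qed.
Lemma Def_not (P : X -> Prop) : Def P -> Def (fun x => ~ P x).
Proof. exact: S_setC. Qed.
Lemma Def_and (P Q : X -> Prop) : Def P -> Def Q -> Def (fun x => P x /\ Q x).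
Proof. exact: S_setI. Qed.
Lemma Def_or (P Q : X -> Prop) : Def P -> Def Q -> Def (fun x => P x \/ Q x).
Proof. exact: S_setU. Qed.
Lemma Def_imp (P Q : X -> Prop) : Def P -> Def Q -> Def (fun x => P x -> Q x).
Proof.
move=> dP dQ; apply: (Def_ext (P := fun x => ~ P x \/ Q x)); last exact/Def_or/dQ/Def_not.
by move=> x; rewrite implyE.
Qed.
Lemma Def_iff (P Q : X -> Prop) : Def P -> Def Q -> Def (fun x => P x <-> Q x).
Proof. by move=> dP dQ; apply: Def_and; apply: Def_imp. Qed.
Lemma Def_cst (P : Prop) : Def (fun _ : X => P).
Proof.
have [p|p] := pselect P.
  by rewrite (_ : (fun _ => P) = fun _ => True);
    [exact: S_setT|apply/funext => x; apply/propext].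
apply: (Def_ext (P := fun x => ~ True)); last exact/Def_not/S_setT.
by move=> x; split.
Qed.
Lemma Def_fall (T : finType) (P : T -> X -> Prop) :
  (forall i, Def (P i)) -> Def (fun x => forall i, P i x).
Proof. by move=> dP; apply: S_finI. Qed.
Lemma Def_fex (T : finType) (P : T -> X -> Prop) :
  (forall i, Def (P i)) -> Def (fun x => exists i, P i x).
Proof.
move=> dP; apply: (Def_ext (P := fun x => ~ forall i, ~ P i x)).
  move=> x; split=> [h|[i Pi] h]; last exact: (h i Pi).
  by apply: contrapT => n; apply: h => i Pi; apply: n; exists i.
by apply: Def_not; apply: Def_fall => i; exact: Def_not.
Qed.
Lemma Def_coord (f : X -> Y) (P : Y -> Prop) :
  Coord f -> Def P -> Def (fun x => P (f x)).
Proof.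
move=> [s hs] dP; have := S_reindex s dP; congr (S _); apply/seteqP.
have h (v : 'rV[R]_ddim) : (\row_j v ord0 (s j)) = denc (f (ddec v)).
  by apply/rowP => j; rewrite mxE hs ddecK.
by split=> v /=; rewrite h dencK.
Qed.
Lemma Def_ex (P : X -> Y -> Prop) :
  Def (fun p : X * Y => P p.1 p.2) -> Def (fun x => exists y, P x y).
Proof.
move=> dP; have := S_proj dP; congr (S _); apply/seteqP; split=> v /=.
  by case=> t; rewrite row_mxKl row_mxKr; exists (ddec t).
by case=> y; exists (denc y); rewrite row_mxKl row_mxKr dencK.
Qed.
Lemma Coord_id : Coord (fun x : X => x). Proof. by exists id. Qed.
Lemma Coord_fst (f : X -> Y * Z) : Coord f -> Coord (fun x => (f x).1).
Proof. by move=> [s h]; exists (s \o lshift _) => x j; rewrite -h row_mxEl. Qed.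
Lemma Coord_snd (f : X -> Y * Z) : Coord f -> Coord (fun x => (f x).2).
Proof. by move=> [s h]; exists (s \o @rshift _ _) => x j; rewrite -h row_mxEr. Qed.
Lemma Coord_pair (f : X -> Y) (g : X -> Z) :
  Coord f -> Coord g -> Coord (fun x => (f x, g x)).
Proof.
move=> [s h] [t k]; exists (fun j => match fintype.split j with inl a => s a | inr b => t b end).
by move=> x j /=; rewrite mxE; case: (fintype.split j) => l.
Qed.
Lemma Coord_row n (f : X -> 'rV[R]_n) i : Coord f -> Coord (fun x => f x ord0 i).
Proof. by move=> [s h]; exists (fun _ => s i) => x j; rewrite -h /= mxE. Qed.
End Closure.

Ltac crd := lazymatch goal with
  | |- Coord (fun x => x) => exact: Coord_id
  | |- Coord fst => apply: (@Coord_fst _ _ _ _ _ _ (fun x => x)); exact: Coord_id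
  | |- Coord snd => apply: (@Coord_snd _ _ _ _ _ _ (fun x => x)); exact: Coord_id
  | |- Coord (fun x => (@?f x, @?g x)) => apply: (@Coord_pair _ _ _ _ _ _ f g); crd
  | |- Coord (fun x => fst (@?f x)) => apply: (@Coord_fst _ _ _ _ _ _ f); crd
  | |- Coord (fun x => snd (@?f x)) => apply: (@Coord_snd _ _ _ _ _ _ f); crd
  | |- Coord (fun x => fun_of_matrix (@?f x) ord0 ?i) => apply: (@Coord_row _ _ _ f i); crd
  end.

Section Closure2.
Context {X Y Z : Type} `{DT X} `{DT Y} `{DT Z}.

Lemma Def_all (P : X -> Y -> Prop) :
  Def (fun p : X * Y => P p.1 p.2) -> Def (fun x => forall y, P x y).
Proof.
move=> dP; apply: (Def_ext (P := fun x => ~ exists y, ~ P x y)).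
  move=> x; split=> [h y|h [y]]; last exact.
  by apply: contrapT => n; apply: h; exists y.
by apply: Def_not; apply: Def_ex; exact: Def_not.
Qed.
Lemma Def_coord_eq (f g : X -> Y) : Coord f -> Coord g -> Def (fun x => f x = g x).
Proof.
move=> [s hs] [t ht]; have [_ [_ [_ [_ [_ [he _]]]]]] := HS.
have := S_finI (fun j => he _ (s j) (t j)); congr (S _); apply/seteqP; split=> v /= h.
  by rewrite -[LHS]dencK -[RHS]dencK; congr ddec; apply/rowP => j; rewrite hs ht ddecK.
by move=> j; rewrite -[v]ddecK -hs -ht h.
Qed.
End Closure2.

Section Closure3.
Context {X Y Z : Type} `{DT X} `{DT Y} `{DT Z}.

Lemma Deff_coord (f : X -> Y) : Coord f -> Deff f.
Proof.
move=> [s h]; apply: (Def_coord_eq (f := fun p : X * Y => p.2)); first by crd.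
by exists (fun j => lshift _ (s j)) => x j; rewrite h /= row_mxEl.
Qed.
Lemma Def_subst (P : Y -> Prop) (f : X -> Y) : Deff f -> Def P -> Def (fun x => P (f x)).
Proof.
move=> df dP; apply: (Def_ext (P := fun x => exists y, y = f x /\ P y)).
  by move=> x; split=> [[y [->]]|]//; exists (f x).
apply: Def_ex; apply: Def_and => //; apply: (Def_coord (f := fun p : X * Y => p.2)) dP; crd.
Qed.
Lemma Deff_pair (f : X -> Y) (g : X -> Z) :
  Deff f -> Deff g -> Deff (fun x => (f x, g x)).
Proof.
move=> df dg.
apply: (Def_ext (P := fun p : X * (Y * Z) => p.2.1 = f p.1 /\ p.2.2 = g p.1)).
  by move=> [x [y z]] /=; split=> [[-> ->]|[-> ->]].
apply: Def_and.
  by apply: (Def_coord (f := fun p : X * (Y * Z) => (p.1, p.2.1))) df; crd.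
by apply: (Def_coord (f := fun p : X * (Y * Z) => (p.1, p.2.2))) dg; crd.
Qed.
Lemma Deff_comp (g : Y -> Z) (f : X -> Y) : Deff f -> Deff g -> Deff (fun x => g (f x)).
Proof.
move=> df dg.
apply: (Def_ext (P := fun p : X * Z => exists y, y = f p.1 /\ p.2 = g y)).
  by move=> [x z] /=; split=> [[y [-> ->]]|->]//; exists (f x).
apply: Def_ex; apply: Def_and.
  by apply: (Def_coord (f := fun q : X * Z * Y => (q.1.1, q.2))) df; crd.
by apply: (Def_coord (f := fun q : X * Z * Y => (q.2, q.1.2))) dg; crd.
Qed.
Lemma Deff_ext (f g : X -> Y) : f =1 g -> Deff f -> Deff g.
Proof. by move=> /funext ->. Qed.
Lemma Deff_rel (G : X -> Y -> Prop) (f : X -> Y) :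
  (forall x y, G x y <-> y = f x) -> Def (fun p : X * Y => G p.1 p.2) -> Deff f.
Proof. by move=> h; apply: Def_ext => p; exact: h. Qed.
Lemma Deff_if (P : X -> Prop) (f g : X -> Y) : Def P -> Deff f -> Deff g ->
  Deff (fun x => if `[< P x >] then f x else g x).
Proof.
move=> dP df dg.
apply: (Deff_rel (G := fun x y => (P x /\ y = f x) \/ (~ P x /\ y = g x))).
  by move=> x y; case: asboolP => p; split=> [[[]|[]]|] //; [left|right].
have dP1 : Def (fun p : X * Y => P p.1) by apply: (Def_coord (f := fst)) dP; crd.
by apply: Def_or; apply: Def_and => //; exact: Def_not.
Qed.
End Closure3.

Lemma Deff_rows X `{DT X} n (f : X -> 'rV[R]_n) :
  (forall i, Deff (fun x => f x ord0 i)) -> Deff f.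
Proof.
move=> df; apply: (Def_ext (P := fun p : X * 'rV[R]_n => forall i, p.2 ord0 i = f p.1 ord0 i)).
  by move=> [x v] /=; split=> [h|->]//; apply/rowP.
apply: Def_fall => i.
by apply: (Def_coord (f := fun p : X * 'rV[R]_n => (p.1, p.2 ord0 i))) (df i); crd.
Qed.

Section Arith.
Context {X : Type} `{DT X}.

Lemma Deff_cstR (c : R) : Deff (fun _ : X => c).
Proof.
have [_ [_ [_ [_ [_ [_ [_ [h _]]]]]]]] := HS.
have d : Def (fun x : R => x = c) by exact: h.
by apply: (Def_coord (f := fun p : X * R => p.2)) d; crd.
Qed.
Lemma Deff_cst Y `{DT Y} (c : Y) : Deff (fun _ : X => c).
Proof.
have d : Deff (fun _ : X => denc c) by apply: Deff_rows => i; exact: Deff_cstR.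
have := d; congr (S _); apply/seteqP; split=> v /= e.
  by rewrite e dencK.
by rewrite -[LHS]ddecK e.
Qed.
Lemma S3_Def (r : R -> R -> R -> Prop) :
  S 3%N [set x : 'rV[R]_3 | r (x ord0 (inord 0)) (x ord0 (inord 1)) (x ord0 (inord 2))] ->
  Def (fun p : R * R * R => r p.1.1 p.1.2 p.2).
Proof.
move=> h; have d : Def (fun x : 'rV[R]_3 =>
   r (x ord0 (inord 0)) (x ord0 (inord 1)) (x ord0 (inord 2))) by [].
have c : Coord (fun p : R * R * R =>
   \row_(i < 3) (if i == 0%N :> nat then p.1.1 else if i == 1%N :> nat then p.1.2 else p.2)).
  exists (fun j : 'I_3 => j) => -[[x y] z] j /=; rewrite !mxE.
  case: splitP => k /= ->; last by rewrite mxE ord1.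
  by rewrite mxE; case: splitP => l /= ->; rewrite mxE ord1.
have := Def_coord c d; apply: Def_ext => -[[x y] z] /=.
by rewrite !mxE !inordK.
Qed.
Lemma Deff_addR : Deff (fun p : R * R => p.1 + p.2).
Proof.
have [_ [_ [_ [_ [_ [_ [_ [_ [_ [h _]]]]]]]]]] := HS.
by apply: Def_ext (S3_Def (r := fun x y z => x + y = z) h) => -[[x y] z] /=; split=> ->.
Qed.
Lemma Deff_mulR : Deff (fun p : R * R => p.1 * p.2).
Proof.
have [_ [_ [_ [_ [_ [_ [_ [_ [_ [_ [h _]]]]]]]]]]] := HS.
by apply: Def_ext (S3_Def (r := fun x y z => x * y = z) h) => -[[x y] z] /=; split=> ->.
Qed.
Lemma Def_ltR : Def (fun p : R * R => p.1 < p.2).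
Proof.
have [_ [_ [_ [_ [_ [_ [_ [_ [h _]]]]]]]]] := HS.
have d : Def (fun x : 'rV[R]_2 => x ord0 (inord 0) < x ord0 (inord 1)) by [].
have c : Coord (fun p : R * R => \row_(i < 2) (if i == 0%N :> nat then p.1 else p.2)).
  exists (fun j : 'I_2 => j) => -[x y] j /=; rewrite !mxE.
  by case: splitP => k /= ->; rewrite mxE ord1.
by have := Def_coord c d; apply: Def_ext => -[x y] /=; rewrite !mxE !inordK.
Qed.

Lemma Deff_comp2 (Y1 Y2 Y3 : Type) `{DT Y1} `{DT Y2} `{DT Y3} (h : Y1 * Y2 -> Y3)
  (f : X -> Y1) (g : X -> Y2) :
  Deff h -> Deff f -> Deff g -> Deff (fun x => h (f x, g x)).
Proof. by move=> dh df dg; apply: (Deff_comp (g := h)) => //; exact: Deff_pair. Qed.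
Lemma Def_subst2 (Y1 Y2 : Type) `{DT Y1} `{DT Y2} (P : Y1 -> Y2 -> Prop)
  (f : X -> Y1) (g : X -> Y2) :
  Def (fun p : Y1 * Y2 => P p.1 p.2) -> Deff f -> Deff g -> Def (fun x => P (f x) (g x)).
Proof.
move=> dP df dg.
by apply: (Def_subst (P := fun p : Y1 * Y2 => P p.1 p.2) (f := fun x => (f x, g x))) => //; exact: Deff_pair.
Qed.
Lemma Deff_subst2 (Y1 Y2 Y3 : Type) `{DT Y1} `{DT Y2} `{DT Y3} (h : Y1 -> Y2 -> Y3)
  (f : X -> Y1) (g : X -> Y2) :
  Deff (fun p : Y1 * Y2 => h p.1 p.2) -> Deff f -> Deff g -> Deff (fun x => h (f x) (g x)).
Proof. exact: (Deff_comp2 (h := fun p => h p.1 p.2)). Qed.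

Lemma Def_eq Y `{DT Y} (f g : X -> Y) : Deff f -> Deff g -> Def (fun x => f x = g x).
Proof. by move=> df dg; apply: (Def_subst2 (P := fun x y => x = y)) => //; apply: (Def_coord_eq (f := fst) (g := snd)); crd. Qed.
Lemma Deff_fst Y1 Y2 `{DT Y1} `{DT Y2} (f : X -> Y1 * Y2) : Deff f -> Deff (fun x => (f x).1).
Proof. by move=> df; apply: (Deff_comp (g := fst)) => //; apply: Deff_coord; apply: Coord_fst; crd. Qed.
Lemma Deff_snd Y1 Y2 `{DT Y1} `{DT Y2} (f : X -> Y1 * Y2) : Deff f -> Deff (fun x => (f x).2).
Proof. by move=> df; apply: (Deff_comp (g := snd)) => //; apply: Deff_coord; apply: Coord_snd; crd. Qed.
Lemma Deff_row n (f : X -> 'rV[R]_n) i : Deff f -> Deff (fun x => f x ord0 i).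
Proof. by move=> df; apply: (Deff_comp (g := fun v : 'rV[R]_n => v ord0 i)) => //; apply: Deff_coord; crd. Qed.

End Arith.

Section ArithR.
Context {X : Type} `{DT X} (f g : X -> R) (df : Deff f) (dg : Deff g).

Lemma Deff_add : Deff (fun x => f x + g x).
Proof. exact: (Deff_subst2 (h := fun x y => x + y) Deff_addR). Qed.
Lemma Deff_mul : Deff (fun x => f x * g x).
Proof. exact: (Deff_subst2 (h := fun x y => x * y) Deff_mulR). Qed.
Lemma Deff_opp : Deff (fun x => - f x).
Proof.
apply: (Deff_ext (f := fun x => -1 * f x)); first by move=> x; rewrite mulN1r.
exact: (Deff_subst2 (h := fun x y => x * y) Deff_mulR (Deff_cstR _)).
Qed.
Lemma Def_lt : Def (fun x => f x < g x).
Proof. exact: (Def_subst2 (P := fun x y => x < y) Def_ltR). Qed.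
Lemma Def_le : Def (fun x => f x <= g x).
Proof.
apply: (Def_ext (P := fun x => ~ g x < f x)).
  by move=> x; rewrite leNgt; split=> [/negP|/negP].
exact/Def_not/(Def_subst2 (P := fun x y => x < y) Def_ltR).
Qed.
Lemma Deff_inv : Deff (fun x => (f x)^-1).
Proof.
(* The first disjunct accounts for the convention [0^-1 = 0], which makes inversion a total
   definable function. *)
apply: (Deff_rel (G := fun x y => (f x = 0 /\ y = 0) \/ f x * y = 1)).
  move=> x y; split=> [[[-> ->]|h]|->]; first by rewrite invr0.
    have h0 : f x != 0 by apply/eqP => e; move: h; rewrite e mul0r => /eqP; rewrite eq_sym oner_eq0.
    by apply: (mulfI h0); rewrite h mulfV.
  by have [->|h] := eqVneq (f x) 0; [left; rewrite invr0|right; rewrite mulfV].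
have df1 : Deff (fun p : X * R => f p.1) by apply: (Deff_comp (f := fst)) df; apply: Deff_coord; crd.
have d2 : Deff (fun p : X * R => p.2) by apply: Deff_coord; crd.
apply: Def_or; first by apply: Def_and; apply: Def_eq => //; exact: Deff_cst.
apply: Def_eq; last exact: Deff_cst.
exact: (Deff_subst2 (h := fun x y => x * y) Deff_mulR).
Qed.
End ArithR.

Section Arith2.
Context {X : Type} `{DT X}.
Lemma Deff_norm (f : X -> R) : Deff f -> Deff (fun x => `|f x|).
Proof.
move=> df; apply: (Deff_ext (f := fun x => if `[< 0 <= f x >] then f x else - f x)).
  move=> x; case: asboolP => h; first by rewrite ger0_norm.
  by rewrite ler0_norm// leNgt; apply/negP => /ltW.
apply: Deff_if => //; last exact: Deff_opp.
by apply: Def_le => //; exact: Deff_cst.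
Qed.
Lemma Deff_exp (f : X -> R) n : Deff f -> Deff (fun x => f x ^+ n).
Proof.
move=> df; elim: n => [|n ih]; first exact: (Deff_ext (f := fun _ => 1)) (Deff_cst _).
by apply: (Deff_ext (f := fun x => f x * f x ^+ n)); [move=> x; rewrite exprS|exact: Deff_mul].
Qed.
End Arith2.

Section More.
Context {X : Type} `{DT X}.

Lemma Deff_id : Deff (fun x : X => x). Proof. by apply: Deff_coord; crd. Qed.
Lemma Deff_mkrow n (F : 'I_n -> X -> R) : (forall i, Deff (F i)) -> Deff (fun x => \row_i F i x).
Proof. by move=> dF; apply: Deff_rows => i; apply: Deff_ext (dF i) => x; rewrite mxE. Qed.
Lemma Def_subst3 (Y1 Y2 Y3 : Type) `{DT Y1} `{DT Y2} `{DT Y3} (P : Y1 -> Y2 -> Y3 -> Prop)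
  (f : X -> Y1) (g : X -> Y2) (h : X -> Y3) :
  Def (fun p : Y1 * Y2 * Y3 => P p.1.1 p.1.2 p.2) -> Deff f -> Deff g -> Deff h ->
  Def (fun x => P (f x) (g x) (h x)).
Proof.
move=> dP df dg dh.
apply: (Def_subst (P := fun p : Y1 * Y2 * Y3 => P p.1.1 p.1.2 p.2) (f := fun x => (f x, g x, h x))) => //.
by apply: Deff_pair => //; apply: Deff_pair.
Qed.
End More.
End Definability.

(** * Automation of definability proofs *)

Arguments Deff_id {R S HS X H}.
Ltac dfn_leaf := first [eassumption | solve [auto with dfn nocore]].
Ltac dfn_eta := lazymatch goal with
  | |- Def _ (fun _ => _) => idtac
  | |- Deff _ (fun _ => _) => idtac
  | |- Def ?S ?f => change (Def S (fun x => f x))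
  | |- Deff ?S ?f => change (Deff S (fun x => f x))
  end.
(** Recursion on the head symbol: connectives, quantifiers over coded or finite types, order, field
    operations. Any other application is treated as a substitution into a predicate or function
    whose definability is a hypothesis or a hint. First-order epsilon-delta definitions are thus
    settled once unfolded. *)
Ltac dfn := intros; first [eassumption | dfn_eta; lazymatch goal with
  | |- Def _ (fun _ => ?P) => refine (Def_cst P)
  | |- Def _ (fun x => _ /\ _) => refine (Def_and _ _); dfn
  | |- Def _ (fun x => _ \/ _) => refine (Def_or _ _); dfn
  | |- Def _ (fun x => ~ _) => refine (Def_not _); dfn
  | |- Def _ (fun x => _ <-> _) => refine (Def_iff _ _); dfn
  | |- Def _ (fun x => exists _, _) => first [refine (Def_ex _); cbv beta; dfn | refine (Def_fex _); dfn]
  | |- Def _ (fun x => @?P x -> @?Q x) => refine (@Def_imp _ _ _ _ _ P Q _ _); dfn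
  | |- Def _ (fun x => forall _, _) => first [refine (Def_all _); cbv beta; dfn | refine (Def_fall _); dfn]
  | |- Def _ (fun x => is_true (_ < _)) => refine (Def_lt _ _); dfn
  | |- Def _ (fun x => is_true (_ <= _)) => refine (Def_le _ _); dfn
  | |- Def _ (fun x => _ = _) => refine (Def_eq _ _); dfn
  | |- Def _ _ => first
    [ lazymatch goal with |- Def _ (fun x => ?P (@?f x) (@?g x) (@?h x)) =>
        refine (@Def_subst3 _ _ _ _ _ _ _ _ _ _ _ P f g h _ _ _ _); [dfn_leaf|dfn|dfn|dfn] end
    | lazymatch goal with |- Def _ (fun x => ?P (@?f x) (@?g x)) =>
        refine (@Def_subst2 _ _ _ _ _ _ _ _ _ P f g _ _ _); [dfn_leaf|dfn|dfn] end
    | lazymatch goal with |- Def _ (fun x => ?P (@?f x)) =>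
        refine (@Def_subst _ _ _ _ _ _ _ P f _ _); [dfn|dfn_leaf] end ]
  | |- Deff _ (fun x => x) => refine Deff_id
  | |- Deff _ (fun _ => ?c) => refine (Deff_cst c)
  | |- Deff _ (fun x => fst _) => refine (Deff_fst _); dfn
  | |- Deff _ (fun x => snd _) => refine (Deff_snd _); dfn
  | |- Deff _ (fun x => (_, _)) => refine (Deff_pair _ _); dfn
  | |- Deff _ (fun x => _ + _) => refine (Deff_add _ _); dfn
  | |- Deff _ (fun x => - _) => refine (Deff_opp _); dfn
  | |- Deff _ (fun x => _ * _) => refine (Deff_mul _ _); dfn
  | |- Deff _ (fun x => _ ^-1) => refine (Deff_inv _); dfn
  | |- Deff _ (fun x => _ ^+ _) => refine (Deff_exp _ _); dfn
  | |- Deff _ (fun x => `| _ |) => refine (Deff_norm _); dfn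
  | |- Deff _ (fun x => fun_of_matrix _ _ _) => refine (Deff_row _ _); dfn
  | |- Deff _ (fun x => \row_i _) => refine (Deff_mkrow _); dfn
  | |- Deff _ (fun x => if `[< _ >] then _ else _) => refine (Deff_if _ _ _); dfn
  | |- Deff _ _ => first
    [ lazymatch goal with |- Deff _ (fun x => ?h (@?f x) (@?g x)) =>
        refine (@Deff_subst2 _ _ _ _ _ _ _ _ _ _ _ h f g _ _ _); [dfn_leaf|dfn|dfn] end
    | lazymatch goal with |- Deff _ (fun x => ?h (@?f x)) =>
        refine (@Deff_comp _ _ _ _ _ _ _ _ _ h f _ _); [dfn|dfn_leaf] end ]
  | |- _ => dfn_leaf
  end].
Create HintDb dfn.

(** * Definable subsets and functions of one variable *)

Section Line.
Context {R : rcfType} (S : forall n : nat, set (set 'rV[R]_n)).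
Arguments S : clear implicits.
Context {HS : ominimal_structure S}.
Local Notation Def := (Def S).
Local Notation Deff := (Deff S).

Definition rgerm (a : R) (P : R -> Prop) : Prop :=
  exists e : R, 0 < e /\ forall x : R, a < x -> x < a + e -> P x.
Definition lgerm (a : R) (P : R -> Prop) : Prop :=
  exists e : R, 0 < e /\ forall x : R, a - e < x -> x < a -> P x.

Lemma rgerm_sub a (P Q : R -> Prop) : (forall x, P x -> Q x) -> rgerm a P -> rgerm a Q.
Proof. by move=> PQ [e [e0 h]]; exists e; split=> // x h1 h2; apply/PQ/h. Qed.
Lemma lgerm_sub a (P Q : R -> Prop) : (forall x, P x -> Q x) -> lgerm a P -> lgerm a Q.
Proof. by move=> PQ [e [e0 h]]; exists e; split=> // x h1 h2; apply/PQ/h. Qed.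
Lemma rgerm_and a (P Q : R -> Prop) : rgerm a P -> rgerm a Q -> rgerm a (fun x => P x /\ Q x).
Proof.
move=> [e [e0 h]] [d [d0 k]]; exists (Num.min e d); split; first by rewrite lt_min e0.
by move=> x ax; rewrite -ltrBlDl lt_min !ltrBlDl => /andP[]; split; [apply: h|apply: k].
Qed.
Lemma rgerm_ex a b (P : R -> Prop) : rgerm a P -> a < b -> exists x, [/\ a < x, x < b & P x].
Proof.
move=> [e [e0 h]] ab; have m0 : 0 < Num.min e (b - a) by rewrite lt_min e0 subr_gt0.
have m1 : Num.min e (b - a) <= e by rewrite ge_min lexx.
have m2 : Num.min e (b - a) <= b - a by rewrite ge_min lexx orbT.
by exists (a + Num.min e (b - a) / 2); split; [lra|lra|apply: h; lra].
Qed.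
Lemma lgerm_opp a (P : R -> Prop) : lgerm a P <-> rgerm (- a) (fun x => P (- x)).
Proof.
split=> -[e [e0 h]]; exists e; split=> // x h1 h2; first by apply: h; lra.
by rewrite -[x]opprK; apply: h; lra.
Qed.
Lemma lgerm_and a (P Q : R -> Prop) : lgerm a P -> lgerm a Q -> lgerm a (fun x => P x /\ Q x).
Proof. by rewrite !lgerm_opp; exact: rgerm_and. Qed.
Lemma lgerm_ex a b (P : R -> Prop) : lgerm b P -> a < b -> exists x, [/\ a < x, x < b & P x].
Proof.
rewrite lgerm_opp => h ab; have [|x [h1 h2 h3]] := rgerm_ex h (b := - a); first by lra.
by exists (- x); split=> //; lra.
Qed.

Lemma Def_itvs (A : R -> Prop) : Def A ->
  exists s : seq (interval R), forall x, A x <-> has (fun i => x \in i) s.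
Proof.
move=> dA; have [_ [_ [_ [_ [_ [_ [_ [_ [_ [_ [_ h]]]]]]]]]]] := HS.
have [s hs] := h _ dA; exists s => x; have := hs (const_mx x).
by rewrite /= !mxE.
Qed.

(** Comparison with a fixed endpoint has constant truth value just to the right of [a], and this
    property survives the Boolean combinations that build a finite union of intervals. Definable
    right germs therefore decide every definable property, which replaces one-sided limits in what
    follows. *)
Lemma rgerm_dich (A : R -> Prop) a : Def A -> rgerm a A \/ rgerm a (fun x => ~ A x).
Proof.
move=> /Def_itvs[s hs].
have lo (c : R) b : rgerm a (fun x => c < x ?<= if b) \/ rgerm a (fun x => ~~ (c < x ?<= if b)).
  have [ca|ac] := leP c a.
    by left; exists 1; split=> // x ax _; apply: lteifS; exact: le_lt_trans ca ax.
  right; exists (c - a); split=> [|x _ h]; first by rewrite subr_gt0.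
  by case: b; rewrite /Order.lteif -?ltNge -?leNgt; lra.
have up (c : R) b : rgerm a (fun x => x < c ?<= if b) \/ rgerm a (fun x => ~~ (x < c ?<= if b)).
  have [ca|ac] := leP c a.
    by right; exists 1; split=> // x ax _; case: b; rewrite /Order.lteif -?ltNge -?leNgt; lra.
  by left; exists (c - a); split=> [|x _ h]; [rewrite subr_gt0|apply: lteifS; lra].
have triv (b : bool) : rgerm a (fun=> b) \/ rgerm a (fun=> ~~ b).
  by case: b; [left|right]; exists 1.
have cnj (p q : R -> bool) : rgerm a p \/ rgerm a (fun x => ~~ p x) ->
    rgerm a q \/ rgerm a (fun x => ~~ q x) ->
    rgerm a (fun x => p x && q x) \/ rgerm a (fun x => ~~ (p x && q x)).
  move=> [hp|hp] [hq|hq]; last first.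
  - by right; apply: rgerm_sub hp => x /negbTE ->.
  - by right; apply: rgerm_sub hp => x /negbTE ->.
  - by right; apply: rgerm_sub hq => x /negbTE ->; rewrite andbF.
  - by left; apply: rgerm_sub (rgerm_and hp hq) => x [-> ->].
have itv (i : interval R) : rgerm a (fun x => x \in i) \/ rgerm a (fun x => ~~ (x \in i)).
  have := cnj (fun x => match i with Interval l u => match l with BSide b lb => lb < x ?<= if b | BInfty b => b end end)
    (fun x => match i with Interval l u => match u with BSide b ub => x < ub ?<= if ~~ b | BInfty b => ~~ b end end).
  case: i => l u h; have [||k|k] := h; [by case: l {h} => *|by case: u {h} => *| |].
    by left; apply: rgerm_sub k => x; rewrite in_itv.
  by right; apply: rgerm_sub k => x; rewrite in_itv.
suff [h|h] : rgerm a (fun x => has (fun i => x \in i) s) \/ rgerm a (fun x => ~~ has (fun i => x \in i) s).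
- by left; apply: rgerm_sub h => x /hs.
- by right; apply: rgerm_sub h => x /negP h /hs.
elim: s {hs} => [|i s ih] /=; first by right; exists 1.
have [hi|hi] := itv i; first by left; apply: rgerm_sub hi => x ->.
case: ih => ih; first by left; apply: rgerm_sub ih => x ->; rewrite orbT.
by right; apply: rgerm_sub (rgerm_and hi ih) => x [/negbTE -> /negbTE ->].
Qed.

Lemma lgerm_dich (A : R -> Prop) a : Def A -> lgerm a A \/ lgerm a (fun x => ~ A x).
Proof. by move=> dA; rewrite !lgerm_opp; apply: (rgerm_dich (A := fun x => A (- x))); dfn. Qed.

(** Among the finitely many intervals forming [A], either one contains two points, hence everything
    between them, or each contributes at most one point. *)
Lemma Def_itv_or_finite (A : R -> Prop) : Def A ->
  (exists a b : R, a < b /\ forall x, a < x -> x < b -> A x) \/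
  (exists l : seq R, forall x, A x -> x \in l).
Proof.
move=> /Def_itvs[s hs].
have [[i [x [y [si ix iy xy]]]]|h] := pselect (exists i (x y : R), [/\ i \in s, x \in i, y \in i & x < y]).
  left; exists x, y; split=> // z xz zy; apply/hs/hasP; exists i => //.
  by apply: (@interval_is_interval _ i x y) => //; rewrite (ltW xz) (ltW zy).
right; exists [seq xget 0 [set` i] | i <- s] => x /hs/hasP[i si ix].
apply/mapP; exists i => //; apply/eqP; apply: contrapT => /negP.
have ig : xget 0 [set` i] \in i by have := @xgetPex _ 0 [set` i] (ex_intro _ x ix).
by rewrite neq_lt => /orP[] xy; apply: h; [exists i, x, (xget 0 [set` i])|exists i, (xget 0 [set` i]), x].
Qed.

Definition islub (A : R -> Prop) (s : R) : Prop :=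
  (forall x, A x -> x <= s) /\ (forall M, (forall x, A x -> x <= M) -> s <= M).

Lemma islub_uniq A s t : islub A s -> islub A t -> s = t.
Proof. by move=> [h1 h2] [k1 k2]; apply/eqP; rewrite eq_le h2// k2. Qed.

(** The field need not be complete, but a finite union of intervals bounded above has the largest
    right endpoint of its nonempty members as supremum; the induction takes the maximum of two
    suprema. *)
Lemma Def_lub (A : R -> Prop) : Def A -> (exists x, A x) ->
  (exists M, forall x, A x -> x <= M) -> exists s, islub A s.
Proof.
move=> /Def_itvs[s hs] [x0 Ax0] [M hM].
suff [||t ht] : (exists x, has (fun i => x \in i) s) ->
   (forall x, has (fun i => x \in i) s -> x <= M) -> exists t, islub (fun x => has (fun i => x \in i) s) t.
- by exists x0; apply/hs.
- by move=> x /hs/hM.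
- exists t; case: ht => h1 h2; split=> [x /hs/h1//|N hN]; apply: h2 => x /hs; exact: hN.
elim: s {hs} => [[//]|i s ih] /= hex hub.
have [[y iy]|ni] := pselect (exists y, y \in i); last first.
  have [||t [h1 h2]] := ih.
  - by case: hex => z /orP[zi|zs]; [case: ni; exists z|exists z].
  - by move=> z zs; apply: hub; rewrite zs orbT.
  exists t; split=> [z /orP[zi|/h1//]|N hN]; first by case: ni; exists z.
  by apply: h2 => z zs; apply: hN; rewrite zs orbT.
have [u [u1 u2]] : exists u, islub (fun x => x \in i) u.
  have ub z : z \in i -> z <= M by move=> zi; apply: hub; rewrite zi.
  case: i {hex hub} iy ub => l [b u|b]; rewrite in_itv /= => /andP[ly yu] ub.
    exists u; split=> [z|N hN]; first by rewrite in_itv => /andP[_ /lteifW].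
    rewrite leNgt; apply/negP => Nu.
    have yu' : y < u.
      rewrite lt_neqAle (lteifW yu) andbT; apply/negP => /eqP e.
      by have := hN y; rewrite in_itv /= ly yu => /(_ isT); rewrite e leNgt Nu.
    (* If [N < u] were an upper bound, this midpoint would be a point of the interval beyond [N]. *)
    set z := (Num.max y N + u) / 2.
    have m1 : y <= Num.max y N by rewrite le_max lexx.
    have m2 : N <= Num.max y N by rewrite le_max lexx orbT.
    have m3 : Num.max y N < u by rewrite gt_max yu'.
    have zu : z < u by rewrite /z; lra.
    have : z <= N.
      apply: hN; rewrite in_itv /= (lteifS _ zu) andbT.
      have yz : y < z by rewrite /z; lra.
      by case: l ly {ub} => // c v cy; apply: lteifS; apply: (@le_lt_trans _ _ y) => //; exact: lteifW cy.
    by rewrite leNgt /z => /negP; apply; lra.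
  exfalso; case: b yu ub => // _ ub.
  have : Num.max y M + 1 <= M.
    apply: ub; rewrite in_itv /= andbT.
    have m1 : y <= Num.max y M by rewrite le_max lexx.
    by case: l ly => // c v /lteifW cy; apply: lteifS; lra.
  have m2 : M <= Num.max y M by rewrite le_max lexx orbT.
  by lra.
have [hs|ns] := pselect (exists x, has (fun i => x \in i) s); last first.
  exists u; split=> [z /orP[/u1//|zs]|N hN]; first by case: ns; exists z.
  by apply: u2 => z zi; apply: hN; rewrite zi.
have [//|z zs|t [h1 h2]] := ih; first by apply: hub; rewrite zs orbT.
exists (Num.max u t); split=> [z /orP[/u1|/h1] h|N hN].
- by rewrite le_max h.
- by rewrite le_max h orbT.
- rewrite ge_max u2; last by move=> z zi; apply: hN; rewrite zi.
  by apply: h2 => z zs; apply: hN; rewrite zs orbT.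
Qed.

(** The value [0] is a default when there is no least upper bound, so that the operation is total
    and definable in families. *)
Definition dsup (A : R -> Prop) : R := xget 0 [set s | islub A s].

Lemma dsupP A : Def A -> (exists x, A x) -> (exists M, forall x, A x -> x <= M) -> islub A (dsup A).
Proof. by move=> dA h1 h2; have [s hs] := Def_lub dA h1 h2; apply: (@xgetPex _ 0 [set s | islub A s]); exists s. Qed.

Lemma Deff_dsup X `{DT R X} (A : X -> R -> Prop) :
  Def (fun p : X * R => A p.1 p.2) -> Deff (fun x => dsup (A x)).
Proof.
move=> dA; apply: (Deff_rel (G := fun x y => islub (A x) y \/
   ((~ exists s : R, islub (A x) s) /\ y = 0))).
  move=> x y; split=> [[h|[h ->]]|->].
  - have h' : islub (A x) (dsup (A x)) by apply: (@xgetPex _ 0 [set s | islub (A x) s]); exists y.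
    exact: islub_uniq h h'.
  - by rewrite /dsup xgetPN// => t ht; apply: h; exists t.
  - have [h|h] := pselect (exists s, islub (A x) s).
      by left; apply: (@xgetPex _ 0 [set s | islub (A x) s]).
    by right; split=> //; rewrite /dsup xgetPN// => t ht; apply: h; exists t.
by rewrite /islub; dfn.
Qed.

(* A canonical positive element of a definable set having one: its infimum, or
   the midpoint of the first gap-free piece above the infimum. *)
Definition dpos (A : R -> Prop) : R :=
  let s := - dsup (fun x => 0 < - x /\ A (- x)) in
  if `[< 0 < s /\ A s >] then s
  else (s + dsup (fun t => t <= s + 1 /\ forall y : R, s < y -> y < t -> A y)) / 2.
Definition dchoice (A : R -> Prop) : R :=
  if `[< A 0 >] then 0
  else if `[< exists x : R, 0 < x /\ A x >] then dpos A else - dpos (fun x => A (- x)).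

(** Let [s] be the infimum of the positive part. If [s] does not itself qualify, the right germ at
    [s] must lie in [A], since otherwise the infimum would be at least [s + e]. The cap [s + 1] in
    [dpos] makes the supremum of that first piece finite. *)
Lemma dposP (A : R -> Prop) : Def A -> (exists x : R, 0 < x /\ A x) -> A (dpos A).
Proof.
move=> dA [x0 [x00 Ax0]]; rewrite /dpos; set s := - dsup _.
have [h1 h2] : islub (fun x => 0 < - x /\ A (- x)) (- s).
  rewrite /s opprK; apply: dsupP.
  - by dfn.
  - by exists (- x0); rewrite opprK.
  - by exists 0 => x [x1 _]; lra.
have s0 : 0 <= s by rewrite -oppr_le0; apply: h2 => x [x1 _]; lra.
have sle x : 0 < x -> A x -> s <= x.
  by move=> x1 Ax; have := h1 (- x); rewrite opprK => /(_ (conj x1 Ax)); lra.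
case: asboolP => [[]//|ns].
have gap : rgerm s A.
  have [//|[e [e0 h]]] := rgerm_dich s dA.
  suff : - s <= - (s + e) by lra.
  apply: h2 => x [x1 Ax]; have sx := sle _ x1 Ax.
  have : s != - x by apply/eqP => E; apply: ns; rewrite E.
  move=> /eqP ne; have {}sx : s < - x by rewrite lt_neqAle sx andbT; apply/eqP.
  by rewrite lerNr leNgt; apply/negP => lt; exact: (h (- x)).
have [e [e0 h]] := gap; set t := dsup _.
have m0 : 0 < Num.min e 1 by rewrite lt_min e0 ltr01.
have m1 : Num.min e 1 <= e by rewrite ge_min lexx.
have m2 : Num.min e 1 <= 1 by rewrite ge_min lexx orbT.
have m3 : s + Num.min e 1 <= s + 1 /\ forall y : R, s < y -> y < s + Num.min e 1 -> A y.
  by split=> [|y sy ye]; [lra|apply: h => //; lra].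
have [k1 k2] : islub (fun t => t <= s + 1 /\ forall y : R, s < y -> y < t -> A y) t.
  apply: dsupP; first by dfn.
    by exists (s + Num.min e 1).
  by exists (s + 1) => x [].
have st : s < t by have := k1 _ m3; lra.
have [z [[_ hz] mz]] : exists z, (z <= s + 1 /\ (forall y : R, s < y -> y < z -> A y)) /\ (s + t) / 2 < z.
  apply: contrapT => nz; suff : t <= (s + t) / 2 by lra.
  by apply: k2 => x hx; rewrite leNgt; apply/negP => lx; apply: nz; exists x.
by apply: hz => //; lra.
Qed.

(** Definable choice. The chosen point depends on the set alone, so equal fibres receive equal
    representatives; the selection of one point per component in the uniform finiteness argument
    relies on this. *)
Lemma dchoiceP A : Def A -> (exists x, A x) -> A (dchoice A).
Proof.
move=> dA [x Ax]; rewrite /dchoice; case: asboolP => // n0; case: asboolP => [|np]; first exact: dposP.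
apply: (@dposP (fun x => A (- x))); first by dfn.
exists (- x); rewrite opprK; split=> //; rewrite oppr_gt0 ltNge le_eqVlt; apply/negP => /orP[/eqP e|x0].
  by apply: n0; rewrite e.
by apply: np; exists x.
Qed.

Lemma Deff_dpos X `{DT R X} (A : X -> R -> Prop) :
  Def (fun p : X * R => A p.1 p.2) -> Deff (fun x => dpos (A x)).
Proof.
move=> dA; have d1 : Deff (fun x => dsup (fun z => 0 < - z /\ A x (- z))) by apply: Deff_dsup; dfn.
have d2 : Deff (fun x => dsup (fun t => t <= - dsup (fun z => 0 < - z /\ A x (- z)) + 1 /\
    forall y : R, - dsup (fun z => 0 < - z /\ A x (- z)) < y -> y < t -> A x y)).
  apply: (Deff_dsup (A := fun x t => t <= - dsup (fun z => 0 < - z /\ A x (- z)) + 1 /\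
    forall y : R, - dsup (fun z => 0 < - z /\ A x (- z)) < y -> y < t -> A x y)).
  have d1' : Deff (fun p : X * R => dsup (fun z => 0 < - z /\ A p.1 (- z))).
    by apply: (Deff_comp (g := fun x => dsup (fun z => 0 < - z /\ A x (- z))) (f := fst)) => //; dfn.
  have d1'' : Deff (fun p : X * R * R => dsup (fun z => 0 < - z /\ A p.1.1 (- z))).
    by apply: (Deff_comp (g := fun x => dsup (fun z => 0 < - z /\ A x (- z))) (f := fun p => p.1.1)) => //; dfn.
  apply: Def_and; first by apply: Def_le; [dfn|apply: Deff_add; [exact: Deff_opp|dfn]].
  apply: Def_all; apply: Def_imp; first by apply: Def_lt; [exact: Deff_opp|dfn].
  by dfn.
by apply: Deff_if; [apply: Def_and; [apply: Def_lt; [dfn|exact: Deff_opp]|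
  apply: (Def_subst2 (P := A) (f := id)) => //; [exact: Deff_id|exact: Deff_opp]]|exact: Deff_opp|
  apply: Deff_mul; [apply: Deff_add => //; exact: Deff_opp|dfn]].
Qed.

Lemma Deff_dchoice X `{DT R X} (A : X -> R -> Prop) :
  Def (fun p : X * R => A p.1 p.2) -> Deff (fun x => dchoice (A x)).
Proof.
move=> dA; apply: Deff_if; first by apply: (Def_subst2 (P := A) (f := id)) => //; dfn.
  by dfn.
apply: Deff_if; [by dfn|exact: Deff_dpos|].
by apply: Deff_opp; apply: (Deff_dpos (A := fun x z => A x (- z))); dfn.
Qed.

Definition contR (f : R -> R) (x : R) : Prop :=
  forall e : R, 0 < e -> exists d : R, 0 < d /\ forall y, `|y - x| < d -> `|f y - f x| < e.

(** Continuous induction. Take the supremum [s] of the [w] such that [f x <= f] on [[x, w]]: the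
    condition on left germs carries the inequality to [s] itself, and the condition on right germs
    carries it beyond [s] unless the end is reached. *)
Lemma nondecr_of_local (f : R -> R) (a b : R) : Deff f ->
  (forall x, a < x -> x < b -> rgerm x (fun y => f x <= f y)) ->
  (forall x v, a < x -> x < b -> lgerm x (fun y => v <= f y) -> v <= f x) ->
  forall x y, a < x -> x < y -> y < b -> f x <= f y.
Proof.
move=> df hr hl x y ax xy yb.
pose E w := x <= w /\ w <= y /\ forall z : R, x <= z -> z <= w -> f x <= f z.
have Ex : E x by split=> //; split=> [|z h1 h2]; [exact: ltW|rewrite (_ : z = x)//; lra].
have [h1 h2] : islub E (dsup E).
  by apply: dsupP; [rewrite /E; dfn|exists x|exists y => w [_ []]].
set s := dsup E in h1 h2.
have xs : x <= s by apply: h1.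
have sy : s <= y by apply: h2 => w [_ []].
have hz z : x <= z -> z < s -> f x <= f z.
  move=> xz zs; have [w [[_ [_ hw]] zw]] : exists w, E w /\ z < w.
    apply: contrapT => n; suff : s <= z by lra.
    by apply: h2 => w Ew; rewrite leNgt; apply/negP => zw; apply: n; exists w.
  by apply: hw => //; exact: ltW.
have hs : f x <= f s.
  have [->//|xs'] := eqVneq x s; have {}xs' : x < s by rewrite lt_neqAle xs' xs.
  apply: hl; [lra|lra|exists (s - x); split=> [|z z1 z2]; first by lra].
  by apply: hz => //; lra.
have [sy'|] := ltP s y; last by move=> ys; rewrite (_ : y = s)//; lra.
exfalso; have [e [e0 he]] := hr s (lt_le_trans ax xs) (lt_trans sy' yb).
have m0 : 0 < Num.min e (y - s) by rewrite lt_min e0 subr_gt0.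
have m1 : Num.min e (y - s) <= e by rewrite ge_min lexx.
have m2 : Num.min e (y - s) <= y - s by rewrite ge_min lexx orbT.
suff : s + Num.min e (y - s) / 2 <= s by lra.
apply: h1; split; [lra|split; [lra|move=> z z1 z2]].
have [zs|sz] := ltP z s; first exact: hz.
have [->//|ne] := eqVneq z s; have sz' : s < z by rewrite lt_neqAle eq_sym ne sz.
by apply: le_trans hs _; apply: he => //; lra.
Qed.

Definition nondecr_on (f : R -> R) (a b : R) : Prop :=
  forall x y, a < x -> x < y -> y < b -> f x <= f y.
Definition noninc_on (f : R -> R) (a b : R) : Prop :=
  forall x y, a < x -> x < y -> y < b -> f y <= f x.

Definition locmin_on (f : R -> R) (a b : R) : Prop :=
  forall x, a < x -> x < b -> rgerm x (fun y => f x < f y) /\ lgerm x (fun y => f x < f y).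

(** Call [x] good if [f x < f] on all of [(x, b)]. Goodness near [b] contradicts strict minimality
    from the left. So points near [b] are not good, and for such an [x] the values of [f] are
    eventually at most [f x]. The infimum of the places after which this holds is a point where [f]
    drops from above [f x] to at most [f x]. Such drops accumulate at [b], hence by the dichotomy
    fill an interval ending there. *)
Lemma locmin_jump (f : R -> R) (a b : R) : Deff f -> a < b -> locmin_on f a b ->
  exists c, [/\ a <= c, c < b & forall z, c < z -> z < b ->
    exists v : R, lgerm z (fun y => v < f y) /\ rgerm z (fun y => f y <= v)].
Proof.
move=> df ab lm.
pose B x := forall y : R, x < y -> y < b -> f x < f y.
have dB : Def B by rewrite /B; dfn.
have [[e [e0 he]]|[e [e0 he]]] := lgerm_dich b dB.
  exfalso; pose x := (Num.max a (b - e) + b) / 2.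
  have m1 : a <= Num.max a (b - e) by rewrite le_max lexx.
  have m2 : b - e <= Num.max a (b - e) by rewrite le_max lexx orbT.
  have m3 : Num.max a (b - e) < b by rewrite gt_max ab ltrBlDr ltrDl.
  have [x1 x2] : a < x /\ x < b by rewrite /x; lra.
  have x3 : Num.max a (b - e) < x by rewrite /x; lra.
  have [y [y1 y2 y3]] := lgerm_ex (lm x x1 x2).2 x3.
  have yB : B y by apply: he; lra.
  by have := yB x y2 x2; lra.
pose a1 := Num.max a (b - e).
have m1 : a <= a1 by rewrite le_max lexx.
have m2 : b - e <= a1 by rewrite le_max lexx orbT.
have m3 : a1 < b by rewrite gt_max ab ltrBlDr ltrDl.
pose Psi z := exists v : R, lgerm z (fun y => v < f y) /\ rgerm z (fun y => f y <= v).
have dPsi : Def Psi by rewrite /Psi /lgerm /rgerm; dfn.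
suff ex x : a1 < x -> x < b -> exists z, [/\ x < z, z < b & Psi z].
  have [[d [d0 hd]]|[d [d0 hd]]] := lgerm_dich b dPsi.
    exists (Num.max a1 (b - d)); split; first by rewrite le_max m1.
      by rewrite gt_max m3 ltrBlDr ltrDl.
    by move=> z; rewrite gt_max => /andP[_ h1] h2; exact: hd.
  exfalso; pose x := (Num.max a1 (b - d) + b) / 2.
  have n1 : a1 <= Num.max a1 (b - d) by rewrite le_max lexx.
  have n2 : b - d <= Num.max a1 (b - d) by rewrite le_max lexx orbT.
  have n3 : Num.max a1 (b - d) < b by rewrite gt_max m3 ltrBlDr ltrDl.
  have [||z [z1 z2 z3]] := ex x; [by rewrite /x; lra|by rewrite /x; lra|].
  by apply: (hd z) => //; move: z1; rewrite /x; lra.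
move=> x1 x2; have ax : a < x by lra.
have [c [c1 c2 c3]] : exists c, [/\ x < c, c < b & forall y, c < y -> y < b -> f y <= f x].
  have dx : Def (fun y => f y <= f x) by dfn.
  have [[d [d0 hd]]|[d [d0 hd]]] := lgerm_dich b dx.
    have n1 : x <= Num.max x (b - d) by rewrite le_max lexx.
    have n2 : b - d <= Num.max x (b - d) by rewrite le_max lexx orbT.
    have n3 : Num.max x (b - d) < b by rewrite gt_max x2 ltrBlDr ltrDl.
    exists ((Num.max x (b - d) + b) / 2); split; [lra|lra|move=> y y1 y2; apply: hd => //; lra].
  (* If [f > f x] near [b], the last point [z] with values at most [f x] before it is either good or
     approached from the left by smaller values; both are excluded. *)
  exfalso; pose E y := x < y /\ y < b /\ f y <= f x.
  have [y0 Ey0] : exists y, E y.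
    apply: contrapT => n; apply: (he x) => //; first by lra.
    move=> y y1 y2; rewrite ltNge; apply/negP => y3; apply: n; by exists y.
  have [h1 h2] : islub E (dsup E).
    by apply: dsupP; [rewrite /E; dfn|exists y0|exists b => y [_ [/ltW]]].
  set z := dsup E in h1 h2.
  have xz : x < z by apply: lt_le_trans (h1 _ Ey0); case: Ey0.
  have zb : z < b.
    apply: (@le_lt_trans _ _ (b - d)); last by lra.
    apply: h2 => y [y1 [y2 y3]]; rewrite leNgt; apply/negP => y4; exact: (hd y).
  have [fz|fz] := leP (f z) (f x).
    apply: (he z) => //; first by lra.
    move=> y zy yb; rewrite ltNge; apply/negP => fy.
    by have : y <= z by [apply: h1; split; [lra|split=> //; lra]]; lra.
  have [y [y1 y2]] := (lm z (lt_trans ax xz) zb).2.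
  have [w [Ew wy]] : exists w, E w /\ z - y < w.
    apply: contrapT => n; suff : z <= z - y by lra.
    by apply: h2 => w Ew; rewrite leNgt; apply/negP => wy; apply: n; exists w.
  have wz : w <= z by apply: h1.
  case: Ew => w1 [w2 w3]; have wz' : w != z by apply/eqP => e'; move: w3; rewrite e'; lra.
  by have := y2 w wy; rewrite lt_neqAle wz' wz => /(_ isT); lra.
pose W z := x <= z /\ z <= c /\ forall y : R, z < y -> y < b -> f y <= f x.
have Wc : W c by split; [exact: ltW|split].
have [h1 h2] : islub (fun z => W (- z)) (dsup (fun z => W (- z))).
  apply: dsupP; first by rewrite /W; dfn.
    by exists (- c); rewrite opprK.
  by exists (- x) => z [h _]; lra.
set t := dsup _ in h1 h2; pose bt := - t.
have Wle z : W z -> bt <= z by move=> Wz; have := h1 (- z); rewrite opprK /bt => /(_ Wz); lra.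
have bW r : 0 < r -> exists z, W z /\ z < bt + r.
  move=> r0; apply: contrapT => n; suff : t <= t - r by lra.
  apply: h2 => z Wz; rewrite leNgt; apply/negP => tz; apply: n; exists (- z); split=> //.
  by rewrite /bt; lra.
have right y : bt < y -> y < b -> f y <= f x.
  move=> y1 y2; have [|z [[_ [_ hz]] z1]] := bW (y - bt); first by lra.
  by apply: hz => //; lra.
have btc : bt <= c by apply: Wle.
have xbt : x < bt.
  have [d [d0 hd]] := (lm x ax x2).1.
  have : x + d <= bt.
    rewrite leNgt; apply/negP => lt.
    have [|z [[z1 [z2 hz]] z3]] := bW (x + d - bt); first by lra.
    have zz : z < x + d by lra.
    have [||y [y1 y2 y3]] := @rgerm_ex z (Num.min b (x + d)) (fun y => f x < f y).
    - by exists (x + d - z); split=> [|y y1 y2]; [lra|apply: hd; lra].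
    - by rewrite lt_min zz andbT; lra.
    by move: y2; rewrite lt_min => /andP[yb _]; have := hz y y1 yb; lra.
  by lra.
have btb : bt < b by lra.
exists bt; split=> //; exists (f x); split; last first.
  by exists (b - bt); split=> [|y y1 y2]; [lra|apply: right => //; lra].
have dx : Def (fun y => f x < f y) by dfn.
have [//|[d [d0 hd]]] := lgerm_dich bt dx; exfalso.
have fbt : f bt <= f x.
  rewrite leNgt; apply/negP => lt.
  have [y [y1 y2 y3]] := rgerm_ex (lm bt (lt_trans ax xbt) btb).1 btb.
  by have := right y y1 y2; lra.
pose z := Num.max x (bt - d / 2).
have n1 : x <= z by rewrite le_max lexx.
have n2 : bt - d / 2 <= z by rewrite le_max lexx orbT.
have n3 : z < bt by rewrite gt_max xbt /=; lra.
suff : bt <= z by lra.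
apply: Wle; split=> //; split; first by lra.
move=> y y1 y2; have [y3|y3] := ltP bt y; first exact: right.
have [->//|yn] := eqVneq y bt; rewrite leNgt; apply/negP; apply: hd; first by move: y1 n2 d0; lin.
by rewrite lt_neqAle yn.
Qed.

(** The jump lemma applied to [f] and then to its reflection gives a point at which [f] jumps down
    across some [v] and up across some [w]; this forces both [v < w] and [w < v]. *)
Lemma locmin_false (f : R -> R) (a b : R) : Deff f -> a < b -> ~ locmin_on f a b.
Proof.
move=> df ab lm; have [c [ac cb hc]] := locmin_jump df ab lm.
have df' : Deff (fun x => f (- x)) by dfn.
have lm' : locmin_on (fun x => f (- x)) (- b) (- c).
  move=> x x1 x2; have [||h1 h2] := lm (- x); [lra|lra|].
  split; first by move: h2; rewrite lgerm_opp opprK.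
  by rewrite lgerm_opp; move: h1; apply: rgerm_sub => y; rewrite opprK.
have [|d [bd dc hd]] := locmin_jump df' _ lm'; first by lra.
pose z : R := (c - d) / 2.
have [||v [v1 v2]] := hc z; [by rewrite /z; lra|by rewrite /z; lra|].
have [||w [w1 w2]] := hd (- z); [by rewrite /z; lra|by rewrite /z; lra|].
have w1' : rgerm z (fun y => w < f y) by move: w1; rewrite lgerm_opp opprK; apply: rgerm_sub => y; rewrite opprK.
have w2' : lgerm z (fun y => f y <= w) by rewrite lgerm_opp.
have [|y [_ _ [y1 y2]]] := rgerm_ex (b := z + 1) (rgerm_and v2 w1'); first by lra.
by have [|y' [_ _ [y1' y2']]] := lgerm_ex (a := z - 1) (lgerm_and v1 w2'); lra.
Qed.

Lemma rgerm_of_ex (A : R -> Prop) a : Def A ->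
  (forall b, a < b -> exists x, [/\ a < x, x < b & A x]) -> rgerm a A.
Proof.
move=> dA h; have [//|[e [e0 he]]] := rgerm_dich a dA.
by have [|x [x1 x2 x3]] := h (a + e); [lra|case: (he x x1 x2)].
Qed.

Lemma itv_cover (A B : R -> Prop) (a b : R) : Def A -> a < b ->
  (forall x, a < x -> x < b -> A x \/ B x) ->
  exists c d : R, [/\ a <= c, c < d, d <= b &
    (forall x, c < x -> x < d -> A x) \/ (forall x, c < x -> x < d -> B x)].
Proof.
move=> dA ab h.
have [[e [e0 he]]|[e [e0 he]]] := rgerm_dich a dA; exists a, (Num.min (a + e) b);
  (split; [by []|by rewrite lt_min ab andbT; lra|by rewrite ge_min lexx orbT|]).
  by left=> x x1; rewrite lt_min => /andP[x2 x3]; exact: he.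
right=> x x1; rewrite lt_min => /andP[x2 x3].
by have [/(he _ x1 x2)|] := h x x1 x3.
Qed.

Lemma itv_avoid (l : seq R) (a b : R) : a < b -> exists x, [/\ a < x, x < b & x \notin l].
Proof.
elim: l a b => [|y l ih] a b ab; first by exists ((a + b) / 2); split=> //; lra.
have [ya|ya] := leP y ((a + b) / 2).
  by have [|x [x1 x2 x3]] := ih ((a + b) / 2) b; [lra|exists x; split=> //; [lra|rewrite inE negb_or x3 andbT; apply/eqP; lra]].
by have [|x [x1 x2 x3]] := ih a ((a + b) / 2); [lra|exists x; split=> //; [lra|rewrite inE negb_or x3 andbT; apply/eqP; lra]].
Qed.

Lemma sign_germs (f : R -> R) x : Deff f ->
  [\/ rgerm x (fun y => f x < f y), rgerm x (fun y => f y < f x) | rgerm x (fun y => f y = f x)].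
Proof.
move=> df.
have d1 : Def (fun y => f x < f y) by dfn.
have d2 : Def (fun y => f y < f x) by dfn.
have [h|h] := rgerm_dich x d1; first by constructor 1.
have [k|k] := rgerm_dich x d2; first by constructor 2.
by constructor 3; apply: rgerm_sub (rgerm_and h k) => y [/negP ? /negP ?]; lra.
Qed.

Lemma const_of_rgerm (f : R -> R) (a b : R) : Deff f -> a < b ->
  (forall x, a < x -> x < b -> rgerm x (fun y => f y = f x)) ->
  exists c d : R, [/\ a <= c, c < d, d <= b & forall x y, c < x -> x < d -> c < y -> y < d -> f x = f y].
Proof.
move=> df ab h; have [||e [e0 he]] := h ((a + b) / 2); [lra|lra|].
have m1 : (a + b) / 2 + Num.min e ((b - a) / 2) <= b.
  have : Num.min e ((b - a) / 2) <= (b - a) / 2 by rewrite ge_min lexx orbT.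
  by lra.
have m2 : Num.min e ((b - a) / 2) <= e by rewrite ge_min lexx.
have m0 : 0 < Num.min e ((b - a) / 2) by rewrite lt_min e0 /=; lra.
exists ((a + b) / 2), ((a + b) / 2 + Num.min e ((b - a) / 2)); split; [lra|lra|lra|].
by move=> x y x1 x2 y1 y2; rewrite !he//; lra.
Qed.

(** Classify points by the sign of [f y - f x] on the two germs at [x], and pass to a subinterval on
    which the type is constant. Strict local minima or maxima everywhere are impossible, a zero sign
    on one side gives a constant piece, and the two remaining types are globally monotone by
    continuous induction. *)
Lemma monotone_gen (f : R -> R) (a b : R) : Deff f -> a < b ->
  exists c d : R, [/\ a <= c, c < d, d <= b &
   [\/ (forall x y, c < x -> x < d -> c < y -> y < d -> f x = f y),
      (forall x y, c < x -> x < y -> y < d -> f x < f y) |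
      (forall x y, c < x -> x < y -> y < d -> f y < f x)]].
Proof.
move=> df ab.
have dfo : Deff (fun x => f (- x)) by dfn.
pose Rp x := rgerm x (fun y => f x < f y). pose Rn x := rgerm x (fun y => f y < f x).
pose Re x := rgerm x (fun y => f y = f x). pose Lp x := lgerm x (fun y => f x < f y).
pose Ln x := lgerm x (fun y => f y < f x). pose Le x := lgerm x (fun y => f y = f x).
have dRp : Def Rp by rewrite /Rp /rgerm; dfn.
have dRn : Def Rn by rewrite /Rn /rgerm; dfn.
have dLp : Def Lp by rewrite /Lp /lgerm; dfn.
have dLn : Def Ln by rewrite /Ln /lgerm; dfn.
have R3 x : Rp x \/ (Rn x \/ Re x) by case: (sign_germs x df); rewrite /Rp /Rn /Re; tauto.
have L3 x : Lp x \/ (Ln x \/ Le x).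
  by rewrite /Lp /Ln /Le !lgerm_opp; case: (sign_germs (- x) dfo); rewrite opprK; tauto.
have sub (c d : R) : a <= c -> c < d -> d <= b ->
  (exists c' d' : R, [/\ c <= c', c' < d', d' <= d &
   [\/ (forall x y, c' < x -> x < d' -> c' < y -> y < d' -> f x = f y),
      (forall x y, c' < x -> x < y -> y < d' -> f x < f y) |
      (forall x y, c' < x -> x < y -> y < d' -> f y < f x)]]) ->
  (exists c d : R, [/\ a <= c, c < d, d <= b &
   [\/ (forall x y, c < x -> x < d -> c < y -> y < d -> f x = f y),
      (forall x y, c < x -> x < y -> y < d -> f x < f y) |
      (forall x y, c < x -> x < y -> y < d -> f y < f x)]]).
  by move=> ac cd db [c' [d' [h1 h2 h3 h4]]]; exists c', d'; split=> //; lra.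
have cstR (c d : R) : c < d -> (forall x, c < x -> x < d -> Re x) ->
  (exists c' d' : R, [/\ c <= c', c' < d', d' <= d &
   [\/ (forall x y, c' < x -> x < d' -> c' < y -> y < d' -> f x = f y),
      (forall x y, c' < x -> x < y -> y < d' -> f x < f y) |
      (forall x y, c' < x -> x < y -> y < d' -> f y < f x)]]).
  by move=> cd h; have [c' [d' [h1 h2 h3 h4]]] := const_of_rgerm df cd h; exists c', d'; split=> //; constructor 1.
have cstL (c d : R) : c < d -> (forall x, c < x -> x < d -> Le x) ->
  (exists c' d' : R, [/\ c <= c', c' < d', d' <= d &
   [\/ (forall x y, c' < x -> x < d' -> c' < y -> y < d' -> f x = f y),
      (forall x y, c' < x -> x < y -> y < d' -> f x < f y) |
      (forall x y, c' < x -> x < y -> y < d' -> f y < f x)]]).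
  move=> cd h; have [||c' [d' [h1 h2 h3 h4]]] := @const_of_rgerm (fun x => f (- x)) (- d) (- c) dfo.
  - by lra.
  - by move=> x x1 x2; have := h (- x); rewrite /Le lgerm_opp opprK; apply; lra.
  exists (- d'), (- c'); split; [lra|lra|lra|constructor 1 => x y x1 x2 y1 y2].
  by have := h4 (- x) (- y); rewrite !opprK; apply; lra.
have dec (g : R -> R) (c d : R) : Deff g -> c < d ->
  (forall x, c < x -> x < d -> rgerm x (fun y => g x < g y)) ->
  (forall x, c < x -> x < d -> lgerm x (fun y => g y < g x)) ->
  forall x y, c < x -> x < y -> y < d -> g x < g y.
  move=> dg cd hr hl x y x1 xy y1.
  have nd : nondecr_on g c d.
    apply: nondecr_of_local => //.
      by move=> z z1 z2; apply: rgerm_sub (hr z z1 z2) => w /ltW.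
    move=> z v z1 z2 hv; have [|w [_ _ [w1 w2]]] := lgerm_ex (a := z - 1) (lgerm_and hv (hl z z1 z2)); first by lra.
    by lra.
  have [z [z1 z2 z3]] := rgerm_ex (hr x x1 (lt_trans xy y1)) xy.
  by apply: lt_le_trans z3 _; apply: nd => //; lra.
have [c [d [h1 h2 h3 [hR|hR]]]] := itv_cover dRp ab (fun x _ _ => R3 x); apply: (sub _ _ h1 h2 h3).
- have [c1 [d1 [h4 h5 h6 [hL|hL]]]] := itv_cover dLp h2 (fun x _ _ => L3 x).
    by exfalso; apply: (locmin_false df h5) => x x1 x2; split; [apply: hR; lra|exact: hL].
  have [c2 [d2 [h7 h8 h9 [hL'|hL']]]] := itv_cover dLn h5 hL.
    exists c2, d2; split; [lra|lra|lra|constructor 2].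
    by apply: dec => // x x1 x2; apply: hR; lra.
  by have [c3 [d3 [k1 k2 k3 k4]]] := cstL _ _ h8 hL'; exists c3, d3; split=> //; lra.
- have [c1 [d1 [h4 h5 h6 [hR'|hR']]]] := itv_cover dRn h2 hR; last first.
    by have [c3 [d3 [k1 k2 k3 k4]]] := cstR _ _ h5 hR'; exists c3, d3; split=> //; lra.
  have [c2 [d2 [h7 h8 h9 [hL|hL]]]] := itv_cover dLp h5 (fun x _ _ => L3 x).
    exists c2, d2; split; [lra|lra|lra|constructor 3] => x y x1 xy y1.
    rewrite -ltrN2; apply: (dec (fun x => - f x) c2 d2) => //; first by dfn.
    + by move=> z z1 z2; apply: rgerm_sub (hR' z _ _) => [w|//|//]; lra.
    + by move=> z z1 z2; apply: lgerm_sub (hL z _ _) => [w|//|//]; lra.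
  have [c3 [d3 [k1 k2 k3 [hL'|hL']]]] := itv_cover dLn h8 hL.
    exfalso; apply: (@locmin_false (fun x => - f x) c3 d3) => //; first by dfn.
    move=> x x1 x2; split; first by apply: rgerm_sub (hR' x _ _) => [w|//|//]; lra.
    by apply: lgerm_sub (hL' x _ _) => [w|//|//]; lra.
  by have [c4 [d4 [j1 j2 j3 j4]]] := cstL _ _ k2 hL'; exists c4, d4; split=> //; lra.
Qed.

(** The image of an injective function on an interval is infinite, so it contains an interval; a
    strictly increasing function that takes all values of an interval is continuous where its values
    lie inside. *)
Lemma contR_of_incr (f : R -> R) (a b : R) : Deff f -> a < b ->
  (forall x y, a < x -> x < y -> y < b -> f x < f y) ->
  exists c d : R, [/\ a <= c, c < d, d <= b & forall x, c < x -> x < d -> contR f x].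
Proof.
move=> df ab inc.
pose J y := exists x : R, a < x /\ x < b /\ f x = y.
have dJ : Def J by rewrite /J; dfn.
have inj x y : a < x -> x < b -> a < y -> y < b -> f x = f y -> x = y.
  move=> x1 x2 y1 y2 e; have [h|h|//] := ltgtP x y.
    by have := inc x y x1 h y2; rewrite e ltxx.
  by have := inc y x y1 h x2; rewrite e ltxx.
have [[u [v [uv hJ]]]|[l hl]] := Def_itv_or_finite dJ; last first.
  have [x [x1 x2 /negP x3]] := itv_avoid [seq xget 0 [set x | a < x /\ x < b /\ f x = y] | y <- l] ab.
  case: x3; apply/mapP; exists (f x); first by apply: hl; exists x.
  have [|/= y1 [y2 y3]] := @xgetPex _ 0 [set z | a < z /\ z < b /\ f z = f x]; first by exists x.
  exact: inj.
(* Preimages of the two points of trisection: between them the values keep a margin of [(v - u) / 3]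
   inside the image interval, so that [f x - r / 2] and [f x + r / 2] are attained as well. *)
have [||p [p1 [p2 p3]]] := hJ (u + (v - u) / 3); [lra|lra|].
have [||q [q1 [q2 q3]]] := hJ (u + (v - u) / 3 * 2); [lra|lra|].
have pq : p < q.
  have [//|qp|e] := ltgtP p q; last by move: p3; rewrite e q3; lra.
  by have := inc q p q1 qp p2; lra.
exists p, q; split; [lra|lra|lra|move=> x px xq e e0].
have fx1 := inc p x p1 px (lt_trans xq q2); have fx2 := inc x q (lt_trans p1 px) xq q2.
pose r := Num.min e ((v - u) / 3).
have r0 : 0 < r by rewrite lt_min e0 /=; lra.
have r1 : r <= e by rewrite ge_min lexx.
have r2 : r <= (v - u) / 3 by rewrite ge_min lexx orbT.
have [||s [s1 [s2 s3]]] := hJ (f x - r / 2); [lra|lra|].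
have [||t [t1 [t2 t3]]] := hJ (f x + r / 2); [lra|lra|].
have sx : s < x.
  have [//|xs|e'] := ltgtP s x; last by move: s3; rewrite e'; lra.
  by have := inc x s (lt_trans p1 px) xs s2; lra.
have xt : x < t.
  have [//|tx|e'] := ltgtP x t; last by move: t3; rewrite -e'; lra.
  by have := inc t x t1 tx (lt_trans xq q2); lra.
exists (Num.min (x - s) (t - x)); split; first by rewrite lt_min !subr_gt0 sx.
move=> y; rewrite lt_min !ltr_norml => /andP[/andP[h1 h2] /andP[h3 h4]].
have := inc s y s1 (_ : s < y) (_ : y < b); have := inc y t (_ : a < y) (_ : y < t) t2.
have sy : s < y by move: h1; lin.
have yt : y < t by move: h4; lin.
move=> /(_ (lt_trans s1 sy) yt) k1 /(_ sy (lt_trans yt t2)) k2.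
by apply/andP; split; move: k1 k2 s3 t3 r0 r1; lin.
Qed.

Lemma mono_cont_gen (f : R -> R) (a b : R) : Deff f -> a < b ->
  exists c d : R, [/\ a <= c, c < d, d <= b,
    (nondecr_on f c d \/ noninc_on f c d) & forall x, c < x -> x < d -> contR f x].
Proof.
move=> df ab; have [c [d [h1 h2 h3 [h|h|h]]]] := monotone_gen df ab.
- exists c, d; split=> //; first by left=> x y x1 xy y1; rewrite (h x y)//; lra.
  move=> x x1 x2 e e0; exists (Num.min (x - c) (d - x)); split; first by rewrite lt_min !subr_gt0 x1.
  move=> y; rewrite lt_min !ltr_norml => /andP[/andP[? ?] /andP[? ?]].
  by rewrite (h y x) ?subrr ?oppr_lt0 ?e0//; lra.
- have [c' [d' [k1 k2 k3 k4]]] := contR_of_incr df h2 h.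
  by exists c', d'; split=> //; [lra|lra|left=> x y x1 xy y1; apply/ltW/h; lra].
- have dg : Deff (fun x => - f x) by dfn.
  have [|c' [d' [k1 k2 k3 k4]]] := contR_of_incr dg h2.
    by move=> x y x1 xy y1; rewrite ltrN2; exact: h.
  exists c', d'; split=> //; [lra|lra|right=> x y x1 xy y1; apply/ltW/h; lra|].
  move=> x x1 x2 e e0; have [r [r0 hr]] := k4 x x1 x2 e e0; exists r; split=> // y /hr.
  by rewrite -opprD normrN.
Qed.
End Line.

(** * Differentiability in one variable *)

Section LineDeriv.
Context {R : rcfType} (S : forall n : nat, set (set 'rV[R]_n)).
Arguments S : clear implicits.
Context {HS : ominimal_structure S}.
Local Notation Def := (Def S).
Local Notation Deff := (Deff S).

(** The derivative as a first-order formula in [x] and [l], hence definable. The bound is not strict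
    so that [h = 0] is allowed. *)
Definition isd (f : R -> R) (x l : R) : Prop :=
  forall e : R, 0 < e -> exists d : R, 0 < d /\
    forall h : R, `|h| < d -> `|f (x + h) - f x - l * h| <= e * `|h|.

Lemma pos_min2 (a b : R) : 0 < a -> 0 < b -> exists k, [/\ 0 < k, k <= a & k <= b].
Proof.
by move=> a0 b0; exists (Num.min a b); rewrite lt_min a0 b0 !ge_min !lexx orbT.
Qed.

Lemma contR_lgerm (f : R -> R) x v : contR f x -> lgerm x (fun y => v <= f y) -> v <= f x.
Proof.
move=> cf [d [d0 hd]]; rewrite leNgt; apply/negP => lt.
have [|r [r0 hr]] := cf (v - f x); first by lra.
have [||y [y1 y2 y3]] := @lgerm_ex _ (x - r) x (fun y => v <= f y); [by exists d|by lra|].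
have : `|f y - f x| < v - f x by apply: hr; rewrite ltr_norml; apply/andP; split; lra.
by rewrite ltr_norml => /andP[h1 h2]; lra.
Qed.

Lemma slope_germ (f : R -> R) (a b c : R) : Deff f ->
  (forall x, a < x -> x < b -> contR f x) ->
  (forall x, a < x -> x < b -> rgerm x (fun y => c * (y - x) <= f y - f x)) ->
  forall x y, a < x -> x < y -> y < b -> c * (y - x) <= f y - f x.
Proof.
move=> df cf hg x y ax xy yb.
suff : f x - c * x <= f y - c * y by lra.
apply: (@nondecr_of_local _ S HS (fun z => f z - c * z) a b) => //; first by dfn.
  by move=> z z1 z2; apply: rgerm_sub (hg z z1 z2) => w; lra.
move=> z v z1 z2; apply: contR_lgerm => e e0.
have k0 : 0 < e / (2 * (1 + `|c|)) by apply: divr_gt0 => //; have := normr_ge0 c; lra.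
have [|r [r0 hr]] := cf z z1 z2 (e / 2); first by lra.
exists (Num.min r (e / (2 * (1 + `|c|)))); split; first by rewrite lt_min r0.
move=> w; rewrite lt_min => /andP[/hr h1 h2].
have h3 : `|c| * `|w - z| <= e / 2.
  have : (1 + `|c|) * `|w - z| <= (1 + `|c|) * (e / (2 * (1 + `|c|))).
    by rewrite ler_wpM2l ?ltW//; have := normr_ge0 c; lra.
  have -> : (1 + `|c|) * (e / (2 * (1 + `|c|))) = e / 2 by field; have := normr_ge0 c; lra.
  by have := normr_ge0 (w - z); lra.
have -> : f w - c * w - (f z - c * z) = (f w - f z) - c * (w - z) by ring.
by apply: le_lt_trans (ler_normB _ _) _; rewrite normrM; lra.
Qed.

Lemma isd_cont (f : R -> R) x l : isd f x l -> contR f x.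
Proof.
move=> h e e0; have [d [d0 hd]] := h 1 ltr01.
have k0 : 0 < e / (1 + `|l|) by apply: divr_gt0 => //; have := normr_ge0 l; lra.
exists (Num.min d (e / (1 + `|l|))); split; first by rewrite lt_min d0.
move=> y; rewrite lt_min => /andP[/hd]; rewrite (_ : x + (y - x) = y) ?mul1r; [move=> h1 h2|by ring].
have h3 : (1 + `|l|) * `|y - x| < e.
  by have := h2; rewrite ltr_pdivlMr; [rewrite mulrC|have := normr_ge0 l; lra].
have -> : f y - f x = (f y - f x - l * (y - x)) + l * (y - x) by ring.
by apply: le_lt_trans (ler_normD _ _) _; rewrite normrM; lra.
Qed.

(** A mean value inequality without Rolle: for [eta > 0] the function grows with slope at least
    [m - eta] on every right germ, hence on every inner interval, and the ends are reached by
    continuity. *)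
Lemma isd_slope (f r : R -> R) (a b m : R) : Deff f -> a < b ->
  (forall x, a <= x -> x <= b -> isd f x (r x)) ->
  (forall x, a < x -> x < b -> m <= r x) -> m * (b - a) <= f b - f a.
Proof.
move=> df ab hf hr.
have inner x y : a < x -> x < y -> y < b -> m * (y - x) <= f y - f x.
  move=> ax xy yb; rewrite leNgt; apply/negP => lt.
  (* With this [eta] the slope [m - eta] predicts an increment halfway between the actual one and
     the one wanted. *)
  pose eta := (m * (y - x) - (f y - f x)) / (2 * (y - x)).
  have eta0 : 0 < eta by apply: divr_gt0; lra.
  have : (m - eta) * (y - x) <= f y - f x.
    apply: (@slope_germ f a b) => // z z1 z2; first by apply: isd_cont (hf z _ _); lra.
    have [|||d [d0 hd]] := hf z _ _ eta => //; [lra|lra|].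
    exists d; split=> // w w1 w2; have := hd (w - z); rewrite gtr0_norm ?subr_gt0// => /(_ _).
    rewrite (_ : z + (w - z) = w); last by ring.
    rewrite ler_norml => h; have /andP[h1 _] : - (eta * (w - z)) <= f w - f z - r z * (w - z) <= eta * (w - z) by apply: h; lra.
    have : m * (w - z) <= r z * (w - z) by rewrite ler_wpM2r//; [lra|exact: hr].
    by lra.
  have -> : (m - eta) * (y - x) = (m * (y - x) + (f y - f x)) / 2 by rewrite /eta; field; lra.
  by lra.
(* A quarter of the deficit: the two end errors of [f] and the lost length [m * k] cost at most [e]
   each. *)
rewrite leNgt; apply/negP => lt; pose e := (m * (b - a) - (f b - f a)) / 4.
have e0 : 0 < e by rewrite /e; lra.
have [||da [da0 hda]] := isd_cont (hf a _ _) e0; [lra|lra|].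
have [||db [db0 hdb]] := isd_cont (hf b _ _) e0; [lra|lra|].
have m0 : 0 <= `|m| by [].
have e1 : 0 < e / (1 + `|m|) by apply: divr_gt0 => //; lra.
have [k1 [k10 k1a k1b]] := pos_min2 da0 db0.
have [k2 [k20 k2a k2b]] := @pos_min2 ((b - a) / 2) _ ltac:(lra) e1.
have [k [k0 ka kb]] := pos_min2 k10 k20.
have k4 : (1 + `|m|) * k <= e.
  have : k <= e / (1 + `|m|) by lra.
  by rewrite ler_pdivlMr 1?mulrC//; lra.
have := inner (a + k / 2) (b - k / 2); have := hda (a + k / 2); have := hdb (b - k / 2).
have -> : a + k / 2 - a = k / 2 by ring.
have -> : b - k / 2 - b = - (k / 2) by ring.
rewrite normrN gtr0_norm; last by lra.
move=> /(_ ltac:(lra)); rewrite ltr_norml => /andP[h1 h2].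
move=> /(_ ltac:(lra)); rewrite ltr_norml => /andP[h3 h4].
move=> /(_ ltac:(lra) ltac:(lra) ltac:(lra)) h5.
have : `|m * k| <= e by rewrite normrM (gtr0_norm k0); lra.
rewrite ler_norml => /andP[h6 h7].
have ee : 4 * e = m * (b - a) - (f b - f a) by rewrite /e; field.
move: h1 h2 h3 h4 h5 h6 h7 ee {lt}; clearbody e => *; lra.
Qed.

Lemma isd_opp (f : R -> R) x l : isd f x l -> isd (fun z => - f z) x (- l).
Proof.
move=> h e e0; have [d [d0 hd]] := h e e0; exists d; split=> // k /hd.
by rewrite -normrN; congr (`|_| <= _); ring.
Qed.

(** The right derivative is the supremum of the slopes that [f] exceeds on the right germ. It cannot
    be infinite on a whole interval, because comparing the increment between two points with their
    mean slope plus one would give a contradiction; the value minus infinity is treated through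
    [- f]. *)
Lemma rderiv_gen (f : R -> R) (a b : R) : Deff f -> a < b ->
  (forall x, a < x -> x < b -> contR f x) ->
  exists (c d : R) (r : R -> R), [/\ a <= c, c < d, d <= b, Deff r &
   forall x, c < x -> x < d -> forall e : R, 0 < e ->
     rgerm x (fun y => (r x - e) * (y - x) < f y - f x) /\
     rgerm x (fun y => f y - f x <= (r x + e) * (y - x))].
Proof.
move=> df ab cf.
pose U (g : R -> R) x c := rgerm x (fun y => c * (y - x) < g y - g x).
have dU g : Deff g -> Def (fun p : R * R => U g p.1 p.2) by move=> dg; rewrite /U /rgerm; dfn.
have noinf g (c d : R) : Deff g -> c < d -> (forall x, c < x -> x < d -> contR g x) ->
    ~ (forall x, c < x -> x < d -> forall v, U g x v).
  move=> dg cd cg h; pose x := c + (d - c) / 3; pose y := c + (d - c) / 3 * 2.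
  have [x1 [xy y1]] : c < x /\ x < y /\ y < d by rewrite /x /y; split; [|split]; lra.
  have : ((g y - g x) / (y - x) + 1) * (y - x) <= g y - g x.
    by apply: (@slope_germ g c d) => // z z1 z2; apply: rgerm_sub (h z z1 z2 ((g y - g x) / (y - x) + 1)) => w /ltW.
  have -> : ((g y - g x) / (y - x) + 1) * (y - x) = g y - g x + (y - x) by field; lra.
  by lra.
have dUf := dU f df.
have d1 : Def (fun x => forall v : R, U f x v) by dfn.
have [c1 [d1' [h1 h2 h3 [h|h]]]] := itv_cover d1 ab (fun x _ _ => EM _).
  by exfalso; apply: (noinf f c1 d1') => // x x1 x2; apply: cf; lra.
have d2 : Def (fun x => forall v : R, ~ U f x v) by dfn.
have [c [d [k1 k2 k3 [k|k]]]] := itv_cover d2 h2 (fun x _ _ => EM _).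
  exfalso; apply: (noinf (fun x => - f x) c d) => //; first by dfn.
    move=> x x1 x2 e e0; have [||t [t0 ht]] := cf x _ _ e e0; [lra|lra|exists t; split=> // y /ht].
    by rewrite -opprD normrN.
  move=> x x1 x2 v; have dd : Def (fun y => (- v - 1) * (y - x) < f y - f x) by dfn.
  have [kk|[t [t0 ht]]] := rgerm_dich x dd; first by case: (k x x1 x2 _ kk).
  by exists t; split=> // y y1 y2; have := ht y y1 y2 => /negP; rewrite -leNgt; lra.
exists c, d, (fun x => dsup (U f x)); split; [lra|lra|lra|exact: Deff_dsup|].
move=> x x1 x2 e e0.
have dUx : Def (U f x) by dfn.
have down u v : U f x u -> v <= u -> U f x v.
  move=> [t [t0 ht]] vu; exists t; split=> // y y1 y2; apply: le_lt_trans (ht y y1 y2).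
  by rewrite ler_wpM2r//; lra.
have [u Uu] : exists u, U f x u.
  apply: contrapT => n; apply: (k x x1 x2) => v Uv; by apply: n; exists v.
have [w Uw] : exists w, ~ U f x w.
  apply: contrapT => n; apply: (h x) => [||v]; [lra|lra|apply: contrapT => Uv; apply: n; by exists v].
have [l1 l2] : islub (U f x) (dsup (U f x)).
  apply: dsupP => //; first by exists u.
  by exists w => v Uv; rewrite leNgt; apply/negP => wv; apply: Uw; apply: down Uv _; exact: ltW.
split.
  have [v [Uv lv]] : exists v, U f x v /\ dsup (U f x) - e < v.
    apply: contrapT => n; suff : dsup (U f x) <= dsup (U f x) - e by lra.
    by apply: l2 => v Uv; rewrite leNgt; apply/negP => lv; apply: n; exists v.
  by apply: down Uv _; lra.
have dd : Def (fun y => (dsup (U f x) + e) * (y - x) < f y - f x) by dfn.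
have [h'|h'] := rgerm_dich x dd; first by have := l1 _ h'; lra.
by apply: rgerm_sub h' => y /negP; rewrite -leNgt.
Qed.

Lemma contR_separate (u v : R -> R) (c d : R) : c < d -> (forall x, c < x -> x < d -> contR u x) ->
  (forall x, c < x -> x < d -> contR v x) -> (forall x, c < x -> x < d -> u x < v x) ->
  exists w c' d' : R, [/\ c <= c', c' < d', d' <= d & forall x, c' < x -> x < d' -> u x < w /\ w < v x].
Proof.
move=> cd cu cv uv; have [x0 [x1 x2]] : exists x0, c < x0 /\ x0 < d by exists ((c + d) / 2); lra.
have e0 : 0 < (v x0 - u x0) / 2 by have := uv _ x1 x2; lra.
have [s [s0 hs]] := cu x0 x1 x2 _ e0; have [t [t0 ht]] := cv x0 x1 x2 _ e0.
have [q1 [q10 qs qt]] := pos_min2 s0 t0.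
have [q2 [q20 qc qd]] := @pos_min2 (x0 - c) (d - x0) ltac:(lra) ltac:(lra).
have [q [q0 qa qb]] := pos_min2 q10 q20.
exists ((u x0 + v x0) / 2), (x0 - q), (x0 + q); split; [move: qb qc; lin|move: q0; lin|move: qb qd; lin|].
move=> x y1 y2; have xq : `|x - x0| < q by rewrite ltr_norml; apply/andP; split; move: y1 y2; lin.
have := hs x (lt_le_trans xq (le_trans qa qs)); have := ht x (lt_le_trans xq (le_trans qa qt)).
rewrite !ltr_norml => /andP[p1 _] /andP[_ p2].
by split; move: p1 p2; lin.
Qed.

Lemma isd_of_sides (f : R -> R) (x l : R) :
  (forall e : R, 0 < e -> rgerm x (fun y => (l - e) * (y - x) < f y - f x) /\
     rgerm x (fun y => f y - f x <= (l + e) * (y - x))) ->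
  (forall e : R, 0 < e -> lgerm x (fun y => (l + e) * (y - x) < f y - f x) /\
     lgerm x (fun y => f y - f x <= (l - e) * (y - x))) -> isd f x l.
Proof.
move=> hr hl e e0; have [u1 u2] := hr e e0; have [v1 v2] := hl e e0.
have [s [s0 hs]] := rgerm_and u1 u2; have [t [t0 ht]] := lgerm_and v1 v2.
have [k [k0 ks kt]] := pos_min2 s0 t0; exists k; split=> // h; rewrite ltr_norml => /andP[p1 p2].
have xh : x + h - x = h by ring.
have [h0|h0] := ltP h 0.
  have [||q1 q2] := ht (x + h); [move: p1 kt; lin|move: h0; lin|].
  rewrite xh in q1 q2; rewrite ler_norml (ltr0_norm h0).
  by apply/andP; split; move: q1 q2; lin.
have [->|hn] := eqVneq h 0; first by rewrite addr0 subrr mulr0 subr0 normr0 mulr0.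
have hp : 0 < h by rewrite lt_neqAle eq_sym hn.
have [||q1 q2] := hs (x + h); [move: hp; lin|move: p2 ks; lin|].
rewrite xh in q1 q2; rewrite ler_norml (gtr0_norm hp).
by apply/andP; split; move: q1 q2; lin.
Qed.

(** Left and right derivatives [l] and [r] exist and are continuous on a subinterval. If they
    differed throughout some interval, a constant [w] would separate them on a smaller one, and
    [w x - f x] or [f x - w x] would have a strict local minimum at every point. *)
Lemma deriv_gen (f : R -> R) (a b : R) : Deff f -> a < b ->
  exists (c d : R) (r : R -> R), [/\ a <= c, c < d, d <= b, Deff r &
    forall x, c < x -> x < d -> isd f x (r x)].
Proof.
move=> df ab; have [a0 [b0 [h1 h2 h3 _ cf]]] := mono_cont_gen df ab.
have [a1 [b1 [r [h4 h5 h6 dr hr]]]] := rderiv_gen df h2 cf.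
have df' : Deff (fun x => f (- x)) by dfn.
have [||a2 [b2 [l' [h7 h8 h9 dl' hl']]]] := @rderiv_gen (fun x => f (- x)) (- b1) (- a1) df'.
- by lra.
- move=> x x1 x2 e e0; have [||d [d0 hd]] := cf (- x) _ _ e e0; [lra|lra|].
  by exists d; split=> // y hy; apply: hd; rewrite -opprD normrN.
pose l x := - l' (- x).
have dl : Deff l by rewrite /l; dfn.
have h8' : - b2 < - a2 by lra.
have [a3 [b3 [h10 h11 h12 _ cr]]] := mono_cont_gen dr h8'.
have [a4 [b4 [h13 h14 h15 _ cl]]] := mono_cont_gen dl h11.
have {h10 h12 h13 h15 h1 h3 h4 h6 h7 h9} [k1 [k2 [k3 [k4 [k5 [k6 [k7 k8]]]]]]] :
    a <= a4 /\ b4 <= b /\ a1 <= a4 /\ b4 <= b1 /\ - b2 <= a4 /\ b4 <= - a2 /\ a3 <= a4 /\ b4 <= b3.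
  by repeat split; lra.
have {}hl x : a4 < x -> x < b4 -> forall e : R, 0 < e ->
     lgerm x (fun y => (l x + e) * (y - x) < f y - f x) /\
     lgerm x (fun y => f y - f x <= (l x - e) * (y - x)).
  move=> x1 x2 e e0; have [||u v] := hl' (- x) _ _ e e0; [move: x2 k6; lin|move: x1 k5; lin|].
  by rewrite /l !lgerm_opp; split; [apply: rgerm_sub u|apply: rgerm_sub v] => y; rewrite opprK; lin.
have {}hr x : a4 < x -> x < b4 -> forall e : R, 0 < e ->
     rgerm x (fun y => (r x - e) * (y - x) < f y - f x) /\ rgerm x (fun y => f y - f x <= (r x + e) * (y - x)).
  by move=> x1 x2; apply: hr; [move: x1 k3; lin|move: x2 k4; lin].
have {}cr x : a4 < x -> x < b4 -> contR r x by move=> x1 x2; apply: cr; [exact: le_lt_trans x1|exact: lt_le_trans k8].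
have dlt : Def (fun x => r x < l x) by dfn.
have dgt : Def (fun x => l x < r x) by dfn.
have [c [d [i1 i2 i3 [ilt|ige]]]] := itv_cover dlt h14 (fun x _ _ => EM _).
  exfalso; have wid x : c < x -> x < d -> a4 < x /\ x < b4.
    by move=> x1 x2; split; [exact: le_lt_trans x1|exact: lt_le_trans i3].
  have [|||w [c' [d' [j1 j2 j3 j4]]]] := @contR_separate r l c d i2 => //.
  - by move=> x x1 x2; have [? ?] := wid x x1 x2; exact: cr.
  - by move=> x x1 x2; have [? ?] := wid x x1 x2; exact: cl.
  apply: (@locmin_false _ S HS (fun x => w * x - f x) c' d') => //; first by dfn.
  move=> x x1 x2; have [w1 w2] := j4 x x1 x2.
  have [y1 y2] := wid x (le_lt_trans j1 x1) (lt_le_trans x2 j3); split.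
    have e0 : 0 < (w - r x) / 2 by move: w1; lin.
    have [_ [t [t0 ht]]] := hr x y1 y2 _ e0; exists t; split=> // y xy yt.
    have := ht y xy yt; have : 0 < (w - r x) / 2 * (y - x) by apply: mulr_gt0 => //; rewrite subr_gt0.
    by lin.
  have e0 : 0 < (l x - w) / 2 by move: w2; lin.
  have [_ [t [t0 ht]]] := hl x y1 y2 _ e0; exists t; split=> // y xy yt.
  have := ht y xy yt; have : 0 < (l x - w) / 2 * (x - y) by apply: mulr_gt0 => //; rewrite subr_gt0.
  by lin.
have [c1 [d1 [i4 i5 i6 ic]]] := itv_cover dgt i2 (fun x _ _ => EM _).
have wid x : c1 < x -> x < d1 -> a4 < x /\ x < b4.
  by move=> x1 x2; split; [move: i1 i4 x1; lin|move: i3 i6 x2; lin].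
case: ic => [igt|ile].
  exfalso; have [|||w [c' [d' [j1 j2 j3 j4]]]] := @contR_separate l r c1 d1 i5 => //.
  - by move=> x x1 x2; have [? ?] := wid x x1 x2; exact: cl.
  - by move=> x x1 x2; have [? ?] := wid x x1 x2; exact: cr.
  apply: (@locmin_false _ S HS (fun x => f x - w * x) c' d') => //; first by dfn.
  move=> x x1 x2; have [w1 w2] := j4 x x1 x2.
  have [y1 y2] := wid x (le_lt_trans j1 x1) (lt_le_trans x2 j3); split.
    have e0 : 0 < r x - w by rewrite subr_gt0.
    by have [[t [t0 ht]] _] := hr x y1 y2 _ e0; exists t; split=> // y xy yt; have := ht y xy yt; lin.
  have e0 : 0 < w - l x by rewrite subr_gt0.
  by have [[t [t0 ht]] _] := hl x y1 y2 _ e0; exists t; split=> // y xy yt; have := ht y xy yt; lin.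
exists c1, d1, r; split=> //; [move: k1 i1 i4; lin|move: k2 i3 i6; lin|move=> x x1 x2].
have [y1 y2] := wid x x1 x2; apply: isd_of_sides; first exact: hr.
have <- : l x = r x; last exact: hl.
apply/eqP; rewrite eq_le !leNgt; apply/andP; split; apply/negP; last exact: ile.
by apply: ige; [exact: le_lt_trans x1|exact: lt_le_trans i6].
Qed.
End LineDeriv.

(** * Generic continuity in several variables *)

Section Cubes.
Context {R : rcfType}.

Definition vcons n (t : R) (y : 'rV[R]_n) : 'rV[R]_n.+1 :=
  \row_i oapp (y ord0) t (unlift ord0 i).
Definition vtail n (x : 'rV[R]_n.+1) : 'rV[R]_n := \row_i x ord0 (lift ord0 i).

Lemma vcons0 n t (y : 'rV[R]_n) : vcons t y ord0 ord0 = t.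
Proof. by rewrite mxE unlift_none. Qed.
Lemma vconsS n t (y : 'rV[R]_n) i : vcons t y ord0 (lift ord0 i) = y ord0 i.
Proof. by rewrite mxE liftK. Qed.
Lemma vtail_cons n t (y : 'rV[R]_n) : vtail (vcons t y) = y.
Proof. by apply/rowP => i; rewrite mxE vconsS. Qed.
Lemma vconsE n (x : 'rV[R]_n.+1) : vcons (x ord0 ord0) (vtail x) = x.
Proof. by apply/rowP => i; rewrite mxE; case: unliftP => [j|] ->; rewrite /= ?mxE. Qed.

Definition cube n (x : 'rV[R]_n) (r : R) (y : 'rV[R]_n) : Prop :=
  forall i, `|y ord0 i - x ord0 i| < r.

Lemma cube_refl n (x : 'rV[R]_n) r : 0 < r -> cube x r x.
Proof. by move=> r0 i; rewrite subrr normr0. Qed.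
Lemma cube_sym n (x y : 'rV[R]_n) r : cube x r y -> cube y r x.
Proof. by move=> h i; rewrite distrC. Qed.
Lemma cube_le n (x y : 'rV[R]_n) r s : r <= s -> cube x r y -> cube x s y.
Proof. by move=> rs h i; apply: lt_le_trans (h i) rs. Qed.
Lemma cube_trans n (x y z : 'rV[R]_n) r s : cube x r y -> cube y s z -> cube x (r + s) z.
Proof.
move=> h k i; rewrite (_ : _ - _ = (y ord0 i - x ord0 i) + (z ord0 i - y ord0 i)); last by ring.
by apply: le_lt_trans (ler_normD _ _) _; apply: ltrD.
Qed.
Lemma cube_vcons n t s (y z : 'rV[R]_n) r :
  cube (vcons t y) r (vcons s z) <-> `|s - t| < r /\ cube y r z.
Proof.
split=> [h|[h k] i]; first by split=> [|i]; [have := h ord0|have := h (lift ord0 i)]; rewrite ?vcons0 ?vconsS.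
by have [j ->|->] := unliftP ord0 i; rewrite ?vcons0 ?vconsS.
Qed.

Lemma fin_pos_min (T : finType) (F : T -> R) : (forall i, 0 < F i) ->
  exists k : R, 0 < k /\ forall i, k <= F i.
Proof.
move=> F0; suff [k [k0 hk]] : exists k : R, 0 < k /\ forall i, i \in enum T -> k <= F i.
  by exists k; split=> // i; apply: hk; rewrite mem_enum.
elim: (enum T) => [|j s [k [k0 ih]]]; first by exists 1.
exists (Num.min k (F j)); split; first by rewrite lt_min k0 F0.
by move=> i; rewrite inE ge_min => /orP[/eqP->|/ih ->]//; rewrite lexx orbT.
Qed.

Lemma cube_open n (x y : 'rV[R]_n) r : cube x r y ->
  exists d, 0 < d /\ forall z, cube y d z -> cube x r z.
Proof.
move=> h; have [|d [d0 hd]] := @fin_pos_min _ (fun i => r - `|y ord0 i - x ord0 i|).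
  by move=> i; rewrite subr_gt0.
exists d; split=> // z k i; rewrite (_ : _ - _ = (z ord0 i - y ord0 i) + (y ord0 i - x ord0 i)); last by ring.
by apply: le_lt_trans (ler_normD _ _) _; rewrite -ltrBrDr; apply: lt_le_trans (k i) (hd i).
Qed.

Definition contV n (f : 'rV[R]_n -> R) (x : 'rV[R]_n) : Prop :=
  forall e : R, 0 < e -> exists d : R, 0 < d /\ forall y, cube x d y -> `|f y - f x| < e.
End Cubes.

Section Generic.
Context {R : rcfType} (S : forall n : nat, set (set 'rV[R]_n)).
Arguments S : clear implicits.
Context {HS : ominimal_structure S}.
Local Notation Def := (Def S).
Local Notation Deff := (Deff S).

Lemma Deff_vcons n : Deff (fun p : R * 'rV[R]_n => vcons p.1 p.2).
Proof.
apply: Deff_rows => i; have [j ->|->] := unliftP ord0 i.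
  by apply: (Deff_ext (f := fun p : R * 'rV[R]_n => p.2 ord0 j)) => [p|]; [rewrite vconsS|dfn].
by apply: (Deff_ext (f := fun p : R * 'rV[R]_n => p.1)) => [p|]; [rewrite vcons0|dfn].
Qed.
Lemma Deff_vtail n : Deff (@vtail R n).
Proof. by rewrite /vtail; dfn. Qed.
Lemma Def_cube n : Def (fun p : 'rV[R]_n * R * 'rV[R]_n => cube p.1.1 p.1.2 p.2).
Proof. by rewrite /cube; dfn. Qed.
Hint Resolve Deff_vcons Deff_vtail Def_cube : dfn.
Lemma Def_contV n (f : 'rV[R]_n -> R) : Deff f -> Def (contV f).
Proof. by move=> df; rewrite /contV; dfn. Qed.

(** Near [z] the value [g (s, v)] is squeezed, by monotonicity in [s], between the slices
    [s = t - q / 2] and [s = t + q / 2], and each of these is continuous in [v]. The local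
    monotonicity in the hypothesis has no uniform radius; continuous induction makes it uniform. *)
Lemma contV_of_slices n (g : 'rV[R]_n.+1 -> R) x1 (r1 : R) : Deff g ->
  (forall z, cube x1 r1 z -> exists e : R, 0 < e /\
     nondecr_on (fun s => g (vcons s (vtail z))) (z ord0 ord0 - e) (z ord0 ord0 + e) /\
     contR (fun s => g (vcons s (vtail z))) (z ord0 ord0)) ->
  (forall z, cube x1 r1 z -> contV (fun y => g (vcons (z ord0 ord0) y)) (vtail z)) ->
  forall z, cube x1 r1 z -> contV g z.
Proof.
move=> dg hup hsl z hz e e0.
have [d0 [d00 hd0]] := cube_open hz.
pose t := z ord0 ord0.
have inC s y : `|s - t| < d0 -> cube (vtail z) d0 y -> cube x1 r1 (vcons s y).
  by move=> h1 h2; apply: hd0; rewrite -[z]vconsE; apply/cube_vcons.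
have nd y : cube (vtail z) d0 y -> nondecr_on (fun s => g (vcons s y)) (t - d0) (t + d0).
  move=> hy; apply: nondecr_of_local; first by dfn.
    move=> s s1 s2; have [|q [q0 [hq _]]] := hup (vcons s y).
      by apply: inC => //; rewrite ltr_norml; apply/andP; split; move: s1 s2; lin.
    move: hq; rewrite vcons0 vtail_cons => hq; exists q; split=> // w w1 w2; by apply: hq; move: q0 w1 w2; lin.
  move=> s v s1 s2; apply: contR_lgerm.
  have [|q [q0 [_ hq]]] := hup (vcons s y); last by move: hq; rewrite vcons0 vtail_cons.
  by apply: inC => //; rewrite ltr_norml; apply/andP; split; move: s1 s2; lin.
have [_ [_ [_ ct]]] := hup z hz; rewrite -/t in ct.
have e2 : 0 < e / 2 by rewrite divr_gt0.
have [d1 [d10 hd1]] := ct _ e2; have [q [q0 q1 q2]] := pos_min2 d00 d10.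
have pt s : `|s - t| < d0 -> contV (fun y => g (vcons s y)) (vtail z).
  by move=> hs; have := hsl (vcons s (vtail z)) (inC _ _ hs (cube_refl _ d00)); rewrite vcons0 vtail_cons.
have tm : `|t - q / 2 - t| < q by rewrite ltr_norml; apply/andP; split; move: q0; lin.
have tp : `|t + q / 2 - t| < q by rewrite ltr_norml; apply/andP; split; move: q0; lin.
have [a [a0 ha]] := pt _ (lt_le_trans tm q1) _ e2.
have [b [b0 hb]] := pt _ (lt_le_trans tp q1) _ e2.
have [k [k0 k1 k2]] := pos_min2 a0 b0.
have [w [w0 w1 w2]] := @pos_min2 _ k (q / 2) k0 ltac:(by rewrite divr_gt0).
exists w; split=> // y; rewrite -[y]vconsE -[z in cube z]vconsE => /cube_vcons[].
rewrite -/t; move: (y ord0 ord0) (vtail y) => s v; rewrite ltr_norml => /andP[s1 s2] hv.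
have hv0 : cube (vtail z) d0 v by apply: cube_le hv; move: w2 q1 q0; lin.
have g1 : g (vcons (t - q / 2) v) <= g (vcons s v).
  by apply: (nd v hv0); move: q0 q1 s1 s2 w2; lin.
have g2 : g (vcons s v) <= g (vcons (t + q / 2) v).
  by apply: (nd v hv0); move: q0 q1 s1 s2 w2; lin.
have := ha v (cube_le (le_trans w1 k1) hv); have := hb v (cube_le (le_trans w1 k2) hv).
have := hd1 _ (lt_le_trans tm q2); have := hd1 _ (lt_le_trans tp q2); rewrite vconsE !ltr_norml.
move=> /andP[_ u1] /andP[u2 _] /andP[_ u3] /andP[u4 _].
by apply/andP; split; move: g1 g2 u1 u2 u3 u4; lin.
Qed.

(** The two statements need each other. The dichotomy in dimension [n + 1] uses generic continuity
    in dimension [n] for the length of the germ over [y]; generic continuity in dimension [n + 1]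
    then uses the new dichotomy to fix the direction of monotonicity and the continuity of the
    slices. *)
Lemma dich_cont_gen n :
  (forall A : 'rV[R]_n -> Prop, Def A -> forall x (r : R), 0 < r ->
    exists (x' : 'rV[R]_n) (r' : R), [/\ 0 < r', forall y, cube x' r' y -> cube x r y &
      (forall y, cube x' r' y -> A y) \/ (forall y, cube x' r' y -> ~ A y)]) /\
  (forall f : 'rV[R]_n -> R, Deff f -> forall x (r : R), 0 < r ->
    exists (x' : 'rV[R]_n) (r' : R), [/\ 0 < r', forall y, cube x' r' y -> cube x r y &
      forall y, cube x' r' y -> contV f y]).
Proof.
elim: n => [|n [ihP ihQ]].
  split=> [A _ x r r0|f _ x r r0]; exists x, r; split=> //.
    have [h|h] := pselect (A x); [left|right] => y _; by rewrite (_ : y = x)// thinmx0 [RHS]thinmx0.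
  by move=> y _ e e0; exists 1; split=> // z _; rewrite (_ : z = y) ?subrr ?normr0// thinmx0 [RHS]thinmx0.
have P : forall A : 'rV[R]_n.+1 -> Prop, Def A -> forall x (r : R), 0 < r ->
    exists (x' : 'rV[R]_n.+1) (r' : R), [/\ 0 < r', forall y, cube x' r' y -> cube x r y &
      (forall y, cube x' r' y -> A y) \/ (forall y, cube x' r' y -> ~ A y)].
  move=> A dA x r r0; pose t := x ord0 ord0.
  have main (B : 'rV[R]_n.+1 -> Prop) : Def B -> forall y0 (r1 : R), 0 < r1 ->
      (forall y, cube y0 r1 y -> cube (vtail x) r y) ->
      (forall y, cube y0 r1 y -> rgerm t (fun s => B (vcons s y))) ->
      exists (x' : 'rV[R]_n.+1) (r' : R), [/\ 0 < r', forall y, cube x' r' y -> cube x r y & forall y, cube x' r' y -> B y].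
    move=> dB y0 r1 r10 sub hg.
    (* [eps y] is how far the germ above [t] reaches over [y]; the cap [r] keeps it finite and
       inside the given cube. *)
    pose E y e := e <= r /\ forall s : R, t < s -> s < t + e -> B (vcons s y).
    pose eps y := dsup (E y).
    have deps : Deff eps by apply: (Deff_dsup (A := E)); rewrite /E; dfn.
    have epsP y : cube y0 r1 y -> 0 < eps y /\ forall s : R, t < s -> s < t + eps y -> B (vcons s y).
      move=> hy; have [e [e0 he]] := hg y hy.
      have [k [k0 ke kr]] := pos_min2 e0 r0.
      have Ek : E y k by split=> // s s1 s2; apply: he => //; lra.
      have [l1 l2] : islub (E y) (eps y).
        by apply: dsupP; [rewrite /E; dfn|exists k|exists r => z []].
      split; first by have := l1 _ Ek; lra.
      move=> s s1 s2; have [z [[_ hz] z1]] : exists z, E y z /\ s - t < z.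
        apply: contrapT => nz; suff : eps y <= s - t by lra.
        by apply: l2 => z Ez; rewrite leNgt; apply/negP => lz; apply: nz; exists z.
      by apply: hz => //; lra.
    have [y1 [r2 [r20 sub2 ceps]]] := ihQ eps deps y0 r1 r10.
    have hy1 : cube y0 r1 y1 by apply: sub2; exact: cube_refl.
    have [e0 _] := epsP y1 hy1.
    have [|d [d0 hd]] := ceps y1 (cube_refl _ r20) (eps y1 / 2); first by lra.
    have [k [k0 kd kr2]] := pos_min2 d0 r20.
    (* The new cube sits at height [t + q] with radius at most [q]: it stays above [t] and below
       [t + eps y1 / 2], where the germ still holds for all nearby [y]. *)
    have [q [q0 q1 q2]] := @pos_min2 _ (eps y1 / 8) (r / 4) ltac:(lra) ltac:(lra).
    have [w [w0 w1 w2]] := pos_min2 k0 q0.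
    exists (vcons (t + q) y1), w; split=> // z; rewrite -[z]vconsE => /cube_vcons[];
      rewrite ltr_norml => /andP[z1 z2] z3.
      rewrite -[x]vconsE; apply/cube_vcons; split; first by rewrite ltr_norml -/t; apply/andP; split; lra.
      by apply: sub; apply: sub2; apply: cube_le z3; lra.
    have z4 : cube y1 r2 (vtail z) by apply: cube_le z3; lra.
    have [_] := epsP _ (sub2 _ z4); apply.
      by move: z1; rewrite /t; lra.
    have : `|eps (vtail z) - eps y1| < eps y1 / 2 by apply: hd; apply: cube_le z3; lra.
    by rewrite ltr_norml => /andP[z5 z6]; move: z2; lra.
  have dg : Def (fun y => rgerm t (fun s => A (vcons s y))) by rewrite /rgerm; dfn.
  have [y0 [r1 [r10 sub [h|h]]]] := ihP _ dg (vtail x) r r0.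
    by have [x' [r' [h1 h2 h3]]] := main A dA y0 r1 r10 sub h; exists x', r'; split=> //; left.
  have [|x' [r' [h1 h2 h3]]] := main (fun y => ~ A y) (Def_not dA) y0 r1 r10 sub; last by exists x', r'; split=> //; right.
  move=> y hy; have dAy : Def (fun s => A (vcons s y)) by dfn.
  by have [/(h y hy)|] := rgerm_dich t dAy.
split=> // f df x r r0.
pose up z := exists e : R, 0 < e /\ nondecr_on (fun s => f (vcons s (vtail z))) (z ord0 ord0 - e) (z ord0 ord0 + e) /\
  contR (fun s => f (vcons s (vtail z))) (z ord0 ord0).
pose dn z := exists e : R, 0 < e /\ noninc_on (fun s => f (vcons s (vtail z))) (z ord0 ord0 - e) (z ord0 ord0 + e) /\
  contR (fun s => f (vcons s (vtail z))) (z ord0 ord0).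
have dup : Def up by rewrite /up /nondecr_on /contR; dfn.
have ddn : Def dn by rewrite /dn /noninc_on /contR; dfn.
(* Monotonicity and continuity hold generically on each vertical line, so [up] and [dn] cannot both
   fail on a whole cube. *)
have some (x1 : 'rV[R]_n.+1) (r1 : R) : 0 < r1 -> exists z, cube x1 r1 z /\ (up z \/ dn z).
  move=> r10; pose t := x1 ord0 ord0.
  have dfs : Deff (fun s => f (vcons s (vtail x1))) by dfn.
  have [|c [d [h1 h2 h3 hm hc]]] := @mono_cont_gen _ S HS _ (t - r1) (t + r1) dfs; first by lra.
  exists (vcons ((c + d) / 2) (vtail x1)); split.
    rewrite -[x1 in cube x1]vconsE; apply/cube_vcons; split; last exact: cube_refl.
    by rewrite -/t ltr_norml; apply/andP; split; lra.
  case: hm => hm; [left|right]; exists ((d - c) / 2); rewrite vcons0 vtail_cons; split; [lra| |lra| ];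
    (split; [move=> u v u1 uv v1; apply: hm; lra|apply: hc; lra]).
pose slc (z : 'rV[R]_n.+1) := contV (fun y => f (vcons (z ord0 ord0) y)) (vtail z).
have dslc : Def slc by rewrite /slc /contV; dfn.
have slice (x1 : 'rV[R]_n.+1) (r1 : R) : 0 < r1 -> exists (x' : 'rV[R]_n.+1) (r' : R), [/\ 0 < r', forall y, cube x' r' y -> cube x1 r1 y & forall z, cube x' r' z -> slc z].
  move=> r10; have [x2 [r2 [r20 sub [h|h]]]] := P _ dslc x1 r1 r10; first by exists x2, r2.
  exfalso; have dfs : Deff (fun y => f (vcons (x2 ord0 ord0) y)) by dfn.
  have [y' [r' [r'0 sub' c']]] := ihQ _ dfs (vtail x2) r2 r20.
  apply: (h (vcons (x2 ord0 ord0) y')).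
    rewrite -[x2 in cube x2]vconsE; apply/cube_vcons; rewrite subrr normr0; split=> //.
    by apply: sub'; exact: cube_refl.
  by rewrite /slc vcons0 vtail_cons; apply: c'; exact: cube_refl.
have [x1 [r1 [r10 sub1 [h|h]]]] := P _ dup x r r0.
  have [x2 [r2 [r20 sub2 h2]]] := slice x1 r1 r10.
  exists x2, r2; split=> // [y /sub2/sub1//|]; by apply: contV_of_slices => // z hz; apply: h; apply: sub2.
have [x2 [r2 [r20 sub2 [h2|h2]]]] := P _ ddn x1 r1 r10; last first.
  by have [z [hz [/h|/h2]]] := some x2 r2 r20; [case; exact: sub2|].
have [x3 [r3 [r30 sub3 h3]]] := slice x2 r2 r20.
exists x3, r3; split=> // [y /sub3/sub2/sub1//|].
have cN (X : 'rV[R]_n.+1) : contV (fun z => - f z) X -> contV f X.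
  by move=> h' e /h' [d [d0 hd]]; exists d; split=> // y /hd; rewrite -opprD normrN.
move=> z hz; apply: cN; apply: (@contV_of_slices _ (fun z => - f z) x3 r3) => // [|w hw|w hw]; first by dfn.
- have [e [e0 [he ce]]] := h2 w (sub3 _ hw); exists e; split=> //; split.
    by move=> u v u1 uv v1; rewrite lerN2; exact: he.
  by move=> e1 /ce[d [d0 hd]]; exists d; split=> // y /hd; rewrite -opprD normrN.
- by move=> e1 /(h3 w hw)[d [d0 hd]]; exists d; split=> // y /hd; rewrite -opprD normrN.
Qed.
End Generic.

(** * Differential calculus of definable functions *)

Section Calculus.
Context {R : rcfType}.

Lemma nbhs_cube n (x : 'rV[R]_n) (P : 'rV[R]_n -> Prop) :
  (\forall y \near x, P y) <-> exists r : R, 0 < r /\ forall y, cube x r y -> P y.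
Proof.
split.
  move=> /nbhs_ballP[r /= r0 h]; exists r; split=> // y hy; apply: h; split=> // i j.
  by rewrite !ord1 /ball /= distrC; exact: hy.
move=> [r [r0 h]]; apply/nbhs_ballP; exists r => //= y [_ hy]; apply: h => i.
by have := hy ord0 i; rewrite /ball /= distrC.
Qed.

Lemma norm_row_le n (v : 'rV[R]_n) i : `|v ord0 i| <= `|v|.
Proof.
rewrite leNgt; apply/negP => h; have vi : 0 < `|v ord0 i| by apply: le_lt_trans h.
have : ball (0 : 'rV[R]_n) `|v ord0 i| v by rewrite mx_norm_ball /ball_ /= sub0r normrN.
by case=> _ /(_ ord0 i); rewrite /ball /= mxE sub0r normrN ltxx.
Qed.

Lemma norm_row_ub n (v : 'rV[R]_n) c : 0 <= c -> (forall i, `|v ord0 i| <= c) -> `|v| <= c.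
Proof.
move=> c0 h; rewrite leNgt; apply/negP => lt.
have : ball (0 : 'rV[R]_n) `|v| v.
  split=> [|i j]; first exact: le_lt_trans lt.
  by rewrite !ord1 /ball /= mxE sub0r normrN; exact: le_lt_trans (h j) lt.
by rewrite mx_norm_ball /ball_ /= sub0r normrN ltxx.
Qed.

Lemma continuous_contV n (f : 'rV[R]_n -> R) (x : 'rV[R]_n) : {for x, continuous f} <-> contV f x.
Proof.
split.
  move=> /cvgrPdist_lt cf e e0; have /nbhs_cube[r [r0 h]] := cf e e0.
  by exists r; split=> // y /h; rewrite distrC.
move=> h; suff : f y @[y --> x] --> f x by [].
apply/(@cvgrPdist_lt _ _ _ (nbhs x) (nbhs_filter x)) => e e0; have [d [d0 hd]] := h e e0.
by apply/nbhs_cube; exists d; split=> // y /hd; rewrite distrC.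
Qed.

Definition hasD n (f : 'rV[R]_n -> R) (x : 'rV[R]_n) (g : 'I_n -> R) : Prop :=
  differentiable f x /\ forall i, 'd f x (delta_mx ord0 i) = g i.

Lemma hasD_lin n (f : 'rV[R]_n -> R) x g : hasD f x g -> forall v, 'd f x v = \sum_i v ord0 i * g i.
Proof.
move=> [_ h] v; rewrite {1}[v]row_sum_delta linear_sum; apply: eq_bigr => i _.
by rewrite linearZ /= h.
Qed.

Lemma hasD_contV n (f : 'rV[R]_n -> R) x g : hasD f x g -> contV f x.
Proof. by move=> [/differentiable_continuous h _]; apply/continuous_contV. Qed.

Lemma hasD_is_diff n (f : 'rV[R]_n -> R) x (g : 'I_n -> R) :
  hasD f x g <-> is_diff x f (fun v => \sum_i v ord0 i * g i).
Proof.
split=> [h|[h1 h2]]; first by split; [case: h|apply/funext; exact: hasD_lin].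
split=> // i; rewrite h2 (bigD1 i)//= big1 => [|j ji]; rewrite mxE !eqxx ?mul1r ?addr0//=.
by rewrite (negbTE ji) mul0r.
Qed.

Lemma hasD_intro n (f : 'rV[R]_n -> R) x (g : 'I_n -> R) :
  (forall e : R, 0 < e -> exists d : R, 0 < d /\ forall v : 'rV[R]_n, (forall i, `|v ord0 i| < d) ->
     `|f (x + v) - f x - \sum_i v ord0 i * g i| <= e * `|v|) -> hasD f x g.
Proof.
move=> h; apply/hasD_is_diff.
have add a u v : \sum_i (a *: u + v : 'rV[R]_n) ord0 i * g i = a *: (\sum_i u ord0 i * g i) + \sum_i v ord0 i * g i.
  by rewrite scaler_sumr -big_split; apply: eq_bigr => i _; rewrite !mxE mulrDl -mulrA.
pose L : {linear 'rV[R]_n -> R} := HB.pack (fun v : 'rV[R]_n => \sum_i v ord0 i * g i)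
  (GRing.isLinear.Build R _ _ _ (fun v : 'rV[R]_n => \sum_i v ord0 i * g i) add).
have cL : continuous L.
  move=> y; apply: differentiable_continuous.
  rewrite (_ : (L : 'rV[R]_n -> R) = \sum_i (fun v : 'rV[R]_n => v ord0 i * g i)); last first.
    by apply/funext => v; rewrite fct_sumE.
  by apply: differentiable_sum => i; apply: differentiableM; [exact: differentiable_coord|exact: differentiable_cst].
have eL : f \o shift x = cst (f x) + L +o_ (0 : 'rV[R]_n) id.
  apply/eqaddoP => e e0; have [d [d0 hd]] := h e e0.
  apply/nbhs_cube; exists d; split=> // v hv.
  rewrite (_ : (_ - _) v = f (v + x) - (f x + \sum_i v ord0 i * g i))// [v + x]addrC opprD addrA.
  apply: hd => i.
  by have := hv i; rewrite mxE subr0.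
have dL : 'd f x = L :> (_ -> _) by apply: diff_unique.
split; last by rewrite dL.
by apply/diff_locallyP; rewrite dL; split.
Qed.

Lemma hasD_elim n (f : 'rV[R]_n -> R) x (g : 'I_n -> R) : hasD f x g ->
  forall e : R, 0 < e -> exists d : R, 0 < d /\ forall v : 'rV[R]_n, (forall i, `|v ord0 i| < d) ->
     `|f (x + v) - f x - \sum_i v ord0 i * g i| <= e * `|v|.
Proof.
move=> hD e e0; have [/diff_locally /eqaddoP /(_ e e0) + _] := hD.
move=> /nbhs_cube[d [d0 hd]]; exists d; split=> // v hv.
have := hd v; rewrite (_ : (_ - _) v = f (v + x) - (f x + 'd f x v))// (hasD_lin hD) [v + x]addrC opprD addrA.
apply => i.
by have := hv i; rewrite mxE subr0.
Qed.

Lemma hasD_ext n (f f' : 'rV[R]_n -> R) x g r : 0 < r -> (forall y, cube x r y -> f y = f' y) ->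
  hasD f x g -> hasD f' x g.
Proof.
move=> r0 ff' hD; apply: hasD_intro => e e0; have [d [d0 hd]] := hasD_elim hD e0.
have [k [k0 kr kd]] := pos_min2 r0 d0; exists k; split=> // v hv.
rewrite -!ff'; first by apply: hd => i; exact: lt_le_trans (hv i) kd.
  exact: cube_refl.
by move=> i; rewrite mxE (_ : _ - _ = v ord0 i); [exact: lt_le_trans (hv i) kr|ring].
Qed.

Lemma row_differentiable m n (h : 'rV[R]_m -> 'rV[R]_n) x :
  (forall j, differentiable (fun y => h y ord0 j : R) x) -> differentiable h x.
Proof.
move=> dh; have -> : h = \sum_j (fun y => h y ord0 j *: delta_mx ord0 j).
  by apply/funext => y; rewrite fct_sumE -row_sum_delta.
by apply: differentiable_sum => j; apply: differentiableZl.
Qed.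

Lemma diff_row m n (h : 'rV[R]_m -> 'rV[R]_n) x j : differentiable h x ->
  differentiable (fun y => h y ord0 j : R) x /\
  forall v, 'd (fun y => h y ord0 j : R) x v = ('d h x v) ord0 j.
Proof.
move=> dh.
have e : (fun y => h y ord0 j) = (fun M : 'rV[R]_n => M ord0 j) \o h by [].
split; first by rewrite e; apply: differentiable_comp => //; exact: differentiable_coord.
move=> v; rewrite e diff_comp//; last exact: differentiable_coord.
have add a u w : (a *: u + w : 'rV[R]_n) ord0 j = a *: (u ord0 j) + w ord0 j by rewrite !mxE.
pose L : {linear 'rV[R]_n -> R} := HB.pack (fun v : 'rV[R]_n => v ord0 j)
  (GRing.isLinear.Build R _ _ _ (fun v : 'rV[R]_n => v ord0 j) add).
rewrite /= (_ : (fun M : 'rV[R]_n => M ord0 j) = L)// diff_lin//.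
exact: coord_continuous.
Qed.

Lemma hasD_cst n (c : R) (x : 'rV[R]_n) : hasD (fun=> c) x (fun=> 0).
Proof. by apply/hasD_is_diff; apply: is_diff_eq (is_diff_cst c x) _; apply/funext => v /=; rewrite big1// => i _; rewrite mulr0. Qed.

Lemma hasD_coord n (x : 'rV[R]_n) j : hasD (fun y => y ord0 j) x (fun i => (i == j)%:R).
Proof.
apply: hasD_intro => e e0; exists 1; split=> // v _.
rewrite (bigD1 j)//= big1 => [|i ij]; last by rewrite (negbTE ij) mulr0.
by rewrite mxE eqxx mulr1 addr0 [_ + v _ _]addrC addrK subrr normr0 mulr_ge0// ltW.
Qed.

Lemma hasD_add n (f1 f2 : 'rV[R]_n -> R) x g1 g2 : hasD f1 x g1 -> hasD f2 x g2 ->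
  hasD (fun y => f1 y + f2 y) x (fun i => g1 i + g2 i).
Proof.
move=> /hasD_is_diff h1 /hasD_is_diff h2; apply/hasD_is_diff.
apply: is_diff_eq (is_diffD h1 h2) _; apply/funext => v /=.
rewrite [LHS](_ : _ = (\sum_i v ord0 i * g1 i) + \sum_i v ord0 i * g2 i)// -big_split.
by apply: eq_bigr => i _; rewrite mulrDr.
Qed.

Lemma hasD_mul n (f1 f2 : 'rV[R]_n -> R) x g1 g2 : hasD f1 x g1 -> hasD f2 x g2 ->
  hasD (fun y => f1 y * f2 y) x (fun i => f1 x * g2 i + f2 x * g1 i).
Proof.
move=> /hasD_is_diff h1 /hasD_is_diff h2; apply/hasD_is_diff.
apply: is_diff_eq (is_diffM h1 h2) _; apply/funext => v /=.
rewrite [LHS](_ : _ = f1 x * (\sum_i v ord0 i * g2 i) + f2 x * \sum_i v ord0 i * g1 i)//.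
by rewrite !mulr_sumr -big_split; apply: eq_bigr => i _ /=; ring.
Qed.

Lemma hasD_inv n (f : 'rV[R]_n -> R) x g : f x != 0 -> hasD f x g ->
  hasD (fun y => (f y)^-1) x (fun i => - (g i * ((f x)^-1 * (f x)^-1))).
Proof.
move=> f0 h; have [df _] := h; split; first exact: differentiableV.
move=> i; rewrite diffV//= (hasD_lin h) (bigD1 i)//= big1 => [|j ji]; rewrite mxE eqxx ?(negbTE ji) ?mul0r//=.
by rewrite eqxx mul1r addr0 /GRing.scale /= exprS expr1 invfM; ring.
Qed.

Lemma hasD_comp m n (F : 'rV[R]_n -> R) (h : 'rV[R]_m -> 'rV[R]_n) x G H :
  hasD F (h x) G -> (forall j, hasD (fun y => h y ord0 j) x (H j)) ->
  hasD (fun y => F (h y)) x (fun i => \sum_j H j i * G j).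
Proof.
move=> hF hh; have dh : differentiable h x by apply: row_differentiable => j; case: (hh j).
have [dF _] := hF; split; first by apply: (@differentiable_comp _ _ _ _ h F).
move=> i; rewrite (_ : (fun y => F (h y)) = F \o h)// diff_comp//= (hasD_lin hF).
by apply: eq_bigr => j _; have [_ <-] := diff_row j dh; have [_ ->] := hh j.
Qed.

Definition vshift n (y : 'rV[R]_n) (i : 'I_n) (s : R) : 'rV[R]_n :=
  \row_j (y ord0 j + s * (j == i)%:R).

Lemma vshift0 n (y : 'rV[R]_n) i : vshift y i 0 = y.
Proof. by apply/rowP => j; rewrite mxE mul0r addr0. Qed.
Lemma vshift_add n (y : 'rV[R]_n) i s t : vshift (vshift y i s) i t = vshift y i (s + t).
Proof. by apply/rowP => j; rewrite !mxE; ring. Qed.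

Lemma isd_uniq (f : R -> R) (x l l' : R) : isd f x l -> isd f x l' -> l = l'.
Proof.
move=> h h'; apply: contrapT => /eqP ne; have e0 : 0 < `|l - l'| / 4 by rewrite divr_gt0// normr_gt0 subr_eq0.
have [d [d0 hd]] := h _ e0; have [d' [d'0 hd']] := h' _ e0.
have [k [k0 kd kd']] := pos_min2 d0 d'0.
have k2 : `|k / 2| = k / 2 by rewrite ger0_norm//; lra.
have h1 := hd (k / 2); rewrite k2 in h1; have {}h1 := h1 ltac:(lra).
have h2 := hd' (k / 2); rewrite k2 in h2; have {}h2 := h2 ltac:(lra).
have : `|l - l'| * (k / 2) <= `|l - l'| / 2 * (k / 2).
  rewrite -{1}k2 -normrM.
  have -> : (l - l') * (k / 2) = (f (x + k / 2) - f x - l' * (k / 2)) - (f (x + k / 2) - f x - l * (k / 2)) by ring.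
  by apply: le_trans (ler_normB _ _) _; lra.
have : 0 < `|l - l'| * k by apply: mulr_gt0 => //; rewrite normr_gt0 subr_eq0.
by lra.
Qed.

Lemma hasD_isd n (f : 'rV[R]_n -> R) x g i : hasD f x g -> isd (fun s => f (vshift x i s)) 0 (g i).
Proof.
move=> /hasD_elim h e e0; have [d [d0 hd]] := h e e0; exists d; split=> // s sd.
pose v : 'rV[R]_n := s *: delta_mx ord0 i.
have vE j : v ord0 j = s * (j == i)%:R by rewrite !mxE eqxx.
have -> : vshift x i (0 + s) = x + v by apply/rowP => j; rewrite !mxE eqxx add0r.
rewrite vshift0; have nv : `|v| <= `|s|.
  by apply: norm_row_ub => // j; rewrite vE; case: eqP => _; rewrite ?mulr1 ?mulr0 ?normr0.
have := hd v; rewrite (bigD1 i)//= big1 => [|j ji]; last by rewrite vE (negbTE ji) mulr0 mul0r.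
rewrite vE eqxx mulr1 addr0 (mulrC s) => hh; apply: le_trans (hh _) _.
  by move=> j; rewrite vE; case: eqP => _; rewrite ?mulr1 ?mulr0 ?normr0.
by rewrite ler_pM2l.
Qed.

Lemma isd_bound_aux (S : forall n : nat, set (set 'rV[R]_n)) {HS : ominimal_structure S}
  (f r : R -> R) (a b L e : R) : Deff S f -> a < b ->
  (forall x, a <= x -> x <= b -> isd f x (r x) /\ `|r x - L| <= e) ->
  `|f b - f a - L * (b - a)| <= e * (b - a).
Proof.
move=> df ab h.
have h1 : (L - e) * (b - a) <= f b - f a.
  apply: (@isd_slope _ S _ f r a b) => // x x1 x2; first by case: (h x x1 x2).
  by have [|| _] := h x; [exact: ltW|exact: ltW|rewrite ler_norml => /andP[]; lra].
have h2 : (- L - e) * (b - a) <= - f b - - f a.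
  apply: (@isd_slope _ S _ (fun x => - f x) (fun x => - r x) a b) => //; first by dfn.
    by move=> x x1 x2; apply: isd_opp; case: (h x x1 x2).
  by move=> x x1 x2; have [|| _] := h x; [exact: ltW|exact: ltW|rewrite ler_norml => /andP[]; lra].
by rewrite ler_norml; apply/andP; split; lra.
Qed.

Lemma isd_bound (S : forall n : nat, set (set 'rV[R]_n)) {HS : ominimal_structure S}
  (f r : R -> R) (s L e : R) : Deff S f ->
  (forall x, `|x| <= `|s| -> isd f x (r x) /\ `|r x - L| <= e) ->
  `|f s - f 0 - L * s| <= e * `|s|.
Proof.
move=> df h; have [s0|s0|->] := ltgtP s 0.
- rewrite (ltr0_norm s0) -normrN.
  have -> : - (f s - f 0 - L * s) = f 0 - f s - L * (- s) by ring.
  rewrite -[- s]sub0r; apply: (@isd_bound_aux S _ f r) => // x x1 x2; apply: h.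
  by rewrite (ltr0_norm s0) ler0_norm//; lra.
- have : `|f s - f 0 - L * (s - 0)| <= e * (s - 0); last by rewrite subr0 (gtr0_norm s0).
  apply: (@isd_bound_aux S _ f r) => // x x1 x2; apply: h.
  by rewrite (gtr0_norm s0) ger0_norm.
- by rewrite subrr mulr0 subrr normr0 mulr0.
Qed.

(** Moving one coordinate at a time splits the increment into one-variable increments; each is
    controlled by the definable mean value inequality and by continuity of the partial derivatives
    at [x]. *)
Lemma hasD_of_partials (S : forall n : nat, set (set 'rV[R]_n)) {HS : ominimal_structure S}
  n (f : 'rV[R]_n -> R) (g : 'I_n -> 'rV[R]_n -> R) x r : Deff S f -> 0 < r ->
  (forall y i, cube x r y -> isd (fun s => f (vshift y i s)) 0 (g i y)) ->
  (forall i, contV (g i) x) -> hasD f x (fun i => g i x).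
Proof.
move=> df r0 hp cg; apply: hasD_intro => e e0.
have [n0|n0] := posnP n.
  subst n; exists 1; split=> // v _; rewrite big_ord0 (_ : x + v = x); last by rewrite thinmx0 [RHS]thinmx0.
  by rewrite subrr subr0 normr0 mulr_ge0// ltW.
have en0 : 0 < e / n%:R by rewrite divr_gt0// ltr0n.
have [D hD] := choice (fun i => cg i _ en0).
have [|d1 [d10 hd1]] := @fin_pos_min R _ D; first by move=> i; case: (hD i).
have [d [d0 dr dd]] := pos_min2 r0 d10; exists d; split=> // v hv.
(* The path from [x] to [x + v]: the first [k] coordinates have been moved. *)
pose y (k : nat) : 'rV[R]_n := \row_j (x ord0 j + (if (j < k)%N then v ord0 j else 0)).
have ycube k : cube x d (y k).
  by move=> i; rewrite mxE (addrC (x ord0 i)) addrK; case: ifP; rewrite ?normr0.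
have y0 : y 0%N = x by apply/rowP => j; rewrite mxE addr0.
have yn : y n = x + v by apply/rowP => j; rewrite !mxE ltn_ord.
have step (k : 'I_n) : `|f (y k.+1) - f (y k) - v ord0 k * g k x| <= e / n%:R * `|v ord0 k|.
  have -> : y k.+1 = vshift (y k) k (v ord0 k).
    apply/rowP => j; rewrite !mxE ltnS leq_eqVlt; have [->|jk] := eqVneq j k.
      by rewrite eqxx ltnn mulr1 addr0.
    by have -> : (j == k :> nat) = false; [exact/negbTE/jk|rewrite mulr0 addr0].
  rewrite -[in f (y k)](vshift0 (y k) k) (mulrC (v ord0 k)).
  have inc t : `|t| <= `|v ord0 k| -> cube x d (vshift (y k) k t).
    move=> ht j; rewrite !mxE; have [->|jk] := eqVneq j k.
      by rewrite ltnn addr0 mulr1 (addrC (x ord0 k)) addrK; exact: le_lt_trans ht (hv k).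
    by rewrite mulr0 addr0 (addrC (x ord0 j)) addrK; case: ifP; rewrite ?normr0.
  apply: (@isd_bound S _ (fun t => f (vshift (y k) k t)) (fun t => g k (vshift (y k) k t))).
    by rewrite /vshift; dfn.
  move=> t ht; split; last first.
    by apply: ltW; have [_ ] := hD k; apply; apply: cube_le (inc t ht); exact: le_trans dd _.
  have := hp (vshift (y k) k t) k (cube_le dr (inc t ht)) => hi b b0.
  have [q [q0 hq]] := hi b b0; exists q; split=> // h hh.
  by have := hq h hh; rewrite vshift0 vshift_add add0r.
have -> : f (x + v) - f x - \sum_i v ord0 i * g i x = \sum_(k < n) (f (y k.+1) - f (y k) - v ord0 k * g k x).
  rewrite sumrB; congr (_ - _); rewrite -yn -{1}y0.
  by rewrite -(telescope_sumr (fun k => f (y k))) // big_mkord.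
apply: le_trans (ler_norm_sum _ _ _) _.
have : \sum_(k < n) `|f (y k.+1) - f (y k) - v ord0 k * g k x| <= \sum_(k < n) e / n%:R * `|v|.
  apply: ler_sum => k _; apply: le_trans (step k) _; apply: ler_wpM2l; first exact: ltW.
  exact: norm_row_le.
move=> h; apply: le_trans h _; rewrite sumr_const card_ord.
by rewrite -[X in X <= _]mulr_natr mulrAC divfK// pnatr_eq0 -lt0n.
Qed.
End Calculus.

(** * Definable functions of class [C^p] *)

Section SmoothDef.
Context {R : rcfType} (S : forall n : nat, set (set 'rV[R]_n)).
Arguments S : clear implicits.
Context {HS : ominimal_structure S}.
Local Notation Def := (Def S).
Local Notation Deff := (Deff S).

(** The functions are total and definable, with smoothness required at points of [U] only. The
    derivatives are given as further total definable functions with free values off [U]: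
    definability of all of them is built in, and closure properties need no statement about ['d f]
    outside [U]. *)
Fixpoint dC n (p : nat) (U : 'rV[R]_n -> Prop) (f : 'rV[R]_n -> R) : Prop :=
  Deff f /\ match p with
  | 0%N => forall x, U x -> contV f x
  | p'.+1 => exists g : 'I_n -> 'rV[R]_n -> R,
      (forall x, U x -> hasD f x (fun i => g i x)) /\ forall i, dC p' U (g i)
  end.

Definition isopen n (U : 'rV[R]_n -> Prop) : Prop :=
  forall x, U x -> exists r : R, 0 < r /\ forall y, cube x r y -> U y.

Lemma dC_Deff n p (U : 'rV[R]_n -> Prop) f : dC p U f -> Deff f.
Proof. by case: p => [|p] []. Qed.

Lemma dCS n p (U : 'rV[R]_n -> Prop) f : dC p.+1 U f <-> Deff f /\
  exists g : 'I_n -> 'rV[R]_n -> R,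
    (forall x, U x -> hasD f x (fun i => g i x)) /\ forall i, dC p U (g i).
Proof. by []. Qed.

Lemma dC_sub n p (U V : 'rV[R]_n -> Prop) f : (forall x, V x -> U x) -> dC p U f -> dC p V f.
Proof.
move=> VU; elim: p f => [|p ih] f; first by move=> [df h]; split=> // x /VU/h.
move=> /dCS[df [g [h1 h2]]]; apply/dCS; split=> //.
by exists g; split=> [x /VU/h1//|i]; apply: ih.
Qed.

Lemma dC_contV n p (U : 'rV[R]_n -> Prop) f x : dC p U f -> U x -> contV f x.
Proof. by case: p => [|p] [_]; [apply|move=> [g [h _]] /h /hasD_contV]. Qed.

Lemma dC_S n p (U : 'rV[R]_n -> Prop) f : dC p.+1 U f -> dC p U f.
Proof.
elim: p f => [|p ih] f /dCS[df [g [h1 h2]]]; first by split=> // x /h1/hasD_contV.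
by apply/dCS; split=> //; exists g; split=> // i; apply: ih.
Qed.

Lemma dC_ext n p (U : 'rV[R]_n -> Prop) f f' : isopen U -> Deff f' ->
  (forall x, U x -> f x = f' x) -> dC p U f -> dC p U f'.
Proof.
move=> oU df' e; case: p => [|p].
  move=> [df h]; split=> // x Ux b /(h x Ux)[d [d0 hd]]; have [r [r0 hr]] := oU x Ux.
  have [k [k0 kd kr]] := pos_min2 d0 r0; exists k; split=> // y hy.
  by rewrite -!e//; [apply: hd; exact: cube_le hy|apply: hr; exact: cube_le hy].
move=> /dCS[df [g [h1 h2]]]; apply/dCS; split=> //.
exists g; split=> // x Ux; have [r [r0 hr]] := oU x Ux.
by apply: hasD_ext r0 _ (h1 x Ux) => y /hr/e.
Qed.

Lemma dC_cst n p (U : 'rV[R]_n -> Prop) (c : R) : dC p U (fun=> c).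
Proof.
elim: p c => [|p ih] c.
  by split=> [|x _]; [dfn|exact: hasD_contV (hasD_cst c x)].
apply/dCS; split; first by dfn.
by exists (fun _ _ => 0); split=> // x _; exact: hasD_cst.
Qed.

Lemma dC_coord n p (U : 'rV[R]_n -> Prop) j : dC p U (fun x => x ord0 j).
Proof.
case: p => [|p]; first by split=> [|x _]; [dfn|exact: hasD_contV (hasD_coord x j)].
apply/dCS; split; first by dfn.
by exists (fun i _ => (i == j)%:R); split=> [x _|i]; [exact: hasD_coord|exact: dC_cst].
Qed.

Lemma contV_add n (f g : 'rV[R]_n -> R) x : contV f x -> contV g x -> contV (fun y => f y + g y) x.
Proof. by rewrite -!continuous_contV => h1 h2; exact: (@continuousD _ _ _ f g). Qed.
Lemma contV_mul n (f g : 'rV[R]_n -> R) x : contV f x -> contV g x -> contV (fun y => f y * g y) x.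
Proof. by rewrite -!continuous_contV => h1 h2; exact: (@continuousM _ _ f g). Qed.

Lemma dC_add n p (U : 'rV[R]_n -> Prop) f g : dC p U f -> dC p U g -> dC p U (fun x => f x + g x).
Proof.
elim: p f g => [|p ih] f g.
  by move=> [df hf] [dg hg]; split=> [|x Ux]; [dfn|apply: contV_add; [apply: hf|apply: hg]].
move=> /dCS[df [f' [f1 f2]]] /dCS[dg [g' [g1 g2]]]; apply/dCS; split; first by dfn.
exists (fun i x => f' i x + g' i x).
by split=> [x Ux|i]; [apply: hasD_add; [apply: f1|apply: g1]|apply: ih].
Qed.

Lemma dC_mul n p (U : 'rV[R]_n -> Prop) f g : dC p U f -> dC p U g -> dC p U (fun x => f x * g x).
Proof.
elim: p f g => [|p ih] f g.
  by move=> [df hf] [dg hg]; split=> [|x Ux]; [dfn|apply: contV_mul; [apply: hf|apply: hg]].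
move=> hf hg; have /dCS[df [f' [f1 f2]]] := hf; have /dCS[dg [g' [g1 g2]]] := hg.
apply/dCS; split; first by dfn.
exists (fun i x => f x * g' i x + g x * f' i x); split=> [x Ux|i].
  by apply: hasD_mul; [apply: f1|apply: g1].
by apply: dC_add; apply: ih => //; exact: dC_S.
Qed.

Lemma dC_opp n p (U : 'rV[R]_n -> Prop) f : dC p U f -> dC p U (fun x => - f x).
Proof.
move=> h; have := dC_mul (dC_cst p U (-1)) h; congr (dC _ _ _).
by apply/funext => x; rewrite mulN1r.
Qed.

Lemma dC_sum n p (U : 'rV[R]_n -> Prop) k (F : 'I_k -> 'rV[R]_n -> R) :
  (forall i, dC p U (F i)) -> dC p U (fun x => \sum_i F i x).
Proof.
move=> h; elim: k F h => [|k ih] F h.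
  by have := dC_cst p U 0; congr (dC _ _ _); apply/funext => x; rewrite big_ord0.
have := dC_add (h ord0) (ih (fun i => F (lift ord0 i)) (fun i => h _)).
by congr (dC _ _ _); apply/funext => x; rewrite big_ord_recl.
Qed.

Lemma dC_inv n p (U : 'rV[R]_n -> Prop) f : (forall x, U x -> f x != 0) ->
  dC p U f -> dC p U (fun x => (f x)^-1).
Proof.
move=> f0; elim: p => [|p ih].
  move=> [df hf]; split=> [|x Ux]; first by dfn.
  apply/continuous_contV; have /continuous_contV := hf x Ux.
  by move=> cf; apply: continuousV => //; exact: f0.
move=> hf; have /dCS[df [g [g1 g2]]] := hf; apply/dCS; split; first by dfn.
exists (fun i x => - (g i x * ((f x)^-1 * (f x)^-1))); split=> [x Ux|i].
  by apply: hasD_inv; [exact: f0|exact: g1].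
by apply: dC_opp; apply: dC_mul => //; apply: dC_mul; apply: ih; exact: dC_S.
Qed.

Lemma contV_comp m n (F : 'rV[R]_n -> R) (h : 'rV[R]_m -> 'rV[R]_n) x :
  contV F (h x) -> (forall j, contV (fun y => h y ord0 j) x) -> contV (fun y => F (h y)) x.
Proof.
move=> cF ch e /cF[d [d0 hd]].
have [D hD] := choice (fun j => ch j _ d0).
have [|k [k0 hk]] := @fin_pos_min R _ D; first by move=> i; case: (hD i).
by exists k; split=> // y hy; apply: hd => j; have [_] := hD j; apply; exact: cube_le hy.
Qed.

Lemma dC_comp m n p (U : 'rV[R]_m -> Prop) (V : 'rV[R]_n -> Prop) F (h : 'rV[R]_m -> 'rV[R]_n) :
  (forall x, U x -> V (h x)) -> dC p V F -> (forall j, dC p U (fun x => h x ord0 j)) ->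
  dC p U (fun x => F (h x)).
Proof.
move=> UV; elim: p F => [|p ih] F hF hh.
all: have dh : Deff h by apply: Deff_rows => i; exact: dC_Deff (hh i).
  have [dF kF] := hF; split=> [|x Ux]; first by dfn.
  apply: contV_comp; first by apply: kF; apply: UV.
  by move=> j; apply: dC_contV (hh j) Ux.
have /dCS[dF [G [G1 G2]]] := hF; apply/dCS; split; first by dfn.
have ex j : exists g : 'I_m -> 'rV[R]_m -> R,
  (forall x, U x -> hasD (fun x => h x ord0 j) x (fun i => g i x)) /\ forall i, dC p U (g i).
  by have /dCS[_] := hh j.
have [H hH] := choice ex.
exists (fun i x => \sum_j H j i x * G j (h x)); split=> [x Ux|i].
  by apply: (hasD_comp (G := fun j => G j (h x))); [apply: G1; apply: UV|move=> j; have [h1 _] := hH j; apply: h1].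
apply: dC_sum => j; apply: dC_mul; first by have [_] := hH j.
by apply: ih => // k; apply: dC_S.
Qed.
End SmoothDef.

(** * Definable compactness and generic smoothness *)

Section Compactness.
Context {R : rcfType} (S : forall n : nat, set (set 'rV[R]_n)).
Arguments S : clear implicits.
Context {HS : ominimal_structure S}.
Local Notation Def := (Def S).
Local Notation Deff := (Deff S).

Lemma cube_half n (x y z : 'rV[R]_n) r : cube x (r / 2) y -> cube y (r / 2) z -> cube x r z.
Proof. by move=> h k; have := cube_trans h k; rewrite (_ : r / 2 + r / 2 = r)//; field. Qed.

(** Definable compactness, for a family shrinking as [s] decreases to [0]. Coordinates are treated
    one after the other: with [c] the lower limit of the [i]-th coordinate, the points satisfying
    [x_i <= c + s] form a nonempty subfamily along which that coordinate converges to [c]. *)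
Lemma cluster_point n (F : R -> 'rV[R]_n -> Prop) (M : R) :
  Def (fun p : R * 'rV[R]_n => F p.1 p.2) ->
  (forall s : R, 0 < s -> exists x, F s x) ->
  (forall (s t : R) x, 0 < s -> s <= t -> F s x -> F t x) ->
  (forall s x i, F s x -> `|x ord0 i| <= M) ->
  exists a : 'rV[R]_n, forall s r : R, 0 < s -> 0 < r -> exists x, F s x /\ cube a r x.
Proof.
move=> dF nF mF bF.
have [G [[dG nG GF _] [a ha]]] : exists G : R -> 'rV[R]_n -> Prop,
    [/\ Def (fun p : R * 'rV[R]_n => G p.1 p.2), forall s : R, 0 < s -> exists x, G s x,
     forall (s : R) x, 0 < s -> G s x -> F s x &
     forall (s t : R) x, 0 < s -> s <= t -> G s x -> G t x] /\
     exists a : 'I_n -> R, forall i, i \in enum 'I_n -> forall r : R, 0 < r ->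
       exists s : R, 0 < s /\ forall (t : R) x, 0 < t -> t <= s -> G t x -> `|x ord0 i - a i| < r.
  elim: (enum 'I_n) => [|i l [G [[dG nG GF mG] [a ha]]]].
    by exists F; split=> //; exists (fun=> 0).
  pose A c := exists s : R, 0 < s /\ forall x : 'rV[R]_n, G s x -> c <= x ord0 i.
  have dA : Def A by rewrite /A; dfn.
  have Aub c : A c -> c <= M.
    move=> [s [s0 hs]]; have [x Gx] := nG s s0; apply: le_trans (hs x Gx) _.
    exact: le_trans (ler_norm _) (bF _ _ i (GF _ _ s0 Gx)).
  have [l1 l2] : islub A (dsup A).
    apply: dsupP => //; last by exists M.
    exists (- M), 1; split=> // x Gx; rewrite lerNl; apply: le_trans (bF _ _ i (GF _ _ ltr01 Gx)).
    by rewrite -normrN; exact: ler_norm.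
  set c := dsup A in l1 l2.
  exists (fun s x => G s x /\ x ord0 i <= c + s); split; first split.
  - by dfn.
  - move=> s s0; apply: contrapT => nx; suff : c + s <= c by lra.
    apply: l1; exists s; split=> // x Gx; rewrite leNgt; apply/negP => lt.
    by apply: nx; exists x; split=> //; exact: ltW.
  - by move=> s x s0 [/GF h _]; exact: h.
  - by move=> s t x s0 st [Gx h]; split; [exact: mG Gx|lra].
  exists (fun j => if j == i then c else a j) => j; rewrite inE => /orP[/eqP->|jl] r r0; last first.
    have [eji|_] := eqVneq j i; last first.
      by have [s [s0 hs]] := ha j jl r r0; exists s; split=> // t x t0 ts [Gx _]; exact: hs Gx.
    subst j; rewrite ?eqxx.
    have [b [[s [s0 hs]] hb]] : exists b, A b /\ c - r < b.
      apply: contrapT => nb; suff : c <= c - r by lra.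
      by apply: l2 => b Ab; rewrite leNgt; apply/negP => lt; apply: nb; exists b.
    have [k [k0 ks kr]] := @pos_min2 R _ (r / 2) s0 ltac:(lra).
    exists k; split=> // t x t0 tk [Gx h]; rewrite ltr_norml; apply/andP; split; last by lra.
    by have := hs x (mG _ _ _ t0 (le_trans tk ks) Gx); lra.
  rewrite eqxx; have [b [[s [s0 hs]] hb]] : exists b, A b /\ c - r < b.
    apply: contrapT => nb; suff : c <= c - r by lra.
    by apply: l2 => b Ab; rewrite leNgt; apply/negP => lt; apply: nb; exists b.
  have [k [k0 ks kr]] := @pos_min2 R _ (r / 2) s0 ltac:(lra).
  exists k; split=> // t x t0 tk [Gx h]; rewrite ltr_norml; apply/andP; split; last by lra.
  by have := hs x (mG _ _ _ t0 (le_trans tk ks) Gx); lra.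
exists (\row_i a i) => s r s0 r0.
have ex i : exists s : R, 0 < s /\ forall (t : R) x, 0 < t -> t <= s -> G t x -> `|x ord0 i - a i| < r.
  by apply: ha => //; rewrite mem_enum.
have [T hT] := choice ex.
have [|k [k0 hk]] := @fin_pos_min R _ T; first by move=> i; case: (hT i).
have [m [m0 mk ms]] := pos_min2 k0 s0; have [x Gx] := nG m m0.
exists x; split; first by apply: mF (GF _ _ m0 Gx).
by move=> i; rewrite mxE; have [_ h] := hT i; apply: h Gx => //; exact: le_trans mk (hk i).
Qed.

(** If [w] were unbounded on the closed bounded set [K], the sets where [w > 1 / s] would cluster at
    a point of [K], against the local bound there. *)
Lemma bounded_of_locally n (K : 'rV[R]_n -> Prop) (w : 'rV[R]_n -> R) (M : R) :
  Def K -> Deff w -> (forall x i, K x -> `|x ord0 i| <= M) ->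
  (forall a, (forall r : R, 0 < r -> exists x, K x /\ cube a r x) -> K a) ->
  (forall a, K a -> exists r B : R, 0 < r /\ forall x, cube a r x -> K x -> w x <= B) ->
  exists B : R, forall x, K x -> w x <= B.
Proof.
move=> dK dw bK cK lw; apply: contrapT => nb.
have unb (B : R) : exists x, K x /\ B < w x.
  apply: contrapT => nx; apply: nb; exists B => x Kx; rewrite leNgt; apply/negP => lt.
  by apply: nx; exists x.
have [||||a ha] := @cluster_point n (fun s x => K x /\ s^-1 < w x) M.
- by dfn.
- by move=> s _; exact: unb.
- move=> s t x s0 st [Kx h]; split=> //; apply: le_lt_trans h.
  by rewrite lef_pV2// posrE //; exact: lt_le_trans s0 st.
- by move=> s x i [Kx _]; exact: bK.
have Ka : K a by apply: cK => r r0; have [x [[Kx _] h]] := ha 1 r ltr01 r0; exists x.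
have [r [B [r0 hB]]] := lw a Ka.
have B0 : 0 < `|B| + 1 by have := normr_ge0 B; lra.
have [||x [[Kx h1] h2]] := ha (`|B| + 1)^-1 r; [by rewrite invr_gt0|by []|].
by have := hB x h2 Kx; have := ler_norm B; move: h1; rewrite invrK; lra.
Qed.
End Compactness.

(** * Smoothness on a dense open set *)

Section GenericSmooth.
Context {R : rcfType} (S : forall n : nat, set (set 'rV[R]_n)).
Arguments S : clear implicits.
Context {HS : ominimal_structure S}.
Local Notation Def := (Def S).
Local Notation Deff := (Deff S).

Definition denseIn n (W G : 'rV[R]_n -> Prop) : Prop :=
  forall x (r : R), 0 < r -> (forall y, cube x r y -> W y) ->
  exists (x' : 'rV[R]_n) (r' : R), [/\ 0 < r', forall y, cube x' r' y -> cube x r y &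
    forall y, cube x' r' y -> G y].

Lemma denseIn_trans n (W G H : 'rV[R]_n -> Prop) : denseIn W G -> denseIn G H -> denseIn W H.
Proof.
move=> WG GH x r r0 hW; have [x' [r' [r'0 h1 h2]]] := WG x r r0 hW.
have [x2 [r2 [r20 k1 k2]]] := GH x' r' r'0 h2; exists x2, r2; split=> // y /k1; exact: h1.
Qed.

Definition pderiv n (f : 'rV[R]_n -> R) (i : 'I_n) (x : 'rV[R]_n) : R :=
  xget 0 [set l | isd (fun s => f (vshift x i s)) 0 l].

Lemma pderivP n (f : 'rV[R]_n -> R) i x l :
  isd (fun s => f (vshift x i s)) 0 l -> pderiv f i x = l.
Proof.
move=> h.
exact: (isd_uniq (@xgetPex _ 0 [set l | isd (fun s => f (vshift x i s)) 0 l] (ex_intro _ l h)) h).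
Qed.

Lemma Def_pder n (f : 'rV[R]_n -> R) i : Deff f ->
  Def (fun p : 'rV[R]_n * R => isd (fun s => f (vshift p.1 i s)) 0 p.2).
Proof. by move=> df; rewrite /isd /vshift; dfn. Qed.

Lemma Deff_pderiv n (f : 'rV[R]_n -> R) i : Deff f -> Deff (pderiv f i).
Proof.
move=> df; have d := Def_pder i df.
apply: (Deff_rel (G := fun x y => isd (fun s => f (vshift x i s)) 0 y \/
   ((~ exists l : R, isd (fun s => f (vshift x i s)) 0 l) /\ y = 0))).
  move=> x y; split=> [[/pderivP->//|[h ->]]|->].
    by rewrite /pderiv xgetPN// => l hl; apply: h; exists l.
  have [[l hl]|h] := pselect (exists l, isd (fun s => f (vshift x i s)) 0 l).
    by left; rewrite (pderivP hl).
  by right; split=> //; rewrite /pderiv xgetPN// => l hl; apply: h; exists l.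
apply: Def_or => //; apply: Def_and; last by dfn.
apply: Def_not; apply: Def_ex.
exact: (Def_subst2 (P := fun x l => isd (fun s => f (vshift x i s)) 0 l) d
   (Deff_fst (Deff_fst Deff_id)) (Deff_snd Deff_id)).
Qed.

Lemma pderiv_exists_gen n (f : 'rV[R]_n -> R) i x r : Deff f -> 0 < r ->
  exists (x' : 'rV[R]_n) (r' : R), [/\ 0 < r', forall y, cube x' r' y -> cube x r y &
    forall y, cube x' r' y -> exists l : R, isd (fun s => f (vshift y i s)) 0 l].
Proof.
move=> df r0; have d := Def_pder i df.
have dN : Def (fun y => exists l : R, isd (fun s => f (vshift y i s)) 0 l) by apply: Def_ex.
have [x' [r' [r'0 h1 [h2|h2]]]] := (dich_cont_gen n).1 _ dN x r r0; first by exists x', r'.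
exfalso; have dfs : Deff (fun s => f (vshift x' i s)) by rewrite /vshift; dfn.
have r'0' : - r' < r' by lra.
have [c [e [g [k1 k2 k3 _ k4]]]] := deriv_gen dfs r'0'.
apply: (h2 (vshift x' i ((c + e) / 2))).
  move=> j; rewrite mxE addrC addKr; case: eqP => _; rewrite ?mulr0 ?normr0// mulr1 ltr_norml.
  by apply/andP; split; lra.
exists (g ((c + e) / 2)) => b b0; have [||t [t0 ht]] := k4 ((c + e) / 2) _ _ b b0; [lra|lra|].
by exists t; split=> // h /ht; rewrite !vshift_add add0r addr0.
Qed.

(** All partial derivatives exist on a dense open set, because they exist generically on every line.
    Refining this set successively makes each of them [C^p]; a function with continuous partials is
    then differentiable. *)
Lemma smooth_gen n p (f : 'rV[R]_n -> R) (W : 'rV[R]_n -> Prop) : Deff f -> Def W -> isopen W ->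
  exists G : 'rV[R]_n -> Prop, [/\ Def G, isopen G, forall x, G x -> W x, denseIn W G & dC S p G f].
Proof.
elim: p f W => [|p ih] f W df dW oW.
  (* The interior of the set of continuity points, so that [G] is open; density only costs halving
     the cube. *)
  pose G x := exists r : R, 0 < r /\ forall y : 'rV[R]_n, cube x r y -> W y /\ contV f y.
  have dcf : Def (contV f) by exact: Def_contV.
  have dcu : Def (fun p : 'rV[R]_n * R * 'rV[R]_n => cube p.1.1 p.1.2 p.2) by exact: Def_cube.
  exists G; split; first by rewrite /G; dfn.
  - move=> x [r [r0 h]]; exists (r / 2); split=> [|y hy]; first by lra.
    exists (r / 2); split=> [|z hz]; first by lra.
    by apply: h; exact: cube_half hy hz.
  - by move=> x [r [r0 h]]; have [] := h x (cube_refl _ r0).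
  - move=> x r r0 hW; have [x' [r' [r'0 h1 h2]]] := (dich_cont_gen n).2 f df x r r0.
    exists x', (r' / 2); split; first by lra.
      by move=> y hy; apply: h1; apply: cube_le hy; lra.
    move=> y hy; exists (r' / 2); split=> [|z hz]; first by lra.
    have hz' : cube x' r' z by exact: cube_half hy hz.
    by split; [apply: hW; apply: h1|apply: h2].
  - by split=> // x [r [r0 h]]; have [] := h x (cube_refl _ r0).
have dcu : Def (fun p : 'rV[R]_n * R * 'rV[R]_n => cube p.1.1 p.1.2 p.2) by exact: Def_cube.
have dN i : Def (fun y => exists l : R, isd (fun s => f (vshift y i s)) 0 l) by apply: Def_ex; exact: Def_pder.
pose N (y : 'rV[R]_n) := forall i, exists l : R, isd (fun s => f (vshift y i s)) 0 l.
have dNN : Def N by apply: Def_fall.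
pose G0 x := exists r : R, 0 < r /\ forall y : 'rV[R]_n, cube x r y -> W y /\ N y.
have dG0 : Def G0 by rewrite /G0; dfn.
have oG0 : isopen G0.
  move=> x [r [r0 h]]; exists (r / 2); split=> [|y hy]; first by lra.
  exists (r / 2); split=> [|z hz]; first by lra.
  by apply: h; exact: cube_half hy hz.
have WG0 : denseIn W G0.
  move=> x r r0 hW.
  suff [x' [r' [r'0 h1 h2]]] : exists (x' : 'rV[R]_n) (r' : R), [/\ 0 < r', forall y, cube x' r' y -> cube x r y &
      forall y, cube x' r' y -> forall i, i \in enum 'I_n -> exists l : R, isd (fun s => f (vshift y i s)) 0 l].
    exists x', (r' / 2); split; first by lra.
      by move=> y hy; apply: h1; apply: cube_le hy; lra.
    move=> y hy; exists (r' / 2); split=> [|z hz]; first by lra.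
    have hz' : cube x' r' z by exact: cube_half hy hz.
    by split; [apply: hW; apply: h1|move=> i; apply: h2 => //; rewrite mem_enum].
  elim: (enum 'I_n) => [|i l [x' [r' [r'0 h1 h2]]]]; first by exists x, r.
  have [x2 [r2 [r20 k1 k2]]] := pderiv_exists_gen i x' df r'0.
  exists x2, r2; split=> // [y /k1/h1//|y hy j]; rewrite inE => /orP[/eqP->|jl]; first exact: k2.
  by apply: h2 => //; exact: k1.
have [G [dG oG GG0 dGG hG]] : exists G : 'rV[R]_n -> Prop, [/\ Def G, isopen G, forall x, G x -> G0 x,
    denseIn G0 G & forall i, i \in enum 'I_n -> dC S p G (pderiv f i)].
  elim: (enum 'I_n) => [|i l [G [dG oG GG0 dGG hG]]].
    by exists G0; split=> // x r r0 h; exists x, r; split.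
  have [G' [dG' oG' G'G dGG' hG']] := ih _ _ (Deff_pderiv i df) dG oG.
  exists G'; split=> // [x /G'G/GG0//||j]; first exact: denseIn_trans dGG dGG'.
  by rewrite inE => /orP[/eqP->//|/hG]; exact: dC_sub.
have hG' i : dC S p G (pderiv f i) by apply: hG; rewrite mem_enum.
exists G; split=> //.
- by move=> x /GG0[r [r0 h]]; have [] := h x (cube_refl _ r0).
- exact: denseIn_trans WG0 dGG.
apply/dCS; split=> //; exists (pderiv f); split=> // x Gx.
have [r [r0 h]] := GG0 x Gx.
apply: (hasD_of_partials df r0) => [y i hy|i]; last exact: dC_contV (hG' i) Gx.
by have [_ /(_ i)[l hl]] := h y hy; rewrite (pderivP hl).
Qed.
End GenericSmooth.

(** * Uniform finiteness *)

Section FiniteFibres1.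
Context {R : rcfType} (S : forall n : nat, set (set 'rV[R]_n)).
Arguments S : clear implicits.
Context {HS : ominimal_structure S}.
Local Notation Def := (Def S).
Local Notation Deff := (Deff S).

Lemma list_pos_min (T : eqType) (l : seq T) (F : T -> R) : (forall i, i \in l -> 0 < F i) ->
  exists k : R, 0 < k /\ forall i, i \in l -> k <= F i.
Proof.
elim: l => [|j l ih] h; first by exists 1.
have [|k [k0 hk]] := ih; first by move=> i il; apply: h; rewrite inE il orbT.
have [m [m0 mk mj]] := pos_min2 k0 (h j (mem_head _ _)).
by exists m; split=> // i; rewrite inE => /orP[/eqP->//|/hk]; exact: le_trans.
Qed.

Lemma fin_max (A : R -> Prop) (l : seq R) : (forall z, A z -> z \in l) -> (exists z, A z) ->
  exists m, A m /\ forall z, A z -> z <= m.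
Proof.
elim: l A => [|x l ih] A hl [z0 Az0]; first by have := hl _ Az0.
have [[z Az]|h] := pselect (exists z, A z /\ z != x); last first.
  have e z : A z -> z = x by move=> Az; apply: contrapT => /eqP zx; apply: h; exists z.
  by exists z0; split=> // z /e ->; rewrite (e _ Az0).
have [||m [[Am mx] hm]] := ih (fun z => A z /\ z != x).
- by move=> y [/hl]; rewrite inE => /orP[/eqP->|//]; rewrite eqxx.
- by exists z.
have [xm|mx'] := leP x m.
  exists m; split=> // y Ay; have [->//|yx] := eqVneq y x; exact: hm.
have [Ax|nAx] := pselect (A x).
  exists x; split=> // y Ay; have [->//|yx] := eqVneq y x.
  by apply: le_trans (ltW mx'); exact: hm.
by exists m; split=> // y Ay; apply: hm; split=> //; apply/eqP => e; apply: nAx; rewrite -e.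
Qed.

(** Definable connectedness of intervals: the indicator function of a locally constant definable
    property is locally constant, so continuous induction makes it monotone, and so is that of the
    complement. *)
Lemma itv_conn (E : R -> Prop) (a b : R) : Def E ->
  (forall x, a < x -> x < b -> exists d : R, 0 < d /\ forall y, `|y - x| < d -> (E x <-> E y)) ->
  forall x y, a < x -> x < b -> a < y -> y < b -> E x -> E y.
Proof.
move=> dE lc.
have up (Q : R -> Prop) : Def Q ->
  (forall x, a < x -> x < b -> exists d : R, 0 < d /\ forall y, `|y - x| < d -> (Q x <-> Q y)) ->
  forall x y, a < x -> x < y -> y < b -> Q x -> Q y.
  move=> dQ lQ x y ax xy yb Qx.
  pose f z : R := if `[< Q z >] then 1 else 0.
  have df : Deff f by rewrite /f; dfn.
  have fe u v : (Q u <-> Q v) -> f u = f v by rewrite /f => h; congr (if _ then _ else _); apply/asboolP/asboolP => /h.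
  have : f x <= f y.
    apply: (@nondecr_of_local _ S HS f a b) => // z.
      move=> az zb; have [d [d0 hd]] := lQ z az zb; exists d; split=> // w w1 w2.
      by rewrite (fe z w)//; apply: hd; rewrite gtr0_norm; lra.
    move=> v az zb; apply: contR_lgerm => e e0; have [d [d0 hd]] := lQ z az zb.
    by exists d; split=> // w /hd h; rewrite (fe z w h) subrr normr0.
  by rewrite /f; case: asboolP => //; case: asboolP => // _ _; rewrite ler10.
move=> x y ax xb ay yb Ex; have [xy|yx|<-//] := ltgtP x y; first exact: up Ex.
apply: contrapT => nEy; apply: (up (fun z => ~ E z) _ _ y x) => //; first exact: Def_not.
by move=> z az zb; have [d [d0 hd]] := lc z az zb; exists d; split=> // w /hd ->.
Qed.

(** Near [(t, z)] the set [B] either is the graph of a function continuous at [t], or is empty. *)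
Definition normal (B : R -> R -> Prop) (t z : R) : Prop :=
  (B t z -> exists e0 : R, 0 < e0 /\ forall e : R, 0 < e -> e < e0 ->
     exists d : R, 0 < d /\ forall s : R, `|s - t| < d ->
       exists w : R, (B s w /\ `|w - z| < e) /\ forall w' : R, B s w' -> `|w' - z| < e -> w' = w) /\
  (~ B t z -> exists e d : R, 0 < e /\ 0 < d /\
     forall s w : R, `|s - t| < d -> `|w - z| < e -> ~ B s w).
Definition badat (B : R -> R -> Prop) (t : R) : Prop :=
  exists z : R, `|z| <= 1 /\ ~ normal B t z.

Context (B : R -> R -> Prop).
Hypotheses (dB : Def (fun p : R * R => B p.1 p.2)) (B1 : forall t z, B t z -> `|z| <= 1).
Hypothesis (fB : forall t, exists l : seq R, forall z, B t z -> z \in l).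

Lemma Def_normal : Def (fun p : R * R => normal B p.1 p.2).
Proof. by rewrite /normal; dfn. Qed.

(** The graph of [beta] runs in a channel bounded by the continuous [lo] and [hi], in which [B] can
    contain only points of the graph. If [B] contains all of the graph or none of it, the point is
    normal in the first or the second way. *)
Lemma normal_of_cont (beta lo hi : R -> R) (a b t : R) : a < t -> t < b ->
  contR beta t -> contR lo t -> contR hi t ->
  (forall s, a < s -> s < b -> [/\ lo s < beta s, beta s < hi s &
     forall w, B s w -> lo s < w -> w < hi s -> w = beta s]) ->
  (forall s, a < s -> s < b -> B s (beta s)) \/ (forall s, a < s -> s < b -> ~ B s (beta s)) ->
  normal B t (beta t).
Proof.
move=> at_ tb cb cl ch hs hB; have [l1 l2 _] := hs t at_ tb.
have [e1 [e10 e1a e1b]] := @pos_min2 R ((beta t - lo t) / 2) ((hi t - beta t) / 2) ltac:(lra) ltac:(lra).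
have [dl [dl0 hdl]] := cl e1 e10; have [dh [dh0 hdh]] := ch e1 e10.
have [d1 [d10 d1a d1b]] := pos_min2 dl0 dh0.
have [d2 [d20 d2a d2b]] := @pos_min2 R (t - a) (b - t) ltac:(lra) ltac:(lra).
have [d3 [d30 d3a d3b]] := pos_min2 d10 d20.
have key s w e : e < e1 -> `|s - t| < d3 -> `|w - beta t| < e -> B s w -> a < s /\ s < b /\ w = beta s.
  move=> ee hst; rewrite ltr_norml => /andP[w1 w2] Bw.
  have hl : `|lo s - lo t| < e1 by apply: hdl; lra.
  have hh : `|hi s - hi t| < e1 by apply: hdh; lra.
  move: hl hh hst; rewrite !ltr_norml => /andP[h1 h2] /andP[h3 h4] /andP[h5 h6].
  have as_ : a < s by clear -h5 d3b d2a; lra.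
  have sb : s < b by clear -h6 d3b d2b; lra.
  split=> //; split=> //; have [_ _] := hs s as_ sb; apply=> //.
    by clear -h2 e1a w1 ee; lra.
  by clear -h3 e1b w2 ee; lra.
split=> Bt.
  have {}hB : forall s, a < s -> s < b -> B s (beta s) by case: hB => // /(_ t at_ tb).
  exists e1; split=> // e e0 ee; have [db [db0 hdb]] := cb e e0.
  have [d [d0 da db']] := pos_min2 d30 db0; exists d; split=> // s hst.
  have hb : `|beta s - beta t| < e by apply: hdb; lra.
  have hst3 : `|s - t| < d3 by lra.
  have [as_ sb] : a < s /\ s < b.
    by move: hst3; rewrite ltr_norml => /andP[h5 h6]; clear -h5 h6 d3b d2a d2b; split; lra.
  exists (beta s); split; first by split=> //; exact: hB.
  by move=> w Bw hw; have [_ [_ ->]] := key s w e ee hst3 hw Bw.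
have {}hB : forall s, a < s -> s < b -> ~ B s (beta s) by case: hB => // /(_ t at_ tb).
exists (e1 / 2), d3; split; first by lra.
split=> // s w hst hw Bw; have e12 : e1 / 2 < e1 by lra.
have [as_ [sb e]] := key s w (e1 / 2) e12 hst hw Bw.
by apply: (hB s as_ sb); rewrite -e.
Qed.

(** Choose definably a point [beta t] that is not normal, together with the nearest points of the
    fibre below and above it. On a smaller interval all three are continuous and membership of
    [beta t] in the fibre does not change, which makes [beta t] normal. *)
Lemma badat_small (a b : R) : a < b -> ~ (forall t, a < t -> t < b -> badat B t).
Proof.
move=> ab hbad; have dn := Def_normal.
pose beta t := dchoice (fun z => `|z| <= 1 /\ ~ normal B t z).
have dbeta : Deff beta by apply: (Deff_dchoice (A := fun t z => `|z| <= 1 /\ ~ normal B t z)); dfn.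
have hbeta t : a < t -> t < b -> `|beta t| <= 1 /\ ~ normal B t (beta t).
  move=> at_ tb; apply: (@dchoiceP _ S HS (fun z => `|z| <= 1 /\ ~ normal B t z)); first by dfn.
  exact: hbad.
(* The values [-2] and [2] lie outside the fibres, which are contained in [[-1, 1]], and serve when
   there is no neighbour. [Hi] is reflected so that both neighbours are maxima of finite sets. *)
pose Lo t w := w = -2 \/ (B t w /\ w < beta t).
pose Hi t w := w = -2 \/ (B t (- w) /\ beta t < - w).
pose lo t := dsup (Lo t). pose hi t := - dsup (Hi t).
have dlo : Deff lo by apply: (Deff_dsup (A := Lo)); rewrite /Lo; dfn.
have dhi : Deff hi by apply: Deff_opp; apply: (Deff_dsup (A := Hi)); rewrite /Hi; dfn.
have maxP (Q : R -> Prop) (l : seq R) : Def Q -> (forall z, Q z -> z \in l) -> (exists z, Q z) ->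
    Q (dsup Q) /\ forall z, Q z -> z <= dsup Q.
  move=> dQ hl ne; have [m [Qm hm]] := fin_max hl ne.
  have lub : islub Q (dsup Q) by apply: dsupP => //; exists m.
  have -> : dsup Q = m by apply: islub_uniq lub _; split=> // M; apply.
  by [].
have hlo t : Lo t (lo t) /\ forall z, Lo t z -> z <= lo t.
  have [l hl] := fB t; apply: (maxP _ (-2 :: l)); [by rewrite /Lo; dfn| |by exists (-2); left].
  by move=> z [->|[/hl h _]]; rewrite inE ?eqxx ?h ?orbT.
have hhi t : Hi t (- hi t) /\ forall z, Hi t z -> z <= - hi t.
  rewrite /hi opprK; have [l hl] := fB t.
  apply: (maxP _ (-2 :: map -%R l)); [by rewrite /Hi; dfn| |by exists (-2); left].
  move=> z [->|[/hl h _]]; rewrite inE ?eqxx//; apply/orP; right; apply/mapP.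
  by exists (- z); rewrite ?opprK.
have [a1 [b1 [h1 h2 h3 _ cbeta]]] := mono_cont_gen dbeta ab.
have [a2 [b2 [h4 h5 h6 _ clo]]] := mono_cont_gen dlo h2.
have [a3 [b3 [h7 h8 h9 _ chi]]] := mono_cont_gen dhi h5.
have dBb : Def (fun t => B t (beta t)) by dfn.
have [a4 [b4 [h10 h11 h12 hB]]] := itv_cover dBb h8 (fun t _ _ => EM _).
have aa : a <= a4 by lra.
have bb : b4 <= b by lra.
pose t := (a4 + b4) / 2.
have /andP[t1 t2] : (a4 < t) && (t < b4) by rewrite /t !midf_lt.
have [_] : `|beta t| <= 1 /\ ~ normal B t (beta t) by apply: hbeta; lra.
apply; apply: (normal_of_cont (lo := lo) (hi := hi) t1 t2) => //.
- by apply: cbeta; lra.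
- by apply: clo; lra.
- by apply: chi; lra.
move=> s s1 s2; have [||] := hbeta s; [by lra|by lra|].
rewrite ler_norml => /andP[p1 p2] _; have [q1 q2] := hlo s; have [q3 q4] := hhi s.
split; first by case: q1 => [->|[]//]; lra.
  by case: q3 => [e|[]]; [lra|rewrite opprK].
move=> w Bw w1 w2; have [wb|wb|//] := ltgtP w (beta s).
  by have := q2 w (or_intror (conj Bw wb)); lra.
have : - w <= - hi s by apply: q4; right; rewrite opprK.
by lra.
Qed.

Definition hascard (Q : R -> Prop) (k : nat) : Prop :=
  exists l : seq R, [/\ uniq l, size l = k & forall z, Q z <-> z \in l].

Lemma hascard_ex (Q : R -> Prop) (l : seq R) : (forall z, Q z -> z \in l) -> exists k, hascard Q k.
Proof.
move=> hl; exists (size (undup [seq z <- l | `[< Q z >]])), (undup [seq z <- l | `[< Q z >]]).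
split=> //; first exact: undup_uniq.
move=> z; rewrite mem_undup mem_filter; split=> [Qz|/andP[/asboolP]//].
by apply/andP; split; [apply/asboolP|exact: hl].
Qed.

(** For a fixed [k] the cardinality is first-order: the fibre is enumerated by a vector with
    distinct coordinates. *)
Lemma Def_hascard k : Def (fun t => hascard (B t) k).
Proof.
apply: (Def_ext (P := fun t => exists v : 'rV[R]_k, (forall i j, i != j -> v ord0 i <> v ord0 j) /\
   forall z : R, B t z <-> exists i, z = v ord0 i)); last by dfn.
move=> t; split.
  move=> [v [inj hv]]; exists [seq v ord0 i | i <- enum 'I_k]; split.
  - rewrite map_inj_in_uniq ?enum_uniq// => i j _ _ e; apply: contrapT => /eqP ij; exact: (inj _ _ ij e).
  - by rewrite size_map size_enum_ord.
  - move=> z; rewrite hv; split=> [[i ->]|/mapP[i _ ->]]; last by exists i.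
    by apply/mapP; exists i; rewrite ?mem_enum.
move=> [l [ul sl hl]]; exists (\row_i nth 0 l i); split.
  move=> i j ij; rewrite !mxE => e; move/eqP: e; rewrite nth_uniq ?sl ?ltn_ord// => /eqP e.
  by move/eqP: ij; apply; apply: val_inj.
move=> z; rewrite hl; split=> [/(nthP 0)[i il <-]|[i ->]].
  by rewrite sl in il; exists (Ordinal il); rewrite mxE.
by rewrite mxE; apply: mem_nth; rewrite sl.
Qed.

(** Each of the [k] points continues uniquely to nearby fibres. No further point appears: points of
    nearby fibres at distance at least [e] from the list would cluster at some [a], and normality at
    [(t, a)] excludes this whether or not [a] is in the fibre. *)
Lemma hascard_loc t k : ~ badat B t -> hascard (B t) k ->
  exists d : R, 0 < d /\ forall s, `|s - t| < d -> hascard (B s) k.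
Proof.
move=> nb [l [ul sl hl]].
have nrm z : `|z| <= 1 -> normal B t z by move=> z1; apply: contrapT => n; apply: nb; exists z.
have ex z : exists e0 : R, z \in l -> 0 < e0 /\ forall e : R, 0 < e -> e < e0 ->
     exists d : R, 0 < d /\ forall s : R, `|s - t| < d ->
       exists w : R, (B s w /\ `|w - z| < e) /\ forall w' : R, B s w' -> `|w' - z| < e -> w' = w.
  have [zl|/negP zl] := boolP (z \in l); last by exists 0.
  have Bz : B t z by apply/hl.
  by have [/(_ Bz)[e0 h] _] := nrm z (B1 Bz); exists e0.
have [E hE] := choice ex.
have [|e1 [e10 he1]] := @list_pos_min _ l E; first by move=> z /hE[].
(* The least distance between distinct points of the fibre; pairs on the diagonal get the harmless
   value [1]. *)
have [|e2 [e20 he2]] := @list_pos_min _ [seq (x, y) | x <- l, y <- l] (fun p => if p.1 == p.2 then 1 else `|p.1 - p.2|).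
  by move=> [x y] _ /=; case: eqP => // /eqP ne; rewrite normr_gt0 subr_eq0.
have [e [e0 ea eb]] := @pos_min2 R (e1 / 2) (e2 / 2) ltac:(lra) ltac:(lra).
have sep x y u : x \in l -> y \in l -> `|u - x| < e -> `|u - y| < e -> x = y.
  move=> xl yl h1 h2; apply: contrapT => /eqP ne.
  have := he2 (x, y); rewrite /= (negbTE ne) => /(_ _) h.
  have : e2 <= `|x - y| by apply: h; apply/allpairsP; exists (x, y).
  have -> : x - y = (u - y) - (u - x) by ring.
  by move=> k'; have := ler_normB (u - y) (u - x); clear -h1 h2 k' eb; lra.
have ex2 z : exists d : R, z \in l -> 0 < d /\ forall s : R, `|s - t| < d ->
       exists w : R, (B s w /\ `|w - z| < e) /\ forall w' : R, B s w' -> `|w' - z| < e -> w' = w.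
  have [zl|/negP zl] := boolP (z \in l); last by exists 0.
  by have [_ /(_ e e0)[|d h]] := hE z zl; [have := he1 z zl; clear -ea e10; lra|exists d].
have [D hD] := choice ex2.
have [|d1 [d10 hd1]] := @list_pos_min _ l D; first by move=> z /hD[].
have [d2 [d20 hd2]] : exists d : R, 0 < d /\ forall s w, `|s - t| < d -> B s w -> exists z, z \in l /\ `|w - z| < e.
  apply: contrapT => nd.
  pose F (d : R) (v : 'rV[R]_1) := exists s : R, `|s - t| < d /\ B s (v ord0 ord0) /\
    forall i : 'I_(size l), e <= `|v ord0 ord0 - nth 0 l i|.
  have dF : Def (fun p : R * 'rV[R]_1 => F p.1 p.2) by rewrite /F; dfn.
  have [|||a ha] := @cluster_point _ S HS 1 F 1 dF.
  - move=> d d0; apply: contrapT => nx; apply: nd; exists d; split=> // s w hs Bw.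
    apply: contrapT => nz; apply: nx; exists (\row__ w), s; rewrite !mxE; split=> //; split=> // i.
    by rewrite leNgt; apply/negP => lt; apply: nz; exists (nth 0 l i); split=> //; apply: mem_nth.
  - by move=> d d' v d0 dd' [s [hs h]]; exists s; split=> //; exact: lt_le_trans hs dd'.
  - by move=> d v i [s [_ [/B1 h _]]]; rewrite (ord1 i).
  have a1 : `|a ord0 ord0| <= 1.
    rewrite leNgt; apply/negP => lt; have [||x [[s [_ [/B1 Bx _]]] hx]] := ha 1 (`|a ord0 ord0| - 1); [by []|lra|].
    have := hx ord0; have := ler_distD (x ord0 ord0) (a ord0 ord0) 0; rewrite !subr0 distrC.
    by move=> h1 h2; clear -h1 h2 Bx; lra.
  have [nB nN] := nrm _ a1.
  have [Ba|nBa] := pselect (B t (a ord0 ord0)).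
    have al : a ord0 ord0 \in l by apply/hl.
    have [x [[s [_ [_ hx]]] /(_ ord0) ax]] := ha 1 e ltr01 e0.
    have il : (index (a ord0 ord0) l < size l)%N by rewrite index_mem.
    by have := hx (Ordinal il); rewrite /= nth_index// leNgt ax.
  have [b [d [b0 [d0 hbd]]]] := nN nBa.
  have [x [[s [hs [Bx _]]] /(_ ord0) ax]] := ha d b d0 b0.
  exact: (hbd s _ hs ax Bx).
have [d [d0 da db]] := pos_min2 d10 d20; exists d; split=> // s hs.
have ex3 z : exists w : R, z \in l -> (B s w /\ `|w - z| < e) /\ forall w' : R, B s w' -> `|w' - z| < e -> w' = w.
  have [zl|/negP zl] := boolP (z \in l); last by exists 0.
  by have [_ /(_ s)[|w h]] := hD z zl; [have := hd1 z zl; clear -hs da; lra|exists w].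
have [W hW] := choice ex3.
exists [seq W z | z <- l]; split; last 1 first.
- move=> w; split=> [Bw|/mapP[z zl ->]]; last by have [[]] := hW z zl.
  have [|z [zl hz]] := hd2 s w _ Bw; first by exact: lt_le_trans hs db.
  by apply/mapP; exists z => //; have [_ h] := hW z zl; apply: h.
- rewrite map_inj_in_uniq// => x y xl yl exy; have [[_ h1] _] := hW x xl; have [[_ h2] _] := hW y yl.
  by apply: (sep x y (W x)) => //; rewrite exy.
- by rewrite size_map.
Qed.
End FiniteFibres1.

(** * Uniform bounds for finite fibres *)

Section UniformFiniteness.
Context {R : rcfType} (S : forall n : nat, set (set 'rV[R]_n)).
Arguments S : clear implicits.
Context {HS : ominimal_structure S}.
Local Notation Def := (Def S).
Local Notation Deff := (Deff S).

Definition fibre_le (N : nat) (Q : R -> Prop) : Prop :=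
  exists l : seq R, (size l <= N)%N /\ forall z, Q z -> z \in l.
Definition finite_fibres X (A : X -> R -> Prop) : Prop :=
  forall x, exists l : seq R, forall z, A x z -> z \in l.

Lemma fibre_le_mono (N M : nat) (Q : R -> Prop) : (N <= M)%N -> fibre_le N Q -> fibre_le M Q.
Proof. by move=> NM [l [sl hl]]; exists l; split=> //; exact: leq_trans NM. Qed.

(** Over at most [K] values of [t] for each [y]: select one of them definably, bound the fibres
    above it by the statement in dimension [n], and remove it. *)
Lemma fibres_along n (A : 'rV[R]_n.+1 -> R -> Prop) (K : nat) (D : 'rV[R]_n -> R -> Prop) :
  (forall C : 'rV[R]_n -> R -> Prop, Def (fun p : 'rV[R]_n * R => C p.1 p.2) ->
    finite_fibres C -> exists N, forall x, fibre_le N (C x)) ->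
  Def (fun p : 'rV[R]_n.+1 * R => A p.1 p.2) -> finite_fibres A ->
  Def (fun p : 'rV[R]_n * R => D p.1 p.2) -> (forall y, fibre_le K (D y)) ->
  exists N, forall y t, D y t -> fibre_le N (A (vcons t y)).
Proof.
move=> ih dA fA; elim: K D => [|K ihK] D dD hD.
  by exists 0%N => y t Dt; have [l [sl /(_ t Dt)]] := hD y; case: l sl.
have dv : Deff (fun p : R * 'rV[R]_n => vcons p.1 p.2) by exact: Deff_vcons.
pose e y := dchoice (D y).
have de : Deff e by apply: (Deff_dchoice (A := D)).
pose C y z := (exists t : R, D y t) /\ A (vcons (e y) y) z.
have [||N1 hN1] := ih C; first by rewrite /C; dfn.
  by move=> y; have [l hl] := fA (vcons (e y) y); exists l => z [_ /hl].
have [||N2 hN2] := ihK (fun y t => D y t /\ t <> e y); first by dfn.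
  move=> y; have [l [sl hl]] := hD y.
  have [[t Dt]|nD] := pselect (exists t, D y t); last by exists [::]; split=> // t [Dt _]; case: nD; exists t.
  have ey : D y (e y) by apply: dchoiceP; [dfn|exists t].
  exists (rem (e y) l); split; first by rewrite size_rem ?hl//; case: (size l) sl.
  move=> z [/hl zl /eqP ze]; have := perm_to_rem (hl _ ey) => /perm_mem /(_ z).
  by rewrite zl inE (negbTE ze) /= => <-.
exists (maxn N1 N2) => y t Dt; have [te|te] := pselect (t = e y).
  apply: (@fibre_le_mono N1); first exact: leq_maxl.
  have [l [sl hl]] := hN1 y; exists l; split=> // z Az; apply: hl; split; first by exists t.
  by rewrite -te.
by apply: (@fibre_le_mono N2); [exact: leq_maxr|exact: hN2].
Qed.

(** Over each [y] the exceptional parameters [C y] are finite in number, and between them the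
    cardinality of the fibre is constant. The sets [C y] and the sets [E y] of representatives of
    the intervals in between are uniformly finite by induction, so bounds along these two families
    bound every fibre. *)
Lemma uniform_finiteness_bounded n (A : 'rV[R]_n.+1 -> R -> Prop) :
  (forall C : 'rV[R]_n -> R -> Prop, Def (fun p : 'rV[R]_n * R => C p.1 p.2) ->
    finite_fibres C -> exists N, forall x, fibre_le N (C x)) ->
  Def (fun p : 'rV[R]_n.+1 * R => A p.1 p.2) -> finite_fibres A ->
  (forall x z, A x z -> `|z| <= 1) -> exists N, forall x, fibre_le N (A x).
Proof.
move=> ih dA fA A1.
have dv : Deff (fun p : R * 'rV[R]_n => vcons p.1 p.2) by exact: Deff_vcons.
pose B y t z := A (vcons t y) z.
have dB y : Def (fun p : R * R => B y p.1 p.2) by rewrite /B; dfn.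
have fB y t : exists l : seq R, forall z, B y t z -> z \in l by exact: fA.
have B1 y t z : B y t z -> `|z| <= 1 by exact: A1.
pose C y t := badat (B y) t.
have dC : Def (fun p : 'rV[R]_n * R => C p.1 p.2) by rewrite /C /badat /normal /B; dfn.
have noitv y (a b : R) : a < b -> ~ (forall t, a < t -> t < b -> C y t).
  by move=> ab; apply: (badat_small (B := B y)) ab => //; exact: B1.
have dCy y : Def (C y) by dfn.
have fC : finite_fibres C.
  move=> y; have [[a [b [ab h]]]|//] := Def_itv_or_finite (dCy y).
  by case: (noitv y a b ab h).
pose btw (s t u : R) := (s <= u /\ u <= t) \/ (t <= u /\ u <= s).
pose comp y t s := ~ C y s /\ forall u : R, btw s t u -> ~ C y u.
(* All points of one component have the same [comp], hence the same choice, so a component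
   contributes exactly one [t]. *)
pose E y t := ~ C y t /\ t = dchoice (comp y t).
have dcomp : Def (fun p : 'rV[R]_n * R * R => comp p.1.1 p.1.2 p.2) by rewrite /comp /btw; dfn.
have dch : Deff (fun p : 'rV[R]_n * R => dchoice (comp p.1 p.2)).
  exact: (Deff_dchoice (A := fun (p : 'rV[R]_n * R) s => comp p.1 p.2 s)).
have dE : Def (fun p : 'rV[R]_n * R => E p.1 p.2).
  by apply: Def_and; [exact: Def_not|apply: Def_eq => //; dfn].
have compE y t t' : (forall u, btw t t' u -> ~ C y u) -> comp y t = comp y t'.
  move=> h; apply/funext => s; apply/propext; split=> -[h1 h2]; split=> // u hu.
    have [k|k] := pselect (btw s t u); first exact: h2.
    by apply: h; move: hu k; rewrite /btw; clear; lra.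
  have [k|k] := pselect (btw s t' u); first exact: h2.
  by apply: h; move: hu k; rewrite /btw; clear; lra.
have fE : finite_fibres E.
  move=> y; have dEy : Def (E y) by dfn.
  have [[a [b [ab h]]]|//] := Def_itv_or_finite dEy.
  exfalso; pose s := a + (b - a) / 3; pose t := a + (b - a) / 3 * 2.
  have [s1 [st t1]] : a < s /\ s < t /\ t < b by rewrite /s /t; split; [|split]; lra.
  have [_ es] := h s s1 (lt_trans st t1); have [_ et] := h t (lt_trans s1 st) t1.
  have : s = t; last by lra.
  rewrite es et; congr dchoice; apply: compE => u hu.
  by rewrite /btw in hu; have [||//] := h u; lra.
have [N1 hN1] := ih C dC fC; have [N2 hN2] := ih E dE fE.
have [N3 hN3] := fibres_along ih dA fA dC hN1.
have [N4 hN4] := fibres_along ih dA fA dE hN2.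
exists (maxn N3 N4) => x; rewrite -[x]vconsE; move: (x ord0 ord0) (vtail x) => t y.
have [Ct|nCt] := pselect (C y t).
  by apply: fibre_le_mono (leq_maxl _ _) (hN3 y t Ct).
apply: fibre_le_mono (leq_maxr _ _) _.
pose t' := dchoice (comp y t).
have [nC' hc] : comp y t t'.
  apply: dchoiceP; first by dfn.
  exists t; split=> // u hu; rewrite (_ : u = t)//; move: hu; rewrite /btw; clear; lra.
have Et' : E y t'.
  split=> //; rewrite {1}/t'; congr dchoice; apply: compE => u hu; apply: hc.
  by move: hu; rewrite /btw; clear; lra.
have [l4 [s4 h4]] := hN4 y t' Et'.
have [l hl] := fB y t'; have [k hk] := hascard_ex hl.
have gl u : ~ C y u -> exists d : R, 0 < d /\ forall v, `|v - u| < d -> ~ C y v.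
  move=> nCu; have [hr|hr] := rgerm_dich u (dCy y).
    by case: hr => d [d0 h]; case: (noitv y u (u + d)) => //; lra.
  have [hl'|hl'] := lgerm_dich u (dCy y).
    by case: hl' => d [d0 h]; case: (noitv y (u - d) u) => //; lra.
  have [d1 [d10 h1]] := hr; have [d2 [d20 h2]] := hl'.
  have [d [d0 da db]] := pos_min2 d10 d20; exists d; split=> // v.
  rewrite ltr_norml => /andP[v1 v2]; have [uv|vu|<-//] := ltgtP u v.
    by apply: h1; lra.
  by apply: h2; lra.
have [d [d0 hd]] := gl t nCt; have [d' [d'0 hd']] := gl t' nC'.
have kt : hascard (B y t) k.
  have dk : Def (fun s => hascard (B y s) k) by exact: Def_hascard.
  (* The interval is enlarged by [d] and [d'] at its ends because connectedness is stated for
     interior points. *)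
  apply: (@itv_conn _ S HS (fun s => hascard (B y s) k) (Num.min (t - d) (t' - d')) (Num.max (t + d) (t' + d')) dk _ t' t) => //.
  - move=> u; rewrite gt_min lt_max => u1 u2.
    have nCu : ~ C y u.
      have [hu|hu] := pselect (btw t' t u); first exact: hc.
      have [h|h] := pselect (`|u - t| < d); first exact: hd.
      apply: hd'; move: h hu; rewrite /btw !ltr_norml => /negP; rewrite negb_and -!leNgt => h hu.
      by move: u1 u2 => /orP u1 /orP u2; move/orP: h => h; apply/andP; split; lra.
    have [lu hlu] := fB y u; have [ku hku] := hascard_ex hlu.
    have [q [q0 hq]] := hascard_loc (dB y) (@B1 y) nCu hku.
    exists q; split=> // v hv; have hkv := hq v hv.
    have uq (Q : R -> Prop) i j : hascard Q i -> hascard Q j -> i = j.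
      move=> [l1 [u1' <- e1]] [l2 [u2' <- e2]]; apply: perm_size; apply: uniq_perm => // z.
      by apply/idP/idP => /[dup]; [move=> /e1/e2|move=> /e2/e1].
    by split=> h; [rewrite (uq _ _ _ h hku)|rewrite (uq _ _ _ h hkv)].
  - by rewrite gt_min; apply/orP; right; lra.
  - by rewrite lt_max; apply/orP; right; lra.
  - by rewrite gt_min; apply/orP; left; lra.
  - by rewrite lt_max; apply/orP; left; lra.
have [la [ua sa ha]] := kt; have [lb [ub sb hb]] := hk.
exists la; split; last by move=> z /ha.
apply: leq_trans s4; rewrite sa -sb; apply: uniq_leq_size => // z /hb; exact: h4.
Qed.

(** The injection [u / (1 + |u|)], with inverse [z / (1 - |z|)], compresses the fibres into
    [(-1, 1)] and reduces to the bounded case. *)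
Theorem uniform_finiteness n (A : 'rV[R]_n -> R -> Prop) :
  Def (fun p : 'rV[R]_n * R => A p.1 p.2) -> finite_fibres A ->
  exists N, forall x, fibre_le N (A x).
Proof.
elim: n A => [|n ih] A dA fA.
  have [l hl] := fA 0; exists (size l) => x; exists l; split=> // z.
  by rewrite [x]thinmx0; exact: hl.
pose g (u : R) := u / (1 + `|u|).
have gb u : `|g u| < 1.
  have u0 := normr_ge0 u; rewrite /g normrM normfV [`|1 + _|]ger0_norm; last by lra.
  by rewrite ltr_pdivrMr; lra.
have gK u : g u / (1 - `|g u|) = u.
  have u0 := normr_ge0 u; have e : `|g u| = `|u| / (1 + `|u|).
    by rewrite /g normrM normfV [`|1 + _|]ger0_norm//; lra.
  have ne : 1 + `|u| != 0 by apply: lt0r_neq0; lra.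
  have -> : 1 - `|g u| = (1 + `|u|)^-1 by rewrite e -{1}(divff ne) -mulrBl addrK div1r.
  by rewrite invrK /g divfK.
pose A' x z := `|z| < 1 /\ A x (z / (1 - `|z|)).
have [||x z [/ltW]//|N hN] := @uniform_finiteness_bounded n A' ih.
- by rewrite /A'; dfn.
- move=> x; have [l hl] := fA x; exists [seq g u | u <- l] => z [z1 Az].
  apply/mapP; exists (z / (1 - `|z|)); first exact: hl.
  rewrite /g normrM normfV [`|1 - _|]gtr0_norm; last by lra.
  have ne : 1 - `|z| != 0 by apply: lt0r_neq0; lra.
  have -> : 1 + `|z| / (1 - `|z|) = (1 - `|z|)^-1 by rewrite -{1}(divff ne) -mulrDl subrK div1r.
  by rewrite invrK divfK.
exists N => x; have [l [sl hl]] := hN x; exists [seq z / (1 - `|z|) | z <- l].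
rewrite size_map; split=> // z Az; apply/mapP; exists (g z); last by rewrite gK.
by apply: hl; split; [exact: gb|rewrite gK].
Qed.
End UniformFiniteness.

(** * Flat functions and extension by zero *)

Section Flat.
Context {R : rcfType} (S : forall n : nat, set (set 'rV[R]_n)).
Arguments S : clear implicits.
Context {HS : ominimal_structure S}.
Local Notation Def := (Def S).
Local Notation Deff := (Deff S).

Definition derivf (f : R -> R) (x : R) : R := xget 0 [set l | isd f x l].

Lemma derivfP f x l : isd f x l -> isd f x (derivf f x).
Proof. by move=> h; exact: (@xgetPex _ 0 [set l | isd f x l] (ex_intro _ l h)). Qed.

Lemma Deff_derivf f : Deff f -> Deff (derivf f).
Proof.
move=> df; have d : Def (fun p : R * R => isd f p.1 p.2) by rewrite /isd; dfn.
apply: (Deff_rel (G := fun x y => isd f x y \/ ((~ exists l : R, isd f x l) /\ y = 0))); last by dfn.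
move=> x y; split=> [[h|[h ->]]|->].
- exact: isd_uniq h (derivfP h).
- by rewrite /derivf xgetPN// => l hl; apply: h; exists l.
- have [[l hl]|h] := pselect (exists l, isd f x l); first by left; exact: derivfP hl.
  by right; split=> //; rewrite /derivf xgetPN// => l hl; apply: h; exists l.
Qed.

Lemma derivf_germ f : Deff f -> rgerm 0 (fun x => isd f x (derivf f x)).
Proof.
move=> df; have d' := Deff_derivf df.
apply: rgerm_of_ex; first by rewrite /isd; dfn.
move=> b b0; have [c [d [r [h1 h2 h3 _ h4]]]] := deriv_gen df b0.
exists ((c + d) / 2); split; [lra|lra|apply: derivfP (h4 _ _ _); lra].
Qed.

(** A monotone derivative at [s] lies between the mean slopes over [[s / 2, s]] and [[s, 2 s]]. The
    half-length interval on the left is what produces the factor [4]. *)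
Lemma deriv_monotone_bound (f r H : R -> R) (e s : R) : Deff f -> 0 < s -> s * 2 < e ->
  (forall x, 0 < x -> x < e -> isd f x (r x)) ->
  (nondecr_on r 0 e \/ noninc_on r 0 e) ->
  (forall x, 0 < x -> x < e -> `|f x| <= H x) ->
  (forall x y, 0 < x -> x <= y -> y < e -> H x <= H y) ->
  `|r s| <= 4 * H (s * 2) / s.
Proof.
move=> df s0 se hf hm hH mH.
have main (g q : R -> R) : Deff g -> (forall x, 0 < x -> x < e -> isd g x (q x)) ->
    nondecr_on q 0 e -> (forall x, 0 < x -> x < e -> `|g x| <= H x) -> `|q s| <= 4 * H (s * 2) / s.
  move=> dg hg mq hgH.
  have h1 : q s * (s * 2 - s) <= g (s * 2) - g s.
    apply: (@isd_slope _ S HS g q) => //; first by lra.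
      by move=> x x1 x2; apply: hg; lra.
    by move=> x x1 x2; apply: mq; lra.
  have h2 : - q s * (s - s / 2) <= - g s - - g (s / 2).
    apply: (@isd_slope _ S HS (fun x => - g x) (fun x => - q x)); [by dfn|lra| |].
      by move=> x x1 x2; apply: isd_opp; apply: hg; lra.
    by move=> x x1 x2; rewrite lerN2; apply: mq; lra.
  have b1 : `|g (s * 2)| <= H (s * 2) by apply: hgH; lra.
  have b2 : `|g s| <= H (s * 2) by apply: le_trans (hgH s _ _) (mH _ _ _ _ _); lra.
  have b3 : `|g (s / 2)| <= H (s * 2) by apply: le_trans (hgH _ _ _) (mH _ _ _ _ _); lra.
  move: b1 b2 b3; rewrite !ler_norml => /andP[u1 u2] /andP[u3 u4] /andP[u5 u6].
  have k1 : - (4 * H (s * 2)) <= q s * s by lra.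
  have k2 : q s * s <= 4 * H (s * 2) by lra.
  by apply/andP; split; [rewrite lerNl ler_pdivlMr// mulNr|rewrite ler_pdivlMr//]; lra.
case: hm => hm; first exact: main hm hH.
rewrite -normrN; apply: (main (fun x => - f x) (fun x => - r x)) => //; first by dfn.
- by move=> x x1 x2; apply: isd_opp; exact: hf.
- by move=> x y x1 xy y1; rewrite lerN2; exact: hm.
- by move=> x x1 x2; rewrite normrN; exact: hH.
Qed.

(** The derivative has a constant sign on the right germ at [0]. *)
Lemma monotone_germ f : Deff f -> exists e : R, 0 < e /\ (nondecr_on f 0 e \/ noninc_on f 0 e).
Proof.
move=> df; have [e [e0 he]] := derivf_germ df.
have d1 : Def (fun x => 0 <= derivf f x) by have := Deff_derivf df; dfn.
have [[d [d0 hd]]|[d [d0 hd]]] := rgerm_dich 0 d1; have [k [k0 ke kd]] := pos_min2 e0 d0;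
  exists k; split=> //; [left|right] => x y x1 xy y1.
  rewrite -subr_ge0 -[X in X <= _](mul0r (y - x)).
  apply: (@isd_slope _ S HS f (derivf f)) => // z z1 z2; first by apply: he; lra.
  by apply: hd; lra.
rewrite -lerN2 -subr_ge0 -[X in X <= _](mul0r (y - x)).
apply: (@isd_slope _ S HS (fun z => - f z) (fun z => - derivf f z)) => //; first by dfn.
  by move=> z z1 z2; apply: isd_opp; apply: he; lra.
by move=> z z1 z2; have /negP := hd z ltac:(lra) ltac:(lra); rewrite -ltNge; lra.
Qed.

(** Monotonicity serves to absorb a change of scale in the argument of [b]. *)
Definition gauge (b : R -> R) : Prop :=
  [/\ Deff b, forall t, 0 < t -> 0 < b t & forall s t, 0 < s -> s <= t -> b s <= b t].

(** The bound [t * b t] is required of [rho] and of all derivatives up to order [p]. Regularity is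
    required up to [2] so that the value [1], which the functions composed with [rho] may take, is
    an interior point. *)
Fixpoint flat (p : nat) (b rho : R -> R) : Prop :=
  Deff rho /\ (forall t : R, 0 < t -> t <= 1 -> `|rho t| <= t * b t) /\
  match p with
  | 0%N => forall t, 0 < t -> t < 2 -> contR rho t
  | p'.+1 => exists rho' : R -> R, (forall t, 0 < t -> t < 2 -> isd rho t (rho' t)) /\ flat p' b rho'
  end.

Lemma flatS p b rho : flat p.+1 b rho <-> Deff rho /\ (forall t : R, 0 < t -> t <= 1 -> `|rho t| <= t * b t) /\
  exists rho' : R -> R, (forall t, 0 < t -> t < 2 -> isd rho t (rho' t)) /\ flat p b rho'.
Proof. by []. Qed.

Lemma flat_le p b b' rho : (forall t, 0 < t -> t <= 1 -> b t <= b' t) -> flat p b rho -> flat p b' rho.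
Proof.
move=> bb; have tr (r : R -> R) : (forall t : R, 0 < t -> t <= 1 -> `|r t| <= t * b t) ->
    forall t : R, 0 < t -> t <= 1 -> `|r t| <= t * b' t.
  by move=> h t t0 t1; apply: le_trans (h t t0 t1) _; rewrite ler_pM2l//; exact: bb.
elim: p rho => [|p ih] rho; first by move=> [dr [hr h]]; split=> //; split=> //; exact: tr.
move=> /flatS[dr [hr [r' [h1 h2]]]]; apply/flatS; split=> //; split; first exact: tr.
by exists r'; split=> //; exact: ih.
Qed.

Lemma flat_pred p b rho : flat p.+1 b rho -> flat p b rho.
Proof.
elim: p rho => [|p ih] rho /flatS[dr [hr [r' [h1 h2]]]].
  by split=> //; split=> // t t0 t2; exact: isd_cont (h1 t t0 t2).
by apply/flatS; split=> //; split=> //; exists r'; split=> //; exact: ih.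
Qed.

Lemma flat_bound p b rho : flat p b rho -> forall t : R, 0 < t -> t <= 1 -> `|rho t| <= t * b t.
Proof. by case: p => [|p] [_ []]. Qed.

Lemma flat_Deff p b rho : flat p b rho -> Deff rho.
Proof. by case: p => [|p] []. Qed.

Lemma isd_scale f (k c x l : R) : 0 < k -> isd f (k * x) l -> isd (fun t => c * f (k * t)) x (c * k * l).
Proof.
move=> k0 h e e0; have c0 := normr_ge0 c.
have e1 : 0 < e / ((1 + `|c|) * k) by apply: divr_gt0 => //; apply: mulr_gt0 => //; lra.
have [d [d0 hd]] := h _ e1; exists (d / k); split; first exact: divr_gt0.
move=> s; rewrite ltr_pdivlMr// => hs.
have := hd (k * s); rewrite normrM (gtr0_norm k0) mulrC => /(_ hs) h1.
rewrite -mulrDr in h1.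
have -> : c * f (k * (x + s)) - c * f (k * x) - c * k * l * s = c * (f (k * (x + s)) - f (k * x) - l * (k * s)) by ring.
rewrite normrM; apply: le_trans (ler_wpM2l c0 h1) _.
have -> : `|c| * (e / ((1 + `|c|) * k) * (`|s| * k)) = `|c| / (1 + `|c|) * (e * `|s|).
  by field; apply/andP; split; apply: lt0r_neq0 => //; lra.
apply: ler_piMl; first by rewrite mulr_ge0// ltW.
by rewrite ler_pdivrMr; lra.
Qed.

(** Start from [t^(p+1) b(t)]. Near [0] its derivatives exist and are monotone, so each
    differentiation costs one power of [s] and a doubling of the argument of [b]: the [k]-th is at
    most [C s^(p-k+1) b(2^k s)]. A rescaling of the variable and division by [C] turn this into the
    bounds on [(0, 1]]. *)
Lemma flat_exists p b : gauge b ->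
  exists rho, flat p b rho /\ forall t : R, 0 < t -> t <= 1 -> 0 < rho t.
Proof.
move=> [db b0 mb].
pose c (t : R) := t ^+ p.+1 * b t.
have dc : Deff c by rewrite /c; dfn.
pose cs k := iter k derivf c.
have dcs k : Deff (cs k) by elim: k => [|k ih] //=; exact: Deff_derivf.
have two (k : nat) : (0 : R) < 2 ^+ k by rewrite exprn_gt0.
have bnd (k : nat) : (k <= p)%N -> exists C e : R, [/\ 0 < C, 0 < e &
    forall s, 0 < s -> s < e -> `|cs k s| <= C * s ^+ (p - k).+1 * b (2 ^+ k * s)].
  elim: k => [_|k ih kp].
    exists 1, 1; split=> // s s0 _; rewrite subn0 expr0 !mul1r /cs /= /c ger0_norm//.
    by rewrite mulr_ge0// ltW// ?exprn_gt0// b0.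
  have [C [e [C0 e0 h]]] := ih (ltnW kp).
  have [e1 [e10 h1]] := derivf_germ (dcs k).
  have [e2 [e20 h2]] := monotone_germ (dcs k.+1).
  have [m1 [m10 m1a m1b]] := pos_min2 e10 e20; have [m [m0 ma mb']] := pos_min2 m10 e0.
  exists (4 * (C * 2 ^+ (p - k).+1)), (m / 2); split; [|lra|move=> s s0 sm].
    by apply: mulr_gt0 => //; apply: mulr_gt0.
  pose H (x : R) := C * x ^+ (p - k).+1 * b (2 ^+ k * x).
  have := @deriv_monotone_bound (cs k) (cs k.+1) H m s (dcs k) s0 ltac:(lra).
  move=> /(_ _ _ _ _) hb; apply: le_trans (hb _ _ _ _) _.
  - by move=> x x1 x2; apply: h1; lra.
  - by case: h2 => h2; [left|right] => x y x1 xy y1; apply: h2; lra.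
  - by move=> x x1 x2; apply: h; lra.
  - move=> x y x1 xy y1; rewrite /H; apply: ler_pM.
    + by rewrite mulr_ge0 ?ltW// exprn_gt0.
    + by rewrite ltW// b0// mulr_gt0.
    + by rewrite ler_pM2l// ler_pXn2r// nnegrE; lra.
    + by apply: mb; [exact: mulr_gt0|rewrite ler_pM2l].
  rewrite /H subnS prednK; last by rewrite subn_gt0.
  have -> : 2 ^+ k * (s * 2) = 2 ^+ k.+1 * s by rewrite exprSr; ring.
  have -> : 4 * (C * (s * 2) ^+ (p - k).+1 * b (2 ^+ k.+1 * s)) / s =
     4 * (C * 2 ^+ (p - k).+1) * s ^+ (p - k) * b (2 ^+ k.+1 * s).
    by rewrite exprMn exprS; field; exact: lt0r_neq0.
  exact: lexx.
have [e [e0 he]] : exists e : R, 0 < e /\ forall k : 'I_p.+1, forall s, 0 < s -> s < e -> isd (cs k) s (cs k.+1 s).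
  have ex (k : 'I_p.+1) : exists e : R, 0 < e /\ forall s, 0 < s -> s < e -> isd (cs k) s (cs k.+1 s).
    have [e [e0 h]] := derivf_germ (dcs k); exists e; split=> // s s0 se; apply: h => //.
    by rewrite add0r.
  have [E hE] := choice ex; have [|e [e0 h]] := @fin_pos_min R _ E; first by move=> k; case: (hE k).
  exists e; split=> // k s s0 se; have [_ hk] := hE k; apply: hk => //; exact: lt_le_trans se (h k).
have [C [e' [C0 e'0 hC]]] : exists C e : R, [/\ 0 < C, 0 < e & forall (k : 'I_p.+1) s, 0 < s -> s < e ->
    `|cs k s| <= C * s ^+ (p - k).+1 * b (2 ^+ k * s)].
  have ex (k : 'I_p.+1) : exists Ce : R * R, [/\ 0 < Ce.1, 0 < Ce.2 & forall s, 0 < s -> s < Ce.2 ->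
    `|cs k s| <= Ce.1 * s ^+ (p - k).+1 * b (2 ^+ k * s)].
    by have [C [e' h]] := bnd k (ltn_ord k : (k <= p)%N); exists (C, e').
  have [E hE] := choice ex.
  have [|e' [e'0 h]] := @fin_pos_min R _ (fun k => (E k).2); first by move=> k; case: (hE k).
  have [|C [C0 hC]] := @fin_pos_min R _ (fun k => (E k).1^-1); first by move=> k; rewrite invr_gt0; case: (hE k).
  exists C^-1, e'; split=> //; first by rewrite invr_gt0.
  move=> k s s0 se; have [k1 k2 hk] := hE k.
  apply: le_trans (hk s s0 (lt_le_trans se (h k))) _; rewrite -!mulrA ler_wpM2r//.
    by rewrite mulr_ge0// ltW// ?exprn_gt0// b0// mulr_gt0.
  by rewrite -[X in X <= _]invrK lef_pV2 ?posrE ?invr_gt0.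
have [m1 [m10 m1a m1b]] := pos_min2 e0 e'0.
(* [q <= m1 / 2] brings [q * t], for [t < 2], into the range where the estimates hold; [q <= 2^-p]
   undoes the doublings, since then [b (2^k q t) <= b t]. *)
have [q [q0 qa qb]] := @pos_min2 R (m1 / 2) (2 ^+ p)^-1 ltac:(lra) ltac:(by rewrite invr_gt0).
have p1 : (1 : R) <= 2 ^+ p by rewrite exprn_ege1// ler1n.
have qp : 2 ^+ p * q <= 1 by rewrite mulrC -ler_pdivlMr// div1r.
have q1 : q <= 1 by apply: le_trans qb _; rewrite invf_le1.
(* By the chain rule this is the [k]-th derivative of [C^-1 c(q t)]. *)
pose rho k t := C^-1 * q ^+ k * cs k (q * t).
have drho k : Deff (rho k) by have := dcs k; rewrite /rho; dfn.
have rb (k : 'I_p.+1) (t : R) : 0 < t -> t <= 1 -> `|rho k t| <= t * b t.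
  move=> t0 t1; have qt0 : 0 < q * t by exact: mulr_gt0.
  have qt1 : q * t <= q by rewrite ger_pMr.
  have hk : `|cs k (q * t)| <= C * (q * t) ^+ (p - k).+1 * b (2 ^+ k * (q * t)) by apply: hC => //; lra.
  have qk1 : q ^+ k <= 1 by rewrite exprn_ile1// ltW.
  have qk0 : 0 < q ^+ k by rewrite exprn_gt0.
  rewrite /rho normrM (gtr0_norm (mulr_gt0 _ _)) ?invr_gt0//.
  apply: le_trans (ler_wpM2l _ hk) _; first by rewrite ltW// mulr_gt0// invr_gt0.
  have -> : C^-1 * q ^+ k * (C * (q * t) ^+ (p - k).+1 * b (2 ^+ k * (q * t))) =
    q ^+ k * ((q * t) ^+ (p - k).+1 * b (2 ^+ k * (q * t))) by field; exact: lt0r_neq0.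
  have x0 : 0 <= (q * t) ^+ (p - k).+1 by rewrite exprn_ge0// ltW.
  have y0 : 0 <= b (2 ^+ k * (q * t)) by rewrite ltW// b0// mulr_gt0.
  apply: le_trans (ler_piMl (mulr_ge0 x0 y0) qk1) _.
  apply: ler_pM => //.
    rewrite exprS; apply: le_trans (_ : q * t * 1 <= _); last by rewrite mulr1 ger_pMl.
    by rewrite ler_pM2l//; apply: exprn_ile1; [exact: ltW|exact: le_trans qt1 q1].
  apply: mb; first exact: mulr_gt0.
  rewrite mulrA ger_pMl//; apply: le_trans qp; rewrite ler_pM2r//.
  by rewrite ler_eXn2l ?ltr1n// -ltnS ltn_ord.
have isr (k : 'I_p.+1) (t : R) : 0 < t -> t < 2 -> isd (rho k) t (rho k.+1 t).
  move=> t0 t2; have -> : rho k.+1 t = C^-1 * q ^+ k * q * cs k.+1 (q * t) by rewrite /rho exprSr mulrA.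
  apply: isd_scale => //; apply: he; first exact: mulr_gt0.
  apply: lt_le_trans (_ : q * 2 <= _); first by rewrite ltr_pM2l.
  by lra.
exists (rho 0%N); split; last first.
  move=> t t0 t1; rewrite /rho expr0 mulr1 mulr_gt0 ?invr_gt0// /cs /= /c mulr_gt0 ?exprn_gt0 ?mulr_gt0//.
  by apply: b0; exact: mulr_gt0.
have : forall j, (j <= p)%N -> flat j b (rho (p - j)%N).
  elim=> [_|j ih jp].
    split; first exact: drho.
    rewrite subn0; split=> [t t0 t1|t t0 t2]; first exact: (rb (@Ordinal p.+1 p (ltnSn p))).
    exact: isd_cont (isr (@Ordinal p.+1 p (ltnSn p)) t t0 t2).
  have lt : (p - j.+1 < p.+1)%N by rewrite ltnS leq_subr.
  apply/flatS; split=> //; split; first exact: (rb (Ordinal lt)).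
  exists (rho (p - j)%N); split; last by apply: ih; exact: ltnW.
  move=> t t0 t2; have := isr (Ordinal lt) t t0 t2.
  by rewrite /= subnS prednK// subn_gt0.
by move=> /(_ p (leqnn p)); rewrite subnn.
Qed.

Lemma isd_hasD1 (rho : R -> R) (v : 'rV[R]_1) l : isd rho (v ord0 ord0) l ->
  hasD (fun w => rho (w ord0 ord0)) v (fun=> l).
Proof.
move=> h; apply: hasD_intro => e e0; have [d [d0 hd]] := h e e0; exists d; split=> // w hw.
rewrite big_ord_recl big_ord0 addr0 mxE [_ * l]mulrC; apply: le_trans (hd _ (hw ord0)) _.
by rewrite ler_pM2l//; exact: norm_row_le.
Qed.

Lemma hasD_comp1 n (rho : R -> R) (f : 'rV[R]_n -> R) x l g : isd rho (f x) l -> hasD f x g ->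
  hasD (fun y => rho (f y)) x (fun i => g i * l).
Proof.
move=> hr hf.
have := @hasD_comp R n 1 (fun w => rho (w ord0 ord0)) (fun y => \row__ f y) x (fun=> l) (fun=> g).
rewrite (_ : (fun y => rho ((\row__ f y) ord0 ord0)) = fun y => rho (f y)); last by apply/funext => y; rewrite mxE.
rewrite (_ : (fun i => \sum_(j < 1) g i * l) = fun i => g i * l); last by apply/funext => i; rewrite big_ord_recl big_ord0 addr0.
apply; first by apply: isd_hasD1; rewrite mxE.
by move=> j; have := hf; congr hasD; apply/funext => y; rewrite mxE.
Qed.

Lemma flat_dC p b rho : flat p b rho ->
  dC S p (fun v : 'rV[R]_1 => 0 < v ord0 ord0 /\ v ord0 ord0 < 2) (fun v => rho (v ord0 ord0)).
Proof.
elim: p rho => [|p ih] rho.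
  move=> [dr [_ h]]; split=> [|v [v0 v2]]; first by dfn.
  move=> e e0; have [d [d0 hd]] := h _ v0 v2 e e0; exists d; split=> // w /(_ ord0); exact: hd.
move=> /flatS[dr [_ [r' [h1 h2]]]]; apply/dCS; split; first by dfn.
exists (fun _ v => r' (v ord0 ord0)); split=> [v [v0 v2]|_]; last exact: ih.
exact/isd_hasD1/h1.
Qed.

Lemma gauge_min2 b1 b2 : gauge b1 -> gauge b2 ->
  exists b, gauge b /\ forall t, b t <= b1 t /\ b t <= b2 t.
Proof.
move=> [d1 p1 m1] [d2 p2 m2]; exists (fun t => Num.min (b1 t) (b2 t)); split; last first.
  by move=> t; rewrite !ge_min !lexx orbT.
split.
- apply: (Deff_ext (f := fun t => if `[< b1 t < b2 t >] then b1 t else b2 t)); last by dfn.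
  by move=> t; rewrite /Order.min; case: asboolP => [->//|/negP/negbTE ->].
- by move=> t t0; rewrite lt_min p1// p2.
- by move=> s t s0 st; rewrite le_min !ge_min (m1 s t)// (m2 s t)// orbT.
Qed.

Lemma gauge_min (T : finType) (b : T -> R -> R) : (forall i, gauge (b i)) ->
  exists b0, gauge b0 /\ forall i t, b0 t <= b i t.
Proof.
move=> hb; have [b0 [g0 h0]] : exists b0, gauge b0 /\ forall i t, i \in enum T -> b0 t <= b i t.
  elim: (enum T) => [|i l [b0 [g0 h0]]].
    by exists (fun=> 1); split=> //; split=> //; dfn.
  have [b1 [g1 h1]] := gauge_min2 g0 (hb i); exists b1; split=> // j t.
  rewrite inE => /orP[/eqP->|jl]; first by case: (h1 t).
  by apply: le_trans (h1 t).1 _; exact: h0.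
by exists b0; split=> // i t; apply: h0; rewrite mem_enum.
Qed.
End Flat.

(** * Extending flat compositions by zero *)

Section FlatExtension.
Context {R : rcfType} (S : forall n : nat, set (set 'rV[R]_n)).
Arguments S : clear implicits.
Context {HS : ominimal_structure S}.
Local Notation Def := (Def S).
Local Notation Deff := (Deff S).

Local Notation gauge := (gauge S).
Local Notation flat := (flat S).
Local Notation dC := (dC S).

Context (n : nat) (V : 'rV[R]_n -> Prop) (A : 'rV[R]_n -> R).
Hypotheses (dV : Def V) (oV : isopen V) (dA : Deff A) (A0 : forall x, 0 <= A x) (A1 : forall x, A x <= 1)
  (cA : forall x, V x -> contV A x).

Definition posset (x : 'rV[R]_n) : Prop := V x /\ 0 < A x.
Definition zext (rho : R -> R) (u : 'rV[R]_n -> R) (x : 'rV[R]_n) : R :=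
  if `[< posset x >] then rho (A x) * u x else 0.

Let dcube : Def (fun p : 'rV[R]_n * R * 'rV[R]_n => cube p.1.1 p.1.2 p.2).
Proof. exact: Def_cube. Qed.

Lemma Def_posset : Def posset.
Proof. by rewrite /posset; dfn. Qed.

Lemma posset_open : isopen posset.
Proof.
move=> x [Vx Ax]; have [r [r0 hr]] := oV Vx; have [d [d0 hd]] := cA Vx Ax.
have [k [k0 kr kd]] := pos_min2 r0 d0; exists k; split=> // y hy; split.
  by apply: hr; exact: cube_le hy.
by have := hd y (cube_le kd hy); rewrite ltr_norml => /andP[h _]; lra.
Qed.

Lemma Deff_zext rho u : Deff rho -> Deff u -> Deff (zext rho u).
Proof. by move=> dr du; have := Def_posset; rewrite /zext; dfn. Qed.

(** A definably compact exhaustion of [posset]: bounded by [1 / t], at distance at least [t] from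
    the complement of [V], and with [A >= t]. The sets shrink as [t] grows. *)
Definition deep (t : R) (x : 'rV[R]_n) : Prop :=
  (forall i, `|x ord0 i| <= t^-1) /\ (forall y : 'rV[R]_n, cube x t y -> V y) /\ t <= A x.

(** As [y] tends to a point [x] of [V] where [A] vanishes, [A y] tends to [0], so bounds by
    [1 / A y] and by distance [A y] become automatic. Estimates on the deep sets thus control the
    whole approach to the boundary inside [V]. *)
Lemma deep_near x : V x -> ~ posset x ->
  exists r : R, 0 < r /\ forall y, cube x r y -> posset y -> deep (A y) y /\ A y < 1.
Proof.
move=> Vx nx; have Ax : A x = 0.
  apply/eqP; rewrite eq_le A0 andbT leNgt; apply/negP => h; exact: nx.
have [r [r0 hr]] := oV Vx; have x0 := normr_ge0 x.
have [k [k0 ka kb]] := @pos_min2 R (r / 2) (2 + `|x|)^-1 ltac:(lra) ltac:(by rewrite invr_gt0; lra).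
have [d [d0 hd]] := cA Vx k0.
have [m [m0 ma mb]] := @pos_min2 R d (r / 2) d0 ltac:(lra).
have [q [q0 qa qb]] := pos_min2 m0 (@ltr01 R).
exists q; split=> // y hy [Vy Ay].
have Ak : A y < k.
  by have := hd y (cube_le (le_trans qa ma) hy); rewrite Ax subr0 ger0_norm.
have k1 : k < 1 by apply: le_lt_trans kb _; rewrite invf_lt1; lra.
split; last exact: lt_trans Ak k1.
split; [|split=> // z hz].
  move=> i; have : `|y ord0 i| <= 1 + `|x|.
    have := hy i; have := ler_normD (y ord0 i - x ord0 i) (x ord0 i); rewrite subrK.
    by have := norm_row_le x i; lra.
  move=> h; apply: le_trans (_ : 2 + `|x| <= _); first by lra.
  rewrite -[X in X <= _]invrK lef_pV2 ?posrE ?invr_gt0//; last by lra.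
apply: hr; apply: cube_half (_ : cube x (r / 2) y) _; first by apply: cube_le hy; lra.
by apply: cube_le hz; lra.
Qed.

(** On each [deep t] a locally bounded [w] is bounded by definable compactness. The gauge is the
    supremum of the [v <= 1] with [w * v <= 1] on [deep t]; it is nondecreasing because the deep
    sets shrink. *)
Lemma gauge_of_locally_bounded (w : 'rV[R]_n -> R) : Deff w ->
  (forall a, posset a -> exists r B : R, 0 < r /\ forall x, cube a r x -> posset x -> w x <= B) ->
  exists b, gauge b /\ forall x, posset x -> deep (A x) x -> w x * b (A x) <= 1.
Proof.
move=> dw lw; have ddeep : Def (fun p : R * 'rV[R]_n => deep p.1 p.2) by rewrite /deep; dfn.
pose Q t v := 0 < v /\ v <= 1 /\ forall x : 'rV[R]_n, deep t x -> w x * v <= 1.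
have dQ : Def (fun p : R * R => Q p.1 p.2) by rewrite /Q; dfn.
have deepO t x : 0 < t -> deep t x -> posset x.
  move=> t0 [_ [h1 h2]]; split; last exact: lt_le_trans h2.
  by apply: h1; exact: cube_refl.
have neQ t : 0 < t -> exists v, Q t v.
  move=> t0; have ddt : Def (deep t) by dfn.
  have [|||B hB] := @bounded_of_locally _ S HS n (deep t) w t^-1 ddt dw.
  - by move=> x i [].
  - move=> a ha; have Va y : cube a t y -> V y.
      move=> hy; have [d [d0 hd]] := cube_open (cube_sym hy).
      have [x [[_ [hx _]] ax]] := ha d d0; apply: hx.
      exact: cube_sym (hd _ ax).
    have Va' : V a by apply: Va; exact: cube_refl.
    split; [|split=> //].
      move=> i; rewrite leNgt; apply/negP => lt.
      have [|x [[hx _] ax]] := ha (`|a ord0 i| - t^-1); first by lra.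
      have := ax i; have := hx i; have := ler_normD (x ord0 i) (a ord0 i - x ord0 i).
      by rewrite [X in `|X| <= _]addrC subrK (distrC (a ord0 i)); lra.
    rewrite leNgt; apply/negP => lt; have [|d [d0 hd]] := cA Va' (_ : 0 < t - A a); first by lra.
    have [x [[_ [_ hx]] ax]] := ha d d0.
    by have := hd x ax; rewrite ltr_norml => /andP[_ h]; lra.
  - move=> a /(deepO _ _ t0) /lw [r [B [r0 hB]]]; exists r, B; split=> // x hx /(deepO _ _ t0).
    exact: hB.
  have B0 := normr_ge0 B; exists (1 + `|B|)^-1; split; first by rewrite invr_gt0; lra.
  split=> [|x /hB hx]; first by rewrite invf_le1; lra.
  by rewrite ler_pdivrMr; have := ler_norm B; lra.
pose b t := dsup (Q t).
have db : Deff b by apply: (Deff_dsup (A := Q)).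
have lub t : 0 < t -> islub (Q t) (b t).
  by move=> t0; apply: dsupP; [dfn|exact: neQ|exists 1 => v [_ []]].
exists b; split; first split=> //.
- by move=> t t0; have [l1 _] := lub t t0; have [v Qv] := neQ t t0; apply: lt_le_trans (l1 v Qv); case: Qv.
- move=> s t s0 st; have t0 : 0 < t by exact: lt_le_trans st.
  have [_ l2] := lub s s0; have [l1 _] := lub t t0; apply: l2 => v [v0 [v1 hv]]; apply: l1.
  split=> //; split=> // x [h1 [h2 h3]]; apply: hv; split.
    move=> i; apply: le_trans (h1 i) _; by rewrite lef_pV2 ?posrE.
  split; last exact: le_trans st h3.
  by move=> y hy; apply: h2; exact: cube_le hy.
- move=> x [Vx Ax] dx; have [_ l2] := lub _ Ax.
  have [w0|w0] := leP (w x) 0.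
    apply: le_trans (_ : 0 <= 1); last by [].
    rewrite -oppr_ge0 -mulNr mulr_ge0 ?oppr_ge0//.
    by have [l1 _] := lub _ Ax; have [v Qv] := neQ _ Ax; apply: le_trans (l1 v Qv); case: Qv => /ltW.
  rewrite mulrC -ler_pdivlMr// div1r; apply: l2 => v [_ [_ hv]].
  by rewrite -div1r ler_pdivlMr// mulrC; exact: hv.
Qed.

Lemma zext_in p b rho u : dC p posset A -> dC p posset u -> flat p b rho -> dC p posset (zext rho u).
Proof.
move=> hA hu hr.
apply: (dC_ext (f := fun x => rho (A x) * u x)) => //.
- exact: posset_open.
- by apply: Deff_zext; [exact: flat_Deff hr|exact: dC_Deff hu].
- by move=> x Ox; rewrite /zext asboolT.
apply: dC_mul => //; have := @dC_comp _ S HS n 1 p posset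
  (fun v : 'rV[R]_1 => 0 < v ord0 ord0 /\ v ord0 ord0 < 2) (fun v => rho (v ord0 ord0)) (fun x => \row__ A x).
rewrite (_ : (fun x => rho ((\row__ A x) ord0 ord0)) = fun x => rho (A x)); last by apply/funext => y; rewrite mxE.
apply=> [x [_ Ax]||j]; [|exact: flat_dC hr|].
  by rewrite !mxE; split=> //; apply: le_lt_trans (A1 x) _; rewrite ltr1n.
by have := hA; congr (dC _ _ _); apply/funext => y; rewrite mxE.
Qed.

Lemma locally_bounded_of_contV (u : 'rV[R]_n -> R) a : contV u a ->
  exists r : R, 0 < r /\ forall x, cube a r x -> `|u x| <= `|u a| + 1.
Proof.
move=> /(_ 1 ltr01)[r [r0 hr]]; exists r; split=> // x /hr h.
by have := ler_normD (u x - u a) (u a); rewrite subrK; lra.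
Qed.

(* The gauge controls [u / D^2], where [D x] is the distance from [x] to the complement
   of [posset], so that [zext] is [O(|x - x0|^2)] at the boundary points. *)
Lemma zext_gauge (u : 'rV[R]_n -> R) : Deff u -> (forall x, posset x -> contV u x) ->
  exists b, gauge b /\ forall p rho, flat p b rho -> forall x0, V x0 -> ~ posset x0 ->
    exists r : R, 0 < r /\ forall x, cube x0 r x -> `|zext rho u x| <= A x /\ `|zext rho u x| <= `|x - x0| ^+ 2.
Proof.
move=> du cu; have dO := Def_posset.
pose E x r := 0 < r /\ r <= 1 /\ forall y : 'rV[R]_n, cube x r y -> posset y.
have dE : Def (fun p : 'rV[R]_n * R => E p.1 p.2) by rewrite /E; dfn.
pose D x := dsup (E x).
have dD : Deff D by apply: (Deff_dsup (A := E)).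
have neE x : posset x -> exists r, E x r.
  move=> /posset_open[r [r0 hr]]; have [k [k0 ka kb]] := pos_min2 r0 (@ltr01 R).
  by exists k; split=> //; split=> // y hy; apply: hr; exact: cube_le hy.
have lubD x : posset x -> islub (E x) (D x).
  by move=> Ox; apply: dsupP; [dfn|exact: neE|exists 1 => r [_ []]].
have D0 x : posset x -> 0 < D x.
  by move=> Ox; have [r Er] := neE x Ox; have [l1 _] := lubD x Ox; apply: lt_le_trans (l1 r Er); case: Er.
have D1 x : posset x -> D x <= 1 by move=> Ox; have [_ l2] := lubD x Ox; apply: l2 => r [_ []].
pose w x := `|u x| * ((D x)^-1 * (D x)^-1).
have [||b [gb hb]] := @gauge_of_locally_bounded w; first by rewrite /w; dfn.
  move=> a Oa; have [r1 [r10 h1]] := locally_bounded_of_contV (cu a Oa).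
  have [r2 [r20 [r21 h2]]] := neE a Oa.
  have [k [k0 ka kb]] := @pos_min2 R r1 (r2 / 2) r10 ltac:(lra).
  exists k, ((`|u a| + 1) * ((r2 / 2)^-1 * (r2 / 2)^-1)); split=> // x hx Ox.
  have Dx : r2 / 2 <= D x.
    have [l1 _] := lubD x Ox; apply: l1; split; [lra|split; [lra|move=> y hy]].
    by apply: h2; apply: cube_half (_ : cube a (r2 / 2) x) hy; exact: cube_le hx.
  have iD : (D x)^-1 <= (r2 / 2)^-1 by rewrite lef_pV2 ?posrE ?D0//; lra.
  have iD0 : 0 <= (D x)^-1 by rewrite invr_ge0 ltW// D0.
  apply: ler_pM => //; first exact: mulr_ge0.
    by apply: h1; exact: cube_le hx.
  exact: ler_pM.
exists b; split=> // p rho hr x0 Vx0 nx0; have [r [r0 hdeep]] := deep_near Vx0 nx0.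
exists r; split=> // x hx; rewrite /zext; case: asboolP => Ox; last first.
  by rewrite normr0; split=> //; rewrite exprn_ge0.
have [dx Ax1] := hdeep x hx Ox; have [_ Ax0] := Ox; have [_ bp _] := gb.
have bA := bp _ Ax0; have hw := hb x Ox dx; have Dx := D0 x Ox.
have ub : `|u x| * b (A x) <= D x ^+ 2.
  move: hw; rewrite /w mulrAC -invfM -expr2 ler_pdivrMr ?mul1r//.
  by rewrite exprn_gt0.
have z1 : `|rho (A x) * u x| <= A x * D x ^+ 2.
  rewrite normrM; apply: le_trans (_ : A x * b (A x) * `|u x| <= _).
    by rewrite ler_wpM2r//; apply: flat_bound hr _ _ _ => //; exact: ltW.
  by rewrite -mulrA ler_pM2l// mulrC.
have DD : D x ^+ 2 <= 1 by apply: exprn_ile1; [exact: ltW|exact: D1].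
split; apply: le_trans z1 _; first by apply: ler_piMr => //; exact: ltW.
apply: le_trans (ler_piMl _ (ltW Ax1)) _; first by rewrite exprn_ge0// ltW.
rewrite ler_pXn2r ?nnegrE ?(ltW Dx)//.
(* [D x <= |x - x0|]: a larger cube about [x] inside [posset] would contain [x0]. *)
have [_ l2] := lubD x Ox; apply: l2 => q [q0 [_ hq]]; rewrite leNgt; apply/negP => lt.
apply: nx0; apply: hq => i; apply: le_lt_trans lt; rewrite distrC.
by have := norm_row_le (x - x0) i; rewrite !mxE.
Qed.

(** In the direction [i] the derivative of [zext rho u] is [zext rho' (gA i * u) + zext rho (gu i)],
    to which the induction hypothesis applies. Only differentiability at a point of [V] outside
    [posset] is new, and there the quadratic bound gives derivative zero. The gauge is the minimum
    of those for the finitely many summands and of the one for the quadratic bound. *)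
Lemma flat_zext p u : dC p posset A -> dC p posset u ->
  exists b, gauge b /\ forall rho, flat p b rho -> dC p V (zext rho u).
Proof.
elim: p u => [|p ih] u hA hu.
  have [|b [gb hb]] := zext_gauge (dC_Deff hu); first by move=> x; exact: dC_contV hu.
  exists b; split=> // rho hr; split; first by apply: Deff_zext; [exact: flat_Deff hr|exact: dC_Deff hu].
  move=> x Vx; have [Ox|nx] := pselect (posset x); first exact: dC_contV (zext_in hA hu hr) Ox.
  move=> e e0; have [r [r0 h]] := hb _ _ hr x Vx nx; have [d [d0 hd]] := cA Vx e0.
  have [k [k0 ka kb]] := pos_min2 r0 d0; exists k; split=> // y hy.
  have zx : zext rho u x = 0 by rewrite /zext asboolF.
  have Ax : A x = 0 by apply/eqP; rewrite eq_le A0 andbT leNgt; apply/negP => h'; exact: nx.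
  rewrite zx subr0; have [h1 _] := h y (cube_le ka hy); apply: le_lt_trans h1 _.
  by have := hd y (cube_le kb hy); rewrite Ax subr0 ger0_norm.
have /dCS[_ [gA [gA1 gA2]]] := hA; have /dCS[_ [gu [gu1 gu2]]] := hu.
have hA' := dC_S hA; have hu' := dC_S hu.
have ex1 i : exists b, gauge b /\ forall rho, flat p b rho -> dC p V (zext rho (fun x => gA i x * u x)).
  by apply: ih => //; exact: dC_mul.
have ex2 i : exists b, gauge b /\ forall rho, flat p b rho -> dC p V (zext rho (gu i)) by exact: ih.
have [b1 hb1] := choice ex1; have [b2 hb2] := choice ex2.
have [|c1 [gc1 hc1]] := @gauge_min _ S HS _ b1; first by move=> i; case: (hb1 i).
have [|c2 [gc2 hc2]] := @gauge_min _ S HS _ b2; first by move=> i; case: (hb2 i).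
have [|b3 [gb3 hb3]] := zext_gauge (dC_Deff hu); first by move=> x; exact: dC_contV hu.
have [c3 [gc3 hc3]] := gauge_min2 gc1 gc2; have [b [gb hb]] := gauge_min2 gc3 gb3.
exists b; split=> // rho hr.
have /flatS[dr [_ [rho' [hr1 hr2]]]] := hr; have hr' := flat_pred hr.
apply/dCS; split; first by apply: Deff_zext => //; exact: dC_Deff hu.
exists (fun i x => zext rho' (fun x => gA i x * u x) x + zext rho (gu i) x); split; last first.
  move=> i; apply: dC_add.
    have [_ h] := hb1 i; apply: h; apply: flat_le hr2 => t _ _.
    by apply: le_trans (hb t).1 _; apply: le_trans (hc3 t).1 _; exact: hc1.
  have [_ h] := hb2 i; apply: h; apply: flat_le hr' => t _ _.
  by apply: le_trans (hb t).1 _; apply: le_trans (hc3 t).2 _; exact: hc2.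
move=> x Vx; have [Ox|nx] := pselect (posset x).
  have [r [r0 hr0]] := posset_open Ox; have [_ Ax] := Ox.
  apply: (hasD_ext (f := fun x => rho (A x) * u x) r0); first by move=> y /hr0 Oy; rewrite /zext asboolT.
  have hc : hasD (fun y => rho (A y)) x (fun i => gA i x * rho' (A x)).
    apply: hasD_comp1 (gA1 x Ox); apply: hr1 => //.
    by apply: le_lt_trans (A1 x) _; rewrite ltr1n.
  have := hasD_mul hc (gu1 x Ox); congr hasD; apply/funext => i.
  by rewrite /zext asboolT//; ring.
have z0 v w : zext v w x = 0 by rewrite /zext asboolF.
rewrite (_ : (fun i => _) = fun=> 0); last by apply/funext => i; rewrite !z0 addr0.
have hr3 : flat p.+1 b3 rho by apply: flat_le hr => t _ _; exact: (hb t).2.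
have [r [r0 h]] := hb3 _ _ hr3 x Vx nx.
apply: hasD_intro => e e0; have [k [k0 kr ke]] := pos_min2 r0 e0; exists k; split=> // v hv.
rewrite z0 subr0 big1 => [|i _]; last by rewrite mulr0.
rewrite subr0; have [|_ h2] := h (x + v).
  by move=> i; rewrite mxE [x ord0 i + _]addrC addrK; exact: lt_le_trans (hv i) kr.
apply: le_trans h2 _; rewrite [x + v]addrC addrK expr2 ler_wpM2r//.
by apply: norm_row_ub (ltW e0) _ => i; apply: ltW; exact: lt_le_trans (hv i) ke.
Qed.
End FlatExtension.

(** * Smooth functions with prescribed positivity set *)

Section PositiveSets.
Context {R : rcfType} (S : forall n : nat, set (set 'rV[R]_n)).
Arguments S : clear implicits.
Context {HS : ominimal_structure S}.
Local Notation Def := (Def S).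
Local Notation Deff := (Deff S).
Local Notation dC := (dC S).
Context (p : nat).

Definition everywhere n (x : 'rV[R]_n) : Prop := True.

Lemma dC_proj m n (U : 'rV[R]_m -> Prop) F (s : 'I_m -> 'I_n) : dC p U F ->
  dC p (fun x : 'rV[R]_n => U (\row_j x ord0 (s j))) (fun x => F (\row_j x ord0 (s j))).
Proof.
move=> hF; apply: (dC_comp (V := U)) => // j.
have -> : (fun x : 'rV[R]_n => (\row_j x ord0 (s j)) ord0 j) = fun x => x ord0 (s j) by apply/funext => x; rewrite mxE.
exact: dC_coord.
Qed.

Lemma everywhere_open n : isopen (@everywhere n).
Proof. by move=> x _; exists 1. Qed.

Lemma pos_open n (a : 'rV[R]_n -> R) : dC p (@everywhere n) a -> isopen (fun x => 0 < a x).
Proof.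
move=> ha x ax; have [d [d0 hd]] := dC_contV ha (I : everywhere x) ax.
by exists d; split=> // y /hd; rewrite ltr_norml => /andP[h _]; lra.
Qed.

(** [q1] and [q2] are controlled only where [a > 0], so the product of [a] with the bounded
    functions [q / (1 + q)] is extended by zero and then flattened. Continuity of the extension
    holds because it is dominated by each of [a], [q1], [q2] on its support, and at any other point
    one of these is continuous and not positive. *)
Lemma pos_smooth n (a q1 q2 : 'rV[R]_n -> R) : dC p (@everywhere n) a ->
  (forall x, 0 <= a x /\ a x <= 1) ->
  dC p (fun x => 0 < a x) q1 -> dC p (fun x => 0 < a x) q2 ->
  exists f : 'rV[R]_n -> R, [/\ dC p (@everywhere n) f, forall x, 0 <= f x /\ f x <= 1 &
    forall x, 0 < f x <-> [/\ 0 < a x, 0 < q1 x & 0 < q2 x]].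
Proof.
move=> ha a01 h1 h2.
have da := dC_Deff ha; have d1 := dC_Deff h1; have d2 := dC_Deff h2.
pose O x := 0 < a x /\ 0 < q1 x /\ 0 < q2 x.
have dO : Def O by rewrite /O; dfn.
pose A x := if `[< O x >] then a x * ((q1 x * (1 + q1 x)^-1) * (q2 x * (1 + q2 x)^-1)) else 0.
have dA : Deff A by rewrite /A; dfn.
have th (q : R) : 0 < q -> 0 < q * (1 + q)^-1 /\ q * (1 + q)^-1 <= 1 /\ q * (1 + q)^-1 <= q.
  move=> q0; have i0 : 0 < (1 + q)^-1 by rewrite invr_gt0; lra.
  have i1 : (1 + q)^-1 <= 1 by rewrite invf_le1; lra.
  split; [exact: mulr_gt0|split; last by rewrite ger_pMr].
  by rewrite ler_pdivrMr; lra.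
have Apos x : O x -> 0 < A x.
  move=> Ox; rewrite /A asboolT//; case: Ox => a0 [q10 q20].
  by have [u1 _] := th _ q10; have [v1 _] := th _ q20; apply: mulr_gt0 => //; exact: mulr_gt0.
have A0 x : 0 <= A x.
  by have [Ox|nx] := pselect (O x); [exact/ltW/Apos|rewrite /A asboolF].
have Ale x : O x -> A x <= a x /\ (A x <= q1 x /\ A x <= q2 x).
  move=> Ox; rewrite /A asboolT//; case: Ox => a0 [q10 q20].
  have [u1 [u2 u3]] := th _ q10; have [v1 [v2 v3]] := th _ q20; have [_ a1] := a01 x.
  move: u1 u2 u3 v1 v2 v3; move: (q1 x * _) (q2 x * _) => u v u1 u2 u3 v1 v2 v3.
  have uv : u * v <= u by rewrite ger_pMr.
  have uv' : u * v <= v by rewrite ger_pMl.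
  have uv0 : 0 <= u * v by rewrite mulr_ge0 ?ltW.
  have auv : a x * (u * v) <= u * v by apply: ler_piMl.
  split; first by rewrite ger_pMr//; apply: le_trans uv u2.
  by split; apply: le_trans auv _; [apply: le_trans uv u3|apply: le_trans uv' v3].
have A1 x : A x <= 1.
  have [Ox|nx] := pselect (O x); last by rewrite /A asboolF.
  by apply: le_trans (Ale x Ox).1 _; case: (a01 x).
have oO : isopen O.
  move=> x [ax [x1 x2]]; have [r0 [r00 hr0]] := pos_open ha ax.
  have [r1 [r10 hr1]] := dC_contV h1 ax x1; have [r2 [r20 hr2]] := dC_contV h2 ax x2.
  have [k [k0 ka kb]] := pos_min2 r00 r10; have [l [l0 la lb]] := pos_min2 k0 r20.
  exists l; split=> // y hy; split; first by apply: hr0; apply: cube_le hy; exact: le_trans la ka.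
  have := hr1 y (cube_le (le_trans la kb) hy); have := hr2 y (cube_le lb hy).
  by rewrite !ltr_norml => /andP[u1 _] /andP[u2 _]; split; lra.
have hAO : dC p O A.
  apply: (dC_ext (f := fun x => a x * ((q1 x * (1 + q1 x)^-1) * (q2 x * (1 + q2 x)^-1)))) => //.
    by move=> x Ox; rewrite /A asboolT.
  have sub x : O x -> 0 < a x by case.
  have k1 := dC_sub sub h1; have k2 := dC_sub sub h2.
  apply: dC_mul; first exact: dC_sub ha.
  apply: dC_mul; apply: dC_mul => //; apply: dC_inv.
  - by move=> x [_ [u _]]; apply: lt0r_neq0; lra.
  - by apply: dC_add => //; exact: dC_cst.
  - by move=> x [_ [_ u]]; apply: lt0r_neq0; lra.
  - by apply: dC_add => //; exact: dC_cst.
have cA x : everywhere x -> contV A x.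
  move=> _; have [Ox|nx] := pselect (O x); first exact: dC_contV hAO Ox.
  have Ax : A x = 0 by rewrite /A asboolF.
  have small (g : 'rV[R]_n -> R) : contV g x -> g x <= 0 -> (forall y, O y -> A y <= g y) -> contV A x.
    move=> cg gx hg e e0; have [d [d0 hd]] := cg e e0; exists d; split=> // y /hd.
    rewrite Ax subr0 (ger0_norm (A0 y)) ltr_norml => /andP[_ h].
    have [Oy|ny] := pselect (O y); first by have := hg y Oy; lra.
    by rewrite /A asboolF.
  have [ax|ax] := leP (a x) 0; first by apply: (small a) => //; [exact: dC_contV ha I|move=> y /Ale[]].
  have [x1|x1] := leP (q1 x) 0; first by apply: (small q1) => //; [exact: dC_contV h1 ax|move=> y /Ale[_ []]].
  have [x2|x2] := leP (q2 x) 0; first by apply: (small q2) => //; [exact: dC_contV h2 ax|move=> y /Ale[_ []]].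
  by case: nx.
have posE x : posset (@everywhere n) A x <-> O x.
  split=> [[_]|Ox]; last by split=> //; exact: Apos.
  by apply: contraPP => nx; rewrite /A asboolF// ltxx.
have hA : dC p (posset (@everywhere n) A) A by apply: dC_sub hAO => x /posE.
have dev : Def (@everywhere n) by exact: Def_cst.
have [b [gb hb]] := flat_zext dev (@everywhere_open n) dA A0 A1 cA hA (dC_cst _ _ 1).
have [|b1 [gb1 hb1]] := gauge_min2 gb (_ : gauge S (fun=> 1)); first by split=> //; dfn.
have [rho [hr rpos]] := flat_exists p gb1.
exists (zext (@everywhere n) A rho (fun=> 1)); split.
- by apply: hb; apply: flat_le hr => t _ _; case: (hb1 t).
- move=> x; rewrite /zext; case: asboolP => [[_ Ax]|_]; last by split.
  rewrite mulr1; split; first exact/ltW/rpos.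
  apply: le_trans (ler_norm _) _; apply: le_trans (flat_bound hr Ax (A1 x)) _.
  have b0 : 0 < b1 (A x) by case: gb1 => _ g _; exact: g.
  by apply: mulr_ile1; [exact: ltW|exact: ltW|exact: A1|case: (hb1 (A x))].
- move=> x; rewrite /zext; case: asboolP => [Ox|nx].
    rewrite mulr1; split=> _; last by apply: rpos => //; case: Ox.
    by have /posE[? [? ?]] := Ox.
  by rewrite ltxx; split=> // -[u v w]; case: nx; apply/posE.
Qed.
End PositiveSets.

(** * Decomposition of definable sets into smooth charts *)

Section Charts.
Context {R : rcfType} (S : forall n : nat, set (set 'rV[R]_n)).
Arguments S : clear implicits.
Context {HS : ominimal_structure S}.
Local Notation Def := (Def S).
Local Notation Deff := (Deff S).
Local Notation dC := (dC S).
Context (p : nat).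

(* A chart parametrises a set by the open set [0 < ca]; the coordinates selected by [cs]
   recover the parameter, so that a chart is a graph over an open subset of a coordinate
   subspace. *)
Record chart (n : nat) := Chart {
  cd : nat;
  ca : 'rV[R]_cd -> R;
  ce : 'rV[R]_cd -> 'rV[R]_n;
  cs : 'I_cd -> 'I_n }.
Arguments ca {n} c w.
Arguments ce {n} c w.
Arguments cs {n} c j.

Definition chart_dom n (c : chart n) (w : 'rV[R]_(cd c)) : Prop := 0 < ca c w.
Arguments chart_dom {n} c w.
Definition chart_im n (c : chart n) (x : 'rV[R]_n) : Prop := exists w, chart_dom c w /\ x = ce c w.
Definition chart_ok n (c : chart n) : Prop :=
  [/\ dC p (@everywhere R (cd c)) (ca c), forall w, 0 <= ca c w /\ ca c w <= 1,
      forall i, dC p (chart_dom c) (fun w => ce c w ord0 i), injective (cs c) &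
      forall w j, chart_dom c w -> ce c w ord0 (cs c j) = w ord0 j].

(** Finite unions of chart images, with no disjointness: only finite sums of functions attached to
    the charts are formed later. [P] records an extra property of the charts used. *)
Inductive chartable n (P : chart n -> Prop) : ('rV[R]_n -> Prop) -> Prop :=
| chartable0 : chartable P (fun=> False)
| chartable1 c : chart_ok c -> P c -> chartable P (chart_im c)
| chartableU Z1 Z2 : chartable P Z1 -> chartable P Z2 -> chartable P (fun x => Z1 x \/ Z2 x).

Lemma chartable_ext n P (Z Z' : 'rV[R]_n -> Prop) : (forall x, Z x <-> Z' x) -> chartable P Z -> chartable P Z'.
Proof. by move=> h; rewrite (_ : Z' = Z)//; apply/funext => x; apply/propext; split=> /h. Qed.

Lemma chartable_bind m n P Q Z (r : 'rV[R]_m -> 'rV[R]_n -> Prop) : chartable P Z ->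
  (forall c, chart_ok c -> P c -> (forall x, chart_im c x -> Z x) ->
    chartable Q (fun y => exists x, chart_im c x /\ r x y)) ->
  chartable Q (fun y => exists x, Z x /\ r x y).
Proof.
elim=> {Z} [|c okc Pc|Z1 Z2 _ ih1 _ ih2] h.
- by apply: chartable_ext (chartable0 Q) => y; split=> // -[x []].
- exact: h.
- apply: (@chartable_ext _ _ (fun y => (exists x, Z1 x /\ r x y) \/ (exists x, Z2 x /\ r x y))).
    by move=> y; split=> [[[x [? ?]]|[x [? ?]]]|[x [[?|?] ?]]]; [exists x; split=> //; left|exists x; split=> //; right|left; exists x|right; exists x].
  by apply: chartableU; [apply: ih1|apply: ih2] => c okc Pc sub; apply: h => // x /sub; [left|right].
Qed.

Lemma chartable_fin (T : finType) n P (Z : T -> 'rV[R]_n -> Prop) :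
  (forall i, chartable P (Z i)) -> chartable P (fun x => exists i, Z i x).
Proof.
move=> h; apply: (@chartable_ext _ _ (fun x => exists i, i \in enum T /\ Z i x)).
  by move=> x; split=> [[i [_ ?]]|[i ?]]; exists i => //; rewrite mem_enum.
elim: (enum T) => [|i l ih].
  by apply: chartable_ext (chartable0 P) => x; split=> // -[i []].
apply: chartable_ext (chartableU (h i) ih) => x; split=> [[?|[j [jl ?]]]|[j [+ ?]]].
- by exists i; rewrite mem_head.
- by exists j; rewrite inE jl orbT.
- by rewrite inE => /orP[/eqP <-|jl]; [left|right; exists j].
Qed.

Lemma chart_dom_open n (c : chart n) : chart_ok c -> isopen (chart_dom c).
Proof. by case=> ha _ _ _ _; exact: pos_open ha. Qed.

Lemma Def_chart_dom n (c : chart n) : chart_ok c -> Def (chart_dom c).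
Proof. by case=> /dC_Deff ha _ _ _ _; rewrite /chart_dom; dfn. Qed.

Lemma Deff_ce n (c : chart n) : chart_ok c -> Deff (ce c).
Proof. by case=> _ _ he _ _; apply: Deff_rows => i; exact: dC_Deff (he i). Qed.

Definition chart_comp n (c : chart n) (c' : chart (cd c)) : chart n :=
  Chart (ca c') (fun w => ce c (ce c' w)) (fun j => cs c (cs c' j)).

Lemma chart_comp_ok n (c : chart n) (c' : chart (cd c)) : chart_ok c -> chart_ok c' ->
  (forall w, chart_im c' w -> chart_dom c w) -> chart_ok (chart_comp c').
Proof.
move=> [ha a1 he ic hs] [ha' a1' he' ic' hs'] sub; split=> //=.
- by move=> i; apply: (dC_comp (V := chart_dom c) (F := fun v => ce c v ord0 i)) => // w hw; apply: sub; exists w.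
- by move=> j k /ic/ic'.
- by move=> w j hw; rewrite hs ?hs'//; apply: sub; exists w.
Qed.

Lemma chart_comp_im n (c : chart n) (c' : chart (cd c)) y :
  chart_im (chart_comp c') y <-> exists w, chart_im c' w /\ y = ce c w.
Proof.
split=> [[w [hw ->]]|[_ [[w [hw ->]] ->]]]; last by exists w.
by exists (ce c' w); split=> //; exists w.
Qed.

(** With at least [n] parameters the coordinate selection is a bijection, so the chart merely
    permutes coordinates and its image is open. *)
Lemma chart_full n (c : chart n) w : chart_ok c -> chart_dom c w -> (n <= cd c)%N ->
  exists r : R, 0 < r /\ forall x, cube (ce c w) r x -> chart_im c x.
Proof.
move=> okc hw nd; have [_ _ _ ic hs] := okc; have [r [r0 hr]] := chart_dom_open okc hw.
have [|f fK gK] := inj_card_bij ic; first by rewrite !card_ord.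
exists r; split=> // x hx; exists (\row_j x ord0 (cs c j)).
have dw : chart_dom c (\row_j x ord0 (cs c j)) by apply: hr => j; rewrite mxE -hs.
by split=> //; apply/rowP => i; rewrite -(gK i) hs// mxE.
Qed.

Lemma smooth_gen_fin n k (f : 'I_k -> 'rV[R]_n -> R) (W : 'rV[R]_n -> Prop) :
  (forall i, Deff (f i)) -> Def W -> isopen W ->
  exists G : 'rV[R]_n -> Prop, [/\ Def G, isopen G, forall x, G x -> W x, denseIn W G & forall i, dC p G (f i)].
Proof.
move=> df dW oW; elim: k f df => [|k ih] f df.
  by exists W; split=> // [x r r0 h|[]//]; exists x, r.
have [G [dG oG GW den hG]] := ih (fun i => f (lift ord0 i)) (fun i => df _).
have [H [dH oH HG den' hH]] := smooth_gen p (df ord0) dG oG.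
exists H; split=> // [x /HG/GW//||i]; first exact: denseIn_trans den den'.
by have [j ->|->] := unliftP ord0 i => //; exact: dC_sub (hG j).
Qed.

Definition decomposable n : Prop := forall Z : 'rV[R]_n -> Prop, Def Z -> chartable (fun=> True) Z.

Definition smooth_on n N (e : 'I_N -> 'rV[R]_n -> R) (c : chart n) : Prop :=
  forall i, dC p (chart_dom c) (fun w => e i (ce c w)).

(** Induction on the dimension of the chart. The functions are smooth on a dense open part [G] of
    the parameter domain, which is decomposed again. A chart inside the complement of [G] has
    smaller dimension, since one of full dimension would cover a cube that [G] misses. *)
Lemma chart_refine n N (e : 'I_N -> 'rV[R]_n -> R) (c : chart n) :
  (forall m, (m <= n)%N -> decomposable m) -> (forall i, Deff (e i)) -> chart_ok c ->
  chartable (smooth_on e) (chart_im c).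
Proof.
move=> dec de; have [d] := ubnP (cd c); elim: d c => // d ih c; rewrite ltnS => cd_le okc.
have dn : (cd c <= n)%N by case: okc => _ _ _ /leq_card; rewrite !card_ord.
have dce : Deff (ce c) by exact: Deff_ce.
have dec' i : Deff (fun w => e i (ce c w)) by have := de i; dfn.
have [G [dG oG GW den hG]] := smooth_gen_fin dec' (Def_chart_dom okc) (chart_dom_open okc).
have imE : forall x, (exists w, G w /\ x = ce c w) \/ (exists w, (chart_dom c w /\ ~ G w) /\ x = ce c w) <-> chart_im c x.
  move=> x; split=> [[[w [Gw ->]]|[w [[hw _] ->]]]|[w [hw ->]]]; [by exists w; split=> //; exact: GW|by exists w|].
  by have [Gw|nG] := pselect (G w); [left; exists w|right; exists w].
apply: chartable_ext imE _; apply: chartableU.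
  apply: (chartable_bind (dec _ dn G dG)) => c' okc' _ sub.
  apply: chartable_ext (@chart_comp_im _ c c') _; apply: chartable1.
    by apply: chart_comp_ok => // w /sub/GW.
  by move=> i; apply: (dC_comp (V := G)) (hG i) _ => [w hw|]; [apply: sub; exists w|case: okc'].
have dWG : Def (fun w => chart_dom c w /\ ~ G w) by have := Def_chart_dom okc; dfn.
apply: (chartable_bind (dec _ dn _ dWG)) => c' okc' _ sub.
apply: chartable_ext (@chart_comp_im _ c c') _.
have okk : chart_ok (chart_comp c') by apply: chart_comp_ok => // w /sub[].
have [lt|ge] := ltnP (cd c') (cd c); first by apply: ih => //=; exact: leq_trans lt cd_le.
apply: (@chartable_ext _ _ (fun=> False)); last exact: chartable0.
move=> x; split=> // -[w [hw _]]; have [r [r0 hr]] := chart_full okc' hw ge.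
have [|x' [r' [r'0 h1 h2]]] := den (ce c' w) r r0; first by move=> y /hr/sub[].
by have := h2 _ (cube_refl x' r'0); have /h1/hr/sub[] := cube_refl x' r'0.
Qed.

(** A uniform bound on the fibres lets definable choice list their points one by one. *)
Lemma finite_selection n N (B : 'rV[R]_n -> R -> Prop) :
  Def (fun q : 'rV[R]_n * R => B q.1 q.2) -> (forall y, fibre_le N (B y)) ->
  exists e : 'I_N -> 'rV[R]_n -> R, (forall i, Deff (e i)) /\ forall y t, B y t -> exists i, t = e i y.
Proof.
elim: N B => [|N ih] B dB hB.
  exists (fun i _ => 0); split=> [[]//|y t Bt].
  by have [l [sl /(_ _ Bt)]] := hB y; case: l sl.
pose e0 y := dchoice (B y).
have d0 : Deff e0 by exact: Deff_dchoice.
have [||e [de he]] := ih (fun y t => B y t /\ t <> e0 y); first by dfn.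
  move=> y; have [l [sl hl]] := hB y; have [ex|nex] := pselect (exists t, B y t); last first.
    by exists [::]; split=> // t [Bt _]; case: nex; exists t.
  have By : Def (B y) by dfn.
  have el : e0 y \in l by apply: hl; exact: dchoiceP By ex.
  exists (rem (e0 y) l); split; first by rewrite size_rem//; case: (size l) sl.
  by move=> t [/hl tl /eqP te]; have := tl; rewrite (perm_mem (perm_to_rem el)) inE (negbTE te).
exists (fun i => oapp e e0 (unlift ord0 i)); split=> [i|y t Bt].
  by case: (unlift ord0 i).
have [->|ne] := pselect (t = e0 y); first by exists ord0; rewrite unlift_none.
by have [i ->] := he y t (conj Bt ne); exists (lift ord0 i); rewrite liftK.
Qed.

Definition above (o : option R) (t : R) : Prop := if o is Some s then s < t else True.
Definition below (o : option R) (t : R) : Prop := if o is Some s then t < s else True.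

(** [B y] is the boundary of the fibre of [Z] over [y]. It is finite, hence uniformly finite, and is
    listed by definable functions [e i]. A point off this list lies between its nearest boundary
    points, [None] standing for an infinite end, and the whole band between them lies in [Z] by
    definable connectedness. *)
Lemma fibre_selection n (Z : 'rV[R]_n.+1 -> Prop) : Def Z ->
  exists N (e : 'I_N -> 'rV[R]_n -> R), (forall i, Deff (e i)) /\
    forall t y, Z (vcons t y) -> (exists i, t = e i y) \/
      exists lo up : option 'I_N, [/\ above (omap (e^~ y) lo) t, below (omap (e^~ y) up) t &
        forall s, above (omap (e^~ y) lo) s -> below (omap (e^~ y) up) s -> Z (vcons s y)].
Proof.
move=> dZ; have dv : Deff (fun p : R * 'rV[R]_n => vcons p.1 p.2) by exact: Deff_vcons.
pose B (y : 'rV[R]_n) (t : R) := ~ exists d : R, 0 < d /\ forall s : R, `|s - t| < d -> (Z (vcons t y) <-> Z (vcons s y)).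
have dB : Def (fun q : 'rV[R]_n * R => B q.1 q.2) by rewrite /B; dfn.
have fB : finite_fibres B.
  move=> y; have dy : Def (B y) by dfn.
  have [[a [b [ab h]]]|//] := Def_itv_or_finite dy; exfalso.
  have dE : Def (fun t => Z (vcons t y)) by dfn.
  have [c [d [ac cd db cst]]] : exists c d : R, [/\ a < c, c < d, d < b & forall s t, c < s -> s < d -> c < t -> t < d ->
     (Z (vcons s y) <-> Z (vcons t y))].
    have [[k [k0 hk]]|[k [k0 hk]]] := rgerm_dich ((a + b) / 2) dE; have q0 : 0 < (b - a) / 2 by [lra|lra];
      have [l [l0 lk lq]] := pos_min2 k0 q0; exists ((a + b) / 2), ((a + b) / 2 + l / 2); split; try lra.
      by move=> s t s1 s2 t1 t2; split=> _; apply: hk; lra.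
    by move=> s t s1 s2 t1 t2; split=> h'; exfalso; [apply: (hk s); first lra|apply: (hk t); first lra]; try lra.
  apply: (h ((c + d) / 2)); [lra|lra|]; exists ((d - c) / 2); split=> [|s]; first lra.
  by rewrite ltr_norml => /andP[s1 s2]; apply: cst; lra.
have [N hN] := uniform_finiteness dB fB.
have [e [de he]] := finite_selection dB hN.
exists N, e; split=> // t y Zt.
have [|ne] := pselect (exists i, t = e i y); [by left|right].
have memE (i : 'I_N) : e i y \in [seq e i y | i <- enum 'I_N] by apply: map_f; rewrite mem_enum.
have [lo [hlo lom]] : exists lo : option 'I_N, above (omap (e^~ y) lo) t /\ forall i, e i y < t -> exists j, lo = Some j /\ e i y <= e j y.
  have [[i hi]|no] := pselect (exists i, e i y < t); last by exists None; split=> // i hi; case: no; exists i.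
  have [||m [[j [-> jt]] hm]] := @fin_max R (fun z => exists i, z = e i y /\ z < t) [seq e i y | i <- enum 'I_N].
  - by move=> z [j [-> _]].
  - by exists (e i y), i.
  by exists (Some j); split=> // k hk; exists j; split=> //; apply: hm; exists k.
have [up [hup upm]] : exists up : option 'I_N, below (omap (e^~ y) up) t /\ forall i, t < e i y -> exists j, up = Some j /\ e j y <= e i y.
  have [[i hi]|no] := pselect (exists i, t < e i y); last by exists None; split=> // i hi; case: no; exists i.
  have [||m [[j [me jt]] hm]] := @fin_max R (fun z => exists i, z = - e i y /\ t < e i y) [seq - e i y | i <- enum 'I_N].
  - by move=> z [j [-> _]]; apply/mapP; exists j => //; rewrite mem_enum.
  - by exists (- e i y), i.
  exists (Some j); split=> // k hk; exists j; split=> //; rewrite -lerN2 -me; apply: hm; by exists k.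
exists lo, up; split=> // s slo sup.
have dE : Def (fun t => Z (vcons t y)) by dfn.
have noB x : above (omap (e^~ y) lo) x -> below (omap (e^~ y) up) x -> ~ B y x.
  move=> xl xu /he[i xe]; have [lt|gt|eq] := ltgtP (e i y) t; last by apply: ne; exists i.
    by have [j [le h]] := lom i lt; move: xl; rewrite le /= xe ltNge h.
  by have [j [le h]] := upm i gt; move: xu; rewrite le /= xe ltNge h.
have [a [b [at_ tb as_ sb hab]]] : exists a b : R, [/\ a < t, t < b, a < s, s < b & forall x, a < x -> x < b ->
   above (omap (e^~ y) lo) x /\ below (omap (e^~ y) up) x].
  have [a [a1 a2 a3]] : exists a : R, [/\ a < t, a < s & forall x, a < x -> above (omap (e^~ y) lo) x].
    case: (lo) hlo slo => [i|] /= u v; first by exists (e i y).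
    by exists (Num.min t s - 1); rewrite !ltrBlDr !gt_min !ltrDl ltr01 orbT.
  have [b [b1 b2 b3]] : exists b : R, [/\ t < b, s < b & forall x, x < b -> below (omap (e^~ y) up) x].
    case: (up) hup sup => [i|] /= u v; first by exists (e i y).
    by exists (Num.max t s + 1); rewrite -!ltrBlDr !lt_max !ltrBlDr !ltrDl ltr01 orbT.
  by exists a, b; split=> // x ax xb; split; [exact: a3|exact: b3].
apply: (itv_conn dE _ at_ tb as_ sb Zt) => x ax xb; have [xl xu] := hab x ax xb.
by have := noB x xl xu; rewrite /B => /contrapT.
Qed.

Definition graph_chart n (c : chart n) (f : 'rV[R]_n -> R) : chart n.+1 :=
  Chart (ca c) (fun w => vcons (f (ce c w)) (ce c w)) (fun j => lift ord0 (cs c j)).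

Lemma graph_chart_ok n (c : chart n) f : chart_ok c -> dC p (chart_dom c) (fun w => f (ce c w)) ->
  chart_ok (graph_chart c f).
Proof.
move=> [ha a1 he ic hs] hf; split=> //=.
- move=> i; have [j ->|->] := unliftP ord0 i.
    by under [X in dC _ _ X]eq_fun do rewrite vconsS; exact: he.
  by under [X in dC _ _ X]eq_fun do rewrite vcons0.
- by move=> i j /lift_inj/ic.
- by move=> w j hw; rewrite vconsS hs.
Qed.

(** The new coordinate [t] is added to the parameters; the band is the locus where [ca], [t - f] and
    [g - t] are positive, which [pos_smooth] turns into the positivity set of one smooth
    function. *)
Lemma band_chart n (c : chart n) (f g : option ('rV[R]_n -> R)) : chart_ok c ->
  (if f is Some f then dC p (chart_dom c) (fun w => f (ce c w)) else True) ->
  (if g is Some g then dC p (chart_dom c) (fun w => g (ce c w)) else True) ->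
  exists c', chart_ok c' /\ forall x, chart_im c' x <->
    exists y, chart_im c y /\ exists t, [/\ x = vcons t y, above (omap (@^~ y) f) t & below (omap (@^~ y) g) t].
Proof.
move=> okc hf hg; have [ha a1 he ic hs] := okc.
have tE (U : 'rV[R]_(cd c) -> Prop) F : dC p U F -> dC p (fun z : 'rV[R]_(cd c).+1 => U (vtail z)) (fun z => F (vtail z)).
  by move=> hF; exact: dC_proj hF.
pose D (z : 'rV[R]_(cd c).+1) := 0 < ca c (vtail z).
pose q1 (z : 'rV[R]_(cd c).+1) := if f is Some f then z ord0 ord0 - f (ce c (vtail z)) else 1.
pose q2 (z : 'rV[R]_(cd c).+1) := if g is Some g then g (ce c (vtail z)) - z ord0 ord0 else 1.
have h1 : dC p D q1.
  rewrite /q1; case: (f) hf => [f' hf|_]; last exact: dC_cst.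
  by apply: dC_add; [exact: dC_coord|apply: dC_opp; exact: tE hf].
have h2 : dC p D q2.
  rewrite /q2; case: (g) hg => [g' hg|_]; last exact: dC_cst.
  by apply: dC_add; [exact: tE hg|apply: dC_opp; exact: dC_coord].
have [A [hA A01 Apos]] := pos_smooth (tE _ _ ha) (fun z => a1 (vtail z)) h1 h2.
exists (Chart A (fun z => vcons (z ord0 ord0) (ce c (vtail z))) (fun j => oapp (fun j => lift ord0 (cs c j)) ord0 (unlift ord0 j))).
split; first split=> //=.
- move=> i; have sub (z : 'rV[R]_(cd c).+1) : 0 < A z -> D z by case/Apos.
  have [j ->|->] := unliftP ord0 i.
    by under [X in dC _ _ X]eq_fun do rewrite vconsS; apply: dC_sub (tE _ _ (he j)).
  by under [X in dC _ _ X]eq_fun do rewrite vcons0; exact: dC_coord.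
- move=> i j; have [i' ->|->] := unliftP ord0 i; have [j' ->|->] := unliftP ord0 j; rewrite ?liftK ?unlift_none //=.
  by move/lift_inj/ic ->.
- move=> z j /Apos[hz _ _]; have [i ->|->] := unliftP ord0 j; rewrite ?liftK ?unlift_none /= ?vcons0// vconsS hs//.
  by rewrite mxE.
have q1E t w : 0 < q1 (vcons t w) <-> above (omap (@^~ (ce c w)) f) t.
  by rewrite /q1; case: (f) => [f'|] /=; rewrite ?ltr01// vcons0 vtail_cons subr_gt0.
have q2E t w : 0 < q2 (vcons t w) <-> below (omap (@^~ (ce c w)) g) t.
  by rewrite /q2; case: (g) => [g'|] /=; rewrite ?ltr01// vcons0 vtail_cons subr_gt0.
move=> x; split.
  move=> [z []]; rewrite /chart_dom /= => /Apos[z0 z1 z2] ->; exists (ce c (vtail z)); split; first by exists (vtail z).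
  by exists (z ord0 ord0); split=> //; [apply/q1E|apply/q2E]; rewrite vconsE.
move=> [_ [[w [hw ->]] [t [-> ht1 ht2]]]]; exists (vcons t w); rewrite /chart_dom /= vcons0 vtail_cons; split=> //.
by apply/Apos; rewrite vtail_cons; split=> //; [apply/q1E|apply/q2E].
Qed.

Lemma decomposable0 : decomposable 0.
Proof.
move=> Z dZ; have [Z0|nZ] := pselect (Z 0); last first.
  by apply: chartable_ext (chartable0 _) => x; split=> //; rewrite [x]thinmx0.
pose c := Chart (fun _ : 'rV[R]_0 => 1) id id.
apply: (@chartable_ext _ _ (chart_im c)).
  by move=> x; split=> _; [rewrite [x]thinmx0|exists x; split=> //; rewrite /chart_dom /= ltr01].
apply: chartable1 => //; split=> //=; first exact: dC_cst.
by case.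
Qed.

(** [Z] is a union of graphs of the selected functions and of bands between them, over definable
    bases in [R^n]. The bases are cut into charts on which all selected functions are smooth. *)
Lemma decomposableS n : (forall m, (m <= n)%N -> decomposable m) -> decomposable n.+1.
Proof.
move=> dec Z dZ; have [N [e [de he]]] := fibre_selection dZ.
have dv : Deff (fun p : R * 'rV[R]_n => vcons p.1 p.2) by exact: Deff_vcons.
have ref (T : 'rV[R]_n -> Prop) : Def T -> chartable (smooth_on e) T.
  move=> dT; apply: (@chartable_ext _ _ (fun y => exists x, T x /\ y = x)).
    by move=> y; split=> [[x [Tx ->]]|Ty] //; exists y.
  apply: (chartable_bind (dec n (leqnn n) T dT)) => c okc _ _.
  apply: (@chartable_ext _ _ (chart_im c)); last exact: chart_refine.
  by move=> y; split=> [cy|[x [cx ->]]//]; exists y.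
pose Tg i y := Z (vcons (e i y) y).
pose Tb (l : option 'I_N * option 'I_N) y :=
  forall s : R, above (omap (e^~ y) l.1) s -> below (omap (e^~ y) l.2) s -> Z (vcons s y).
have dTg i : Def (Tg i) by rewrite /Tg; have := de i; dfn.
have dTb l : Def (Tb l).
  by rewrite /Tb; case: l => [[i|] [j|]] /=; [have := de i; have := de j|have := de i|have := de j|]; dfn.
apply: (@chartable_ext _ _ (fun x => (exists i, exists y, Tg i y /\ x = vcons (e i y) y) \/
   (exists l, exists y, Tb l y /\ exists t, [/\ x = vcons t y, above (omap (e^~ y) l.1) t & below (omap (e^~ y) l.2) t]))).
  move=> x; split=> [[[i [y [h ->//]]]|[l [y [h [t [-> h1 h2]]]]]]|]; first exact: h.
  rewrite -(vconsE x); move: (x ord0 ord0) (vtail x) => t y Zx.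
  have [[i te]|[lo [up [h1 h2 h3]]]] := he t y Zx.
    by left; exists i, y; split; [rewrite /Tg -te|rewrite -te].
  by right; exists (lo, up), y; split=> //; exists t.
apply: chartableU; [apply: chartable_fin => i|apply: chartable_fin => l].
  apply: (chartable_bind (ref _ (dTg i))) => c okc smc _.
  apply: (@chartable_ext _ _ (chart_im (graph_chart c (e i)))).
    move=> x; split=> [[w [hw ->]]|[_ [[w [hw ->]] ->]]]; last by exists w.
    by exists (ce c w); split=> //; exists w.
  by apply: chartable1 => //; exact: graph_chart_ok.
apply: (chartable_bind (ref _ (dTb l))) => c okc smc _.
have [||c' [okc' imc']] := @band_chart _ c (omap e l.1) (omap e l.2) okc; try by [case: (l.1)|case: (l.2)].
apply: (@chartable_ext _ _ (chart_im c')); last exact: chartable1.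
move=> x; split=> [/imc'[y [cy [t [-> h1 h2]]]]|[y [cy [t [-> h1 h2]]]]]; [|apply/imc']; exists y; split=> //; exists t; split=> //; move: h1 h2; by case: (l.1); case: (l.2).
Qed.

Theorem chart_decomposition n : decomposable n.
Proof.
elim/ltn_ind: n => -[_|n ih]; first exact: decomposable0.
by apply: decomposableS => m mn; apply: ih.
Qed.
End Charts.

(** * Tubular neighbourhoods of charts *)

Section Carpeting.
Context {R : rcfType} (S : forall n : nat, set (set 'rV[R]_n)).
Arguments S : clear implicits.
Context {HS : ominimal_structure S}.
Local Notation Def := (Def S).
Local Notation Deff := (Deff S).
Local Notation dC := (dC S).
Context (p : nat).

Definition damp n (a : 'rV[R]_n -> R) (x : 'rV[R]_n) : R :=
  a x * (1 + \sum_i x ord0 i * x ord0 i)^-1.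

Lemma damp_aux n (x : 'rV[R]_n) : 0 < (1 + \sum_i x ord0 i * x ord0 i)^-1 /\ (1 + \sum_i x ord0 i * x ord0 i)^-1 <= 1.
Proof.
have s0 : 0 <= \sum_i x ord0 i * x ord0 i by apply: sumr_ge0 => i _; rewrite -expr2 sqr_ge0.
by split; [rewrite invr_gt0|rewrite invf_le1]; lra.
Qed.

Lemma damp_gt0 n (a : 'rV[R]_n -> R) x : 0 < damp a x <-> 0 < a x.
Proof. by have [h _] := damp_aux x; rewrite /damp pmulr_lgt0. Qed.

Lemma damp_01 n (a : 'rV[R]_n -> R) x : 0 <= a x /\ a x <= 1 -> 0 <= damp a x /\ damp a x <= 1.
Proof.
move=> [h0 h1]; have [k0 k1] := damp_aux x; split; first by rewrite mulr_ge0// ltW.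
by apply: mulr_ile1 => //; exact: ltW.
Qed.

Lemma damp_bound n (a : 'rV[R]_n -> R) x i : a x <= 1 -> 0 < a x -> `|x ord0 i| <= (damp a x)^-1.
Proof.
move=> h1 h0; have [k0 k1] := damp_aux x; rewrite /damp invfM invrK.
have s0 : 0 <= \sum_(j | j != i) x ord0 j * x ord0 j by apply: sumr_ge0 => j _; rewrite -expr2 sqr_ge0.
have le : `|x ord0 i| <= 1 + \sum_i x ord0 i * x ord0 i.
  rewrite (bigD1 i)//= -expr2 -real_normK ?num_real//.
  have := sqr_ge0 (`|x ord0 i| - 1); move: s0; rewrite sqrrB1; have := normr_ge0 (x ord0 i).
  move: (`|_|) (\sum_(_ | _) _) => u v u0 v0; rewrite mulr2n; lra.
apply: le_trans le _; apply: ler_peMl; last by rewrite invf_ge1.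
by rewrite -invr_ge0 ltW.
Qed.

Lemma dC_damp n (U : 'rV[R]_n -> Prop) a : dC p U a -> dC p U (damp a).
Proof.
move=> ha; apply: dC_mul => //; apply: dC_inv.
  by move=> x _; have [h _] := damp_aux x; rewrite -invr_eq0 gt_eqF.
by apply: dC_add; [exact: dC_cst|apply: dC_sum => i; apply: dC_mul; exact: dC_coord].
Qed.

(** Let [D w] be the radius of a cube about [ce w] that fits in [V]. A flat composition [B <= D^2],
    positive on the chart domain, is a smooth lower bound; the tube consists of the [x] whose
    squared distance to the chart point with the same selected coordinates is less than [B / 4]. *)
Lemma chart_tube n (c : chart n) (V : 'rV[R]_n -> Prop) : Def V -> isopen V -> chart_ok S p c ->
  (forall x, chart_im c x -> V x) ->
  exists f : 'rV[R]_n -> R, [/\ dC p (@everywhere R n) f, forall x, 0 <= f x /\ f x <= 1,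
    forall x, chart_im c x -> 0 < f x & forall x, 0 < f x -> V x].
Proof.
move=> dV oV okc sub; have [ha a01 he ic hs] := okc.
have dce : Deff (ce (c := c)) by exact: Deff_ce okc.
have dcube : Def (fun p : 'rV[R]_n * R * 'rV[R]_n => cube p.1.1 p.1.2 p.2) by exact: Def_cube.
pose A := damp (ca (c := c)).
have hAe : dC p (@everywhere R (cd c)) A by exact: dC_damp.
have dA := dC_Deff hAe.
have A0 w : 0 <= A w by case: (damp_01 (a01 w)).
have A1 w : A w <= 1 by case: (damp_01 (a01 w)).
have cA w : everywhere w -> contV A w by exact: dC_contV hAe.
have dE0 : Def (@everywhere R (cd c)) by exact: Def_cst.
pose P := posset (@everywhere R (cd c)) A.
have PE w : P w <-> 0 < ca w by split=> [[_ /damp_gt0]|h]//; split=> //; apply/damp_gt0.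
pose E (w : 'rV[R]_(cd c)) (r : R) := 0 < r /\ r <= 1 /\ forall y : 'rV[R]_n, cube (ce w) r y -> V y.
have dE : Def (fun p : 'rV[R]_(cd c) * R => E p.1 p.2) by rewrite /E; dfn.
pose D w := dsup (E w).
have dD : Deff D by apply: (Deff_dsup (A := E)).
have neE w : P w -> exists r, E w r.
  move=> /PE hw; have [|r [r0 hr]] := oV (ce w); first by apply: sub; exists w.
  have [k [k0 ka kb]] := pos_min2 r0 (@ltr01 R).
  by exists k; split=> //; split=> // y hy; apply: hr; exact: cube_le hy.
have lubD w : P w -> islub (E w) (D w).
  by move=> Ow; apply: dsupP; [dfn|exact: neE|exists 1 => r [_ []]].
have D0 w : P w -> 0 < D w.
  by move=> Ow; have [r Er] := neE w Ow; have [l1 _] := lubD w Ow; apply: lt_le_trans (l1 r Er); case: Er.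
have [||b [gb hb]] := gauge_of_locally_bounded dE0 dA cA (w := fun w => (D w)^-1 * (D w)^-1); first by dfn.
  move=> a Pa; have [r2 [r20 [r21 h2]]] := neE a Pa.
  have ca0 : chart_dom a by exact/PE.
  have r22 : 0 < r2 / 2 by lra.
  have [d hd] := choice (fun i => dC_contV (he i) ca0 r22).
  have [|k [k0 hk]] := @fin_pos_min R _ d; first by move=> i; case: (hd i).
  exists k, ((r2 / 2)^-1 * (r2 / 2)^-1); split=> // x hx Px.
  have Dx : r2 / 2 <= D x.
    have [l1 _] := lubD x Px; apply: l1; split; [lra|split; [lra|move=> y hy]].
    apply: h2; apply: cube_half (_ : cube (ce a) (r2 / 2) (ce x)) hy => i.
    by case: (hd i) => _; apply; exact: cube_le hx.
  have iD : (D x)^-1 <= (r2 / 2)^-1 by rewrite lef_pV2 ?posrE ?D0//; lra.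
  have iD0 : 0 <= (D x)^-1 by rewrite invr_ge0 ltW// D0.
  exact: ler_pM.
have [rho [hr rpos]] := flat_exists p gb.
pose B := zext (@everywhere R (cd c)) A rho (fun=> 1).
have hB : dC p P B.
  apply: zext_in hr => //; [exact: everywhere_open|exact: dC_sub hAe|exact: dC_cst].
have B0 w : P w -> 0 < B w.
  by move=> Pw; rewrite /B /zext asboolT// mulr1; apply: rpos => //; case: Pw.
have BD w : P w -> B w <= D w ^+ 2.
  move=> Pw; rewrite /B /zext asboolT// mulr1; have [_ Aw] := Pw; have [_ b0 _] := gb.
  have deepw : deep (@everywhere R (cd c)) A (A w) w.
    by split=> // i; apply: damp_bound; [case: (a01 w)|exact/PE].
  have := hb w Pw deepw; rewrite -invfM -expr2 mulrC ler_pdivrMr ?mul1r; last by rewrite exprn_gt0// D0.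
  apply: le_trans; apply: le_trans (ler_norm _) _; apply: le_trans (flat_bound hr Aw (A1 w)) _.
  by apply: ler_piMl => //; exact/ltW/b0.
pose pr (x : 'rV[R]_n) : 'rV[R]_(cd c) := \row_j x ord0 (cs j).
(* The factor [1 / 4] keeps [x] within [D / 2] of the chart: [D] is a supremum that need not be
   attained, but some admissible radius exceeds [D / 2]. *)
pose q x := B (pr x) / 4 - \sum_i (x ord0 i - ce (pr x) ord0 i) * (x ord0 i - ce (pr x) ord0 i).
have hq : dC p (fun x => 0 < ca (pr x)) q.
  have sp U F : dC p U F -> (forall w, 0 < ca w -> U w) -> dC p (fun x => 0 < ca (pr x)) (fun x => F (pr x)).
    by move=> hF UF; apply: dC_sub (dC_proj (@cs _ _ c) hF) => x; exact: UF.
  have hd i : dC p (fun x => 0 < ca (pr x)) (fun x => x ord0 i - ce (pr x) ord0 i).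
    by apply: dC_add; [exact: dC_coord|apply: dC_opp; exact: sp (he i) _].
  apply: dC_add; first by apply: dC_mul; [apply: sp hB _ => w /PE|exact: dC_cst].
  by apply: dC_opp; apply: dC_sum => i; exact: dC_mul.
have hap : dC p (@everywhere R n) (fun x => ca (pr x)) by exact: dC_proj ha.
have [f [hf f01 fpos]] := pos_smooth hap (fun x => a01 (pr x)) hq (dC_cst _ _ 1).
exists f; split=> // x.
  move=> [w [hw ->]]; apply/fpos.
  have prE : pr (ce w) = w by apply/rowP => j; rewrite mxE hs.
  rewrite /q prE; split=> //; rewrite big1 ?subr0 => [|i _]; last by rewrite subrr mul0r.
  by rewrite divr_gt0// B0//; exact/PE.
move=> /fpos[/PE Px qx _]; have [l1 l2] := lubD _ Px.
have [r [Er hr2]] : exists r, E (pr x) r /\ D (pr x) / 2 < r.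
  apply: contrapT => h; have := D0 _ Px; suff : D (pr x) <= D (pr x) / 2 by lra.
  by apply: l2 => r Er; rewrite leNgt; apply/negP => lt; apply: h; exists r.
have [_ [_ hE]] := Er; apply: hE => i; apply: lt_trans hr2.
rewrite -(@ltr_pXn2r _ 2) ?nnegrE ?divr_ge0 ?(ltW (D0 _ Px))//.
have BDx := BD _ Px.
have s0 : 0 <= \sum_(j | j != i) (x ord0 j - ce (pr x) ord0 j) * (x ord0 j - ce (pr x) ord0 j).
  by apply: sumr_ge0 => j _; rewrite -expr2 sqr_ge0.
move: qx; rewrite /q (bigD1 i)//= real_normK ?num_real// expr_div_n -expr2.
by move: BDx s0; rewrite (_ : 2 ^+ 2 = 4 :> R); last (by ring); move: (\sum_(_ | _) _) ((x ord0 i - _) ^+ 2) (D (pr x) ^+ 2) (B (pr x)) => u1 u2 u3 u4; lra.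
Qed.

Theorem positivity_set n (V : 'rV[R]_n -> Prop) : Def V -> isopen V ->
  exists f : 'rV[R]_n -> R, [/\ dC p (@everywhere R n) f, forall x, 0 <= f x /\ f x <= 1 &
    forall x, 0 < f x <-> V x].
Proof.
move=> dV oV.
have key (Z : 'rV[R]_n -> Prop) : chartable S p (fun=> True) Z -> (forall x, Z x -> V x) ->
  exists f : 'rV[R]_n -> R, [/\ dC p (@everywhere R n) f, forall x, 0 <= f x /\ f x <= 1,
    forall x, Z x -> 0 < f x & forall x, 0 < f x -> V x].
  elim=> {Z} [|c okc _|Z1 Z2 _ ih1 _ ih2] sub.
  - by exists (fun=> 0); split=> // [|x]; [exact: dC_cst|rewrite ltxx].
  - exact: chart_tube.
  - have [|f1 [h1 a1 p1 v1]] := ih1; first by move=> x Zx; apply: sub; left.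
    have [|f2 [h2 a2 p2 v2]] := ih2; first by move=> x Zx; apply: sub; right.
    exists (fun x => (f1 x + f2 x) / 2); split=> [|x|x|x].
    + by apply: dC_mul; [exact: dC_add|exact: dC_cst].
    + by have := a1 x; have := a2 x; lra.
    + by have := a1 x; have := a2 x; case=> ? ?; case=> ? ?; case=> [/p1|/p2]; lra.
    + have [/v1//|n1] := ltP 0 (f1 x); have [/v2//|n2] := ltP 0 (f2 x); lra.
have [|f [hf f01 f1 f2]] := key _ (chart_decomposition p dV) => //.
by exists f; split=> // x; split; [exact: f2|exact: f1].
Qed.
End Carpeting.

(** * Gluing charts *)

Section CpMaps.
Context {R : rcfType} (S : forall n : nat, set (set 'rV[R]_n)).
Arguments S : clear implicits.
Context {HS : ominimal_structure S}.
Local Notation Def := (Def S).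
Local Notation Deff := (Deff S).
Local Notation dC := (dC S).

Lemma isopenP n (U : set 'rV[R]_n) : open U <-> isopen U.
Proof.
split=> [oU x Ux|oU].
  by apply/nbhs_cube; exact: open_nbhs_nbhs.
by rewrite openE => x /oU /nbhs_cube.
Qed.

(** Nothing is known of [f] or ['d f] outside [U], so definability is carried by a function [F] that
    agrees with a coordinate of [f] on [U]; its partial derivatives are represented by the globally
    definable [pderiv]. *)
Lemma dC_of_Cp m k p (U : 'rV[R]_m -> Prop) (f : 'rV[R]_m -> 'rV[R]_k) j F : isopen U -> Deff F ->
  (forall x, U x -> F x = f x ord0 j) -> Cp p U f -> dC p U F.
Proof.
move=> oU; elim: p f F => [|p ih] f F dF Ff.
  move=> cf; split=> // x Ux e e0; have [r [r0 hr]] := oU x Ux.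
  have /nbhs_ballP[d /= d0 hd] := cf x Ux _ (nbhsx_ballx (f x) e e0).
  have [k0 [k00 ka kb]] := pos_min2 r0 d0; exists k0; split=> // y hy.
  have Uy : U y by apply: hr; exact: cube_le hy.
  have [|_ h] := hd y; first by split=> // i l; rewrite ord1 /ball /= distrC; exact: (cube_le kb hy).
  by rewrite !Ff// distrC; exact: h.
move=> [df hf]; apply/dCS; split=> //.
have key x : U x -> hasD F x (fun i => ('d f x (delta_mx ord0 i)) ord0 j).
  move=> Ux; have [r [r0 hr]] := oU x Ux; have [h1 h2] := diff_row j (df x Ux).
  by apply: (hasD_ext (f := fun y => f y ord0 j) r0) => [y /hr/Ff//|]; split=> // i; rewrite h2.
have pE x i : U x -> pderiv F i x = ('d f x (delta_mx ord0 i)) ord0 j.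
  by move=> Ux; apply: pderivP; exact: hasD_isd (key x Ux).
exists (fun i => pderiv F i); split=> [x Ux|i].
  by rewrite (_ : (fun i => pderiv F i x) = fun i => ('d f x (delta_mx ord0 i)) ord0 j)//; [exact: key|apply/funext => i; exact: pE].
by apply: (ih (fun x => 'd f x (delta_mx ord0 i))) => [|x Ux|]; [exact: Deff_pderiv|exact: pE|exact: hf].
Qed.

Lemma Cp_of_dC m k p (U : 'rV[R]_m -> Prop) (f : 'rV[R]_m -> 'rV[R]_k) : isopen U ->
  (forall j, exists F, dC p U F /\ forall x, U x -> F x = f x ord0 j) -> Cp p U f.
Proof.
move=> oU; elim: p f => [|p ih] f hf.
  move=> x Ux; have [F hF] := choice hf.
  have cj j : contV (F j) x by case: (hF j) => h _; exact: dC_contV h Ux.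
  have [r [r0 hr]] := oU x Ux.
  move=> N /nbhs_ballP[e /= e0 he].
  have [d hd] := choice (fun j => cj j e e0).
  have [|k0 [k00 hk]] := @fin_pos_min R _ d; first by move=> j; case: (hd j).
  have [l [l0 la lb]] := pos_min2 k00 r0.
  apply/nbhs_cube; exists l; split=> // y hy; apply: he; split=> // i j; rewrite ord1 /ball /= distrC.
  have Uy : U y by apply: hr; exact: cube_le hy.
  have [_ Fj] := hF j; rewrite -!Fj//; have [_ h] := hd j; apply: h; apply: cube_le hy.
  exact: le_trans la (hk j).
have hD j : exists g : 'I_m -> 'rV[R]_m -> R, (forall i, dC p U (g i)) /\
    forall x, U x -> hasD (fun y => f y ord0 j) x (fun i => g i x).
  have [F [hF Ff]] := hf j; have /dCS[_ [g [h1 h2]]] := hF; exists g; split=> // x Ux.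
  have [r [r0 hr]] := oU x Ux; apply: hasD_ext r0 _ (h1 x Ux) => y /hr; exact: Ff.
have df x : U x -> differentiable f x.
  by move=> Ux; apply: row_differentiable => j; have [g [_ /(_ x Ux)[]]] := hD j.
split=> // i; apply: ih => j; have [g [h1 h2]] := hD j; exists (g i); split=> // x Ux.
by have [_ <-] := diff_row j (df x Ux); have [_ ->] := h2 x Ux.
Qed.

(** Only the graph of [f] over [U] is definable, so [f] is replaced by zero elsewhere. *)
Lemma definable_Cp_coord m k p (U : set 'rV[R]_m) (f : 'rV[R]_m -> 'rV[R]_k) j : isopen U -> Def U ->
  definable_Cp_map S p U f -> exists F, dC p U F /\ forall x, U x -> F x = f x ord0 j.
Proof.
move=> oU dU [df cf]; exists (fun x => if `[< U x >] then f x ord0 j else 0).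
have Ff x : U x -> (if `[< U x >] then f x ord0 j else 0) = f x ord0 j by move=> Ux; rewrite asboolT.
split=> //; apply: dC_of_Cp Ff cf => //.
have dg : Def (fun q : 'rV[R]_m * 'rV[R]_k => U q.1 /\ q.2 = f q.1) by exact: df.
apply: (Deff_rel (G := fun x y => (exists v : 'rV[R]_k, (U x /\ v = f x) /\ y = v ord0 j) \/ (~ U x /\ y = 0))).
  move=> x y; case: asboolP => Ux; split.
  - by case=> [[v [[_ ->] ->]]|[]].
  - by move=> ->; left; exists (f x).
  - by case=> [[v [[]]]|[]].
  - by right.
have dg' : Def (fun q : 'rV[R]_m * 'rV[R]_k => (fun x v => U x /\ v = f x) q.1 q.2) by exact: dg.
apply: Def_or; last by dfn.
apply: (Def_ex (P := fun (q : 'rV[R]_m * R) v => (U q.1 /\ v = f q.1) /\ q.2 = v ord0 j)).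
apply: Def_and; last by dfn.
by apply: (Def_subst2 (P := fun x v => U x /\ v = f x) (f := fun q : 'rV[R]_m * R * 'rV[R]_k => q.1.1) (g := snd)) => //; dfn.
Qed.

Lemma definable_Cp_of_coord m k p (U : set 'rV[R]_m) (f : 'rV[R]_m -> 'rV[R]_k) : isopen U -> Def U ->
  (forall j, dC p U (fun x => f x ord0 j)) -> definable_Cp_map S p U f.
Proof.
move=> oU dU hf; split; last by apply: Cp_of_dC => // j; exists (fun x => f x ord0 j).
have df : Deff f by apply: Deff_rows => j; exact: dC_Deff (hf j).
have dg : Def (fun q : 'rV[R]_m * 'rV[R]_k => U q.1 /\ q.2 = f q.1) by dfn.
exact: dg.
Qed.
End CpMaps.

(** * The glued functions on the manifold *)

Section Gluing.
Context {R : rcfType} (S : forall n : nat, set (set 'rV[R]_n)).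
Arguments S : clear implicits.
Context {HS : ominimal_structure S}.
Local Notation Def := (Def S).
Local Notation Deff := (Deff S).
Local Notation dC := (dC S).
Context (p : nat) (M : Type) (m : nat) (I : finType) (U : I -> set M) (phi : I -> M -> 'rV[R]_m).
Hypothesis (HM : is_manifold S U phi p).

Definition chart_set i : 'rV[R]_m -> Prop := phi i @` U i.
Definition overlap i j : 'rV[R]_m -> Prop := phi i @` (U i `&` U j).

Lemma phi_inj i x y : U i x -> U i y -> phi i x = phi i y -> x = y.
Proof. by case: HM => -[_ h _ _ _] _; exact: h. Qed.
Lemma Def_chart_set i : Def (chart_set i).
Proof. by case: HM => -[_ _ /(_ i)[h _] _ _] _; exact: h. Qed.
Lemma chart_set_open i : isopen (chart_set i).
Proof. by case: HM => -[_ _ /(_ i)[_ h] _ _] _; exact/isopenP. Qed.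
Lemma Def_overlap i j : Def (overlap i j).
Proof. by case: HM => -[_ _ _ /(_ i j)[h _] _] _; exact: h. Qed.
Lemma overlap_open i j : isopen (overlap i j).
Proof. by case: HM => -[_ _ _ /(_ i j)[_ h] _] _; exact/isopenP. Qed.
Lemma chart_setP i x : U i x -> chart_set i (phi i x). Proof. by exists x. Qed.
Lemma overlapP i j x : U i x -> overlap i j (phi i x) <-> U j x.
Proof.
move=> Ux; split=> [[y [Uy Vy] e]|Vx]; last by exists x.
by rewrite -(phi_inj Uy Ux e).
Qed.

Lemma transitions : exists T : I -> I -> 'rV[R]_m -> 'rV[R]_m,
  (forall i j x, U i x -> U j x -> T i j (phi i x) = phi j x) /\
  forall i j k, dC p (overlap i j) (fun y => T i j y ord0 k).
Proof.
have ex i j : exists T : 'rV[R]_m -> 'rV[R]_m, (forall x, U i x -> U j x -> T (phi i x) = phi j x) /\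
    forall k, dC p (overlap i j) (fun y => T y ord0 k).
  have [[_ _ _ _ /(_ i j)[t [ht [dt _]]]] _] := HM.
  have [F hF] := choice (fun k => definable_Cp_coord k (@overlap_open i j) (@Def_overlap i j) dt).
  exists (fun y => \row_k F k y); split=> [x Ux Vx|k].
    by apply/rowP => k; rewrite mxE; have [_ ->] := hF k; [rewrite ht|exists x].
  by under [X in dC _ _ X]eq_fun do rewrite mxE; case: (hF k).
have [T hT] := choice (fun ij : I * I => ex ij.1 ij.2).
by exists (fun i j => T (i, j)); split=> i j; case: (hT (i, j)).
Qed.

Section Pullback.
Context (i j : I) (T : 'rV[R]_m -> 'rV[R]_m) (a : 'rV[R]_m -> R).
Hypotheses (TE : forall x, U j x -> U i x -> T (phi j x) = phi i x)
  (hT : forall k, dC p (overlap j i) (fun y => T y ord0 k))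
  (ha : dC p (@everywhere R m) a) (a01 : forall y, 0 <= a y /\ a y <= 1)
  (apos : forall y, 0 < a y <-> chart_set i y).

Definition pullback (y : 'rV[R]_m) : R := if `[< overlap j i y >] then damp a (T y) else 0.

Lemma Deff_trans : Deff T.
Proof. by apply: Deff_rows => k; exact: dC_Deff (hT k). Qed.

Lemma Deff_pullback : Deff pullback.
Proof.
have d1 := Deff_trans; have d2 := dC_Deff (dC_damp ha); have d3 := Def_overlap j i.
by rewrite /pullback; dfn.
Qed.

Lemma pullback_01 y : 0 <= pullback y /\ pullback y <= 1.
Proof. by rewrite /pullback; case: asboolP => _; [exact: damp_01|split]. Qed.

Lemma pullback_smooth : dC p (overlap j i) pullback.
Proof.
apply: (dC_ext (f := fun y => damp a (T y))).
- exact: overlap_open.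
- exact: Deff_pullback.
- by move=> y hy; rewrite /pullback asboolT.
- by apply: (dC_comp (V := @everywhere R m)) => //; exact: dC_damp.
Qed.

(* If [pullback] did not tend to zero at a point of the chart outside the overlap, points of the
   overlap would converge both to that point and, in the other chart, to a point of
   positivity of [a]: the two limits could not be separated. *)
Lemma pullback_cont y : chart_set j y -> contV pullback y.
Proof.
move=> Vy; have [Wy|nW] := pselect (overlap j i y); first exact: dC_contV pullback_smooth Wy.
have P0 : pullback y = 0 by rewrite /pullback asboolF.
move=> e e0; apply: contrapT => ne.
have hd : dC p (@everywhere R m) (damp a) by exact: dC_damp.
have dd := dC_Deff hd; have dT := Deff_trans; have dW := Def_overlap j i.
have dcube : Def (fun p : 'rV[R]_m * R * 'rV[R]_m => cube p.1.1 p.1.2 p.2) by exact: Def_cube.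
(* Images in chart [i] of the overlap points within [s] of [y] at which the damped function is at
   least [e]. The damping bounds them by [1 / e], so they have a cluster point [b]. *)
pose F (s : R) (z : 'rV[R]_m) := exists y' : 'rV[R]_m, cube y s y' /\ overlap j i y' /\ z = T y' /\ e <= damp a z.
have dF : Def (fun q : R * 'rV[R]_m => F q.1 q.2) by rewrite /F; dfn.
have [||s z k [y' [_ [_ [_ h]]]]|b hb] := @cluster_point _ S HS m F e^-1 dF.
- move=> s s0; apply: contrapT => nz; apply: ne; exists s; split=> // y' hy.
  rewrite P0 subr0 ger0_norm; last by case: (pullback_01 y').
  rewrite ltNge; apply/negP; rewrite /pullback; case: asboolP => [Wy'|_] h; last by lra.
  by apply: nz; exists (T y'), y'.
- by move=> s t z s0 st [y' [h1 h2]]; exists y'; split=> //; exact: cube_le h1.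
- have dz : 0 < damp a z by exact: lt_le_trans h.
  have bd : `|z ord0 k| <= (damp a z)^-1 by apply: damp_bound; [case: (a01 z)|exact/damp_gt0].
  apply: le_trans bd _.
  by rewrite lef_pV2 ?posrE.
have ab : e <= damp a b.
  rewrite leNgt; apply/negP => lt; have [|d [d0 hd']] := dC_contV hd (Logic.I : everywhere b) (_ : 0 < e - damp a b); first by lra.
  have [z [[_ [_ [_ [_ h]]]] bz]] := hb 1 d ltr01 d0; have := hd' z bz.
  by rewrite ltr_norml => /andP[_ h']; lra.
have [x1 Ux1 bE] : chart_set i b by apply/apos; apply/damp_gt0; exact: lt_le_trans ab.
have [x0 Ux0 yE] := Vy.
have ne01 : x0 <> x1 by move=> e01; apply: nW; rewrite -yE; apply/overlapP; rewrite // e01.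
have [_ hd2] := HM; have [N1 [N2 [oN1 oN2 xN1 xN2 dis]]] := hd2 _ _ ne01.
have [s [s0 hs]] : exists s : R, 0 < s /\ forall y', cube y s y' -> (phi j @` (N1 `&` U j)) y'.
  by have /isopenP := oN1 j; apply; rewrite -yE; exists x0.
have [r [r0 hr]] : exists r : R, 0 < r /\ forall z, cube b r z -> (phi i @` (N2 `&` U i)) z.
  by have /isopenP := oN2 i; apply; rewrite -bE; exists x1.
have [z [[y' [hy' [[x [Ujx Uix] xE] [zE _]]]] bz]] := hb s r s0 r0.
have [u [N1u Uu] uE] := hs y' hy'; have [v [N2v Uv] vE] := hr z bz.
have ux : u = x by apply: (phi_inj Uu Ujx); rewrite uE.
have vx : v = x by apply: (phi_inj Uv Uix); rewrite vE zE -xE TE.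
have : (N1 `&` N2) x by split; [rewrite -ux|rewrite -vx].
by rewrite dis.
Qed.

Lemma pullback_pos y : posset (chart_set j) pullback y <-> overlap j i y.
Proof.
split=> [[_]|Wy]; first by rewrite /pullback; case: asboolP => //; rewrite ltxx.
have [x [Ujx Uix] <-] := Wy; split; first by exists x.
rewrite /pullback asboolT; last by exists x.
by rewrite TE//; apply/damp_gt0/apos; exists x.
Qed.
End Pullback.

(** [G i None] is [lambda_i] and [G i (Some k)] is its product with the [k]-th coordinate of
    [phi_i]; [H i j] represents them in chart [j]. One [rho_i] must serve in every chart and for
    every component, so it is built from the minimum of the finitely many gauges. *)
Lemma glued_functions : exists (G : I -> option 'I_m -> M -> R) (H : I -> I -> option 'I_m -> 'rV[R]_m -> R),
  [/\ forall i j o, dC p (chart_set j) (H i j o),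
      forall i j o x, U j x -> H i j o (phi j x) = G i o x,
      forall i x, 0 < G i None x <-> U i x &
      forall i k x, G i (Some k) x = G i None x * phi i x ord0 k].
Proof.
have [T [TE hT]] := transitions.
have [a ha] := choice (fun i => positivity_set p (@Def_chart_set i) (@chart_set_open i)).
pose A i j := pullback i j (T j i) (a i).
pose u i j (o : option 'I_m) (y : 'rV[R]_m) := if o is Some k then T j i y ord0 k else 1.
have ex i j o : exists b, gauge S b /\ forall rho, flat S p b rho ->
    dC p (chart_set j) (zext (chart_set j) (A i j) rho (u i j o)).
  have [h1 h2 h3] := ha i.
  have TE' x : U j x -> U i x -> T j i (phi j x) = phi i x by exact: TE.
  have sub y : posset (chart_set j) (A i j) y -> overlap j i y by move/(pullback_pos TE' h3).
  apply: flat_zext.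
  - exact: Def_chart_set.
  - exact: chart_set_open.
  - exact: Deff_pullback.
  - by move=> y; case: (pullback_01 i j (T j i) h2 y).
  - by move=> y; case: (pullback_01 i j (T j i) h2 y).
  - by move=> y; exact: pullback_cont.
  - by apply: dC_sub sub _; exact: pullback_smooth.
  - apply: dC_sub sub _; case: o => [k|]; [exact: hT|exact: dC_cst].
have [b hb] := choice (fun q : I * I * option 'I_m => ex q.1.1 q.1.2 q.2).
have exr i : exists rho : R -> R, (forall j o, flat S p (b (i, j, o)) rho) /\ forall t : R, 0 < t -> t <= 1 -> 0 < rho t.
  have [|b0 [g0 h0]] := @gauge_min _ S HS (I * option 'I_m)%type (fun q => b (i, q.1, q.2)).
    by move=> q; case: (hb (i, q.1, q.2)).
  have [rho [h1 h2]] := flat_exists p g0; exists rho; split=> // j o.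
  by apply: flat_le h1 => t _ _; exact: (h0 (j, o)).
have [rho hrho] := choice exr.
exists (fun i o x => if `[< U i x >] then rho i (damp (a i) (phi i x)) * (if o is Some k then phi i x ord0 k else 1) else 0).
exists (fun i j o => zext (chart_set j) (A i j) (rho i) (u i j o)); split.
- by move=> i j o; have [_ h] := hb (i, j, o); apply: h; case: (hrho i).
- move=> i j o x Ux; have [h1 h2 h3] := ha i.
  have TE' z : U j z -> U i z -> T j i (phi j z) = phi i z by exact: TE.
  have pE : posset (chart_set j) (A i j) (phi j x) <-> U i x.
    by rewrite (pullback_pos TE' h3); exact: overlapP.
  rewrite /zext; case: asboolP => [/pE Uix|nU]; last by rewrite asboolF// => /pE.
  rewrite asboolT// /A /pullback asboolT; last exact/overlapP.
  by rewrite TE// /u; case: (o) => [k|]//; rewrite TE.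
- move=> i x; have [h1 h2 h3] := ha i; case: asboolP => Ux; last by rewrite ltxx.
  rewrite mulr1; split=> // _; have [_ h] := hrho i; apply: h; last by case: (damp_01 (h2 (phi i x))).
  by apply/damp_gt0/h3; exists x.
- by move=> i k x; case: asboolP => _; rewrite ?mul0r// mulr1.
Qed.
End Gluing.

(** * The embedding *)

Theorem theorem3p1 (R : rcfType) (S : forall n : nat, set (set 'rV[R]_n))
  (HS : ominimal_structure S) (p : nat) (hp : (1 <= p)%N)
  (M : Type) (m : nat) (I : finType) (U : I -> set M) (phi : I -> M -> 'rV[R]_m)
  (HM : is_manifold S U phi p) :
  exists n : nat, (0 < n)%N /\
    exists g : M -> 'rV[R]_n, is_embedding S U phi p g.
Proof.
have [G [H [hH HG Gpos Gmul]]] := glued_functions HM.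
(* The summand [None] of [K] is a zero coordinate: it makes [n] positive even if [I] is empty. *)
pose K : finType := option (I * option 'I_m).
pose n := #|K|.
pose g (x : M) : 'rV[R]_n := \row_l if enum_val l is Some (i, o) then G i o x else 0.
pose h (j : I) (y : 'rV[R]_m) : 'rV[R]_n := \row_l if enum_val l is Some (i, o) then H i j o y else 0.
pose e i o : 'I_n := enum_rank (Some (i, o) : K).
have gE i o x : g x ord0 (e i o) = G i o x by rewrite mxE enum_rankK.
have hE i j o y : h j y ord0 (e i o) = H i j o y by rewrite mxE enum_rankK.
have hg j x : U j x -> h j (phi j x) = g x.
  by move=> Ux; apply/rowP => l; rewrite !mxE; case: (enum_val l) => [[i o]|]//; exact: HG.
have hsm j l : dC S p (chart_set U phi j) (fun y => h j y ord0 l).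
  under [X in dC _ _ _ X]eq_fun do rewrite mxE.
  by case: (enum_val l) => [[i o]|]; [exact: hH|exact: dC_cst].
have cov x : exists i, U i x by case: HM => -[].
have phiE i x k : U i x -> phi i x ord0 k = G i (Some k) x / G i None x.
  by move=> /Gpos/lt0r_neq0 ne; rewrite Gmul mulrAC divff// mul1r.
exists n; split; first by rewrite /n; apply/card_gt0P; exists None.
exists g; split.
- move=> j; exists (h j); split; first exact: hg.
  split.
    by apply: definable_Cp_of_coord => [||l]; [exact: chart_set_open HM j|exact: Def_chart_set HM j|exact: hsm].
  move=> x Ux v dv; set y := phi j x; case: p hp HM hH hsm => // q _ HM' hH' hsm'.
  have Vy : chart_set U phi j y by exact: chart_setP.
  have df : differentiable (h j) y.
    by apply: row_differentiable => l; have /dCS[_ [? [/(_ y Vy)[]]]] := hsm' j l.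
  have d0 l : 'd (fun z => h j z ord0 l : R) y v = 0.
    by have [_ ->] := diff_row l df; rewrite dv mxE.
  (* In its own chart the differential of [lambda_j] kills [v]. By the product rule the differential
     of [lambda_j * phi_j,k] then takes the value [lambda_j * v_k] at [v]; as this vanishes and
     [lambda_j > 0], so does [v_k]. *)
  have /dCS[_ [g0 [hg0 _]]] := hH' j j None; have h0 := hg0 y Vy.
  have z0 : \sum_i v ord0 i * g0 i y = 0.
    by rewrite -(hasD_lin h0) -[RHS](d0 (e j None)); congr ('d _ y v); apply/funext => z; rewrite hE.
  apply/rowP => k; rewrite mxE.
  have [r [r0 hr]] := chart_set_open HM' Vy.
  have hk : hasD (fun z => h j z ord0 (e j (Some k))) y (fun i => H j j None y * (i == k)%:R + y ord0 k * g0 i y).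
    by apply: hasD_ext r0 _ (hasD_mul h0 (hasD_coord y k)) => z /hr[x' Ux' <-]; rewrite hE !HG// Gmul.
  have := d0 (e j (Some k)); rewrite (hasD_lin hk).
  under eq_bigr => i _ do rewrite mulrDr [v _ _ * (y _ _ * _)]mulrCA.
  rewrite big_split /= -mulr_sumr z0 mulr0 addr0 (bigD1 k)//= eqxx mulr1 big1 ?addr0 => [|i /negbTE->]; last by rewrite !mulr0.
  move/eqP; rewrite mulf_eq0 => /orP[/eqP//|/eqP].
  by rewrite HG// => G0; have := (Gpos j x).2 Ux; rewrite G0 ltxx.
- move=> x x' gx; have [i Ux] := cov x.
  have GE o : G i o x = G i o x' by rewrite -!gE gx.
  have Ux' : U i x' by apply/Gpos; rewrite -GE; exact/Gpos.
  by apply: (phi_inj HM Ux Ux'); apply/rowP => k; rewrite !phiE// !GE.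
- move=> V /isopenP oV j; apply/isopenP => _ [x [Vx Ux] <-].
  have Vy : chart_set U phi j (phi j x) by exact: chart_setP.
  have [d [d0 hd]] : exists d : R, 0 < d /\ forall z, cube (h j (phi j x)) d z -> V z by apply: oV; rewrite hg.
  have [D hD] := choice (fun l => dC_contV (hsm j l) Vy d0).
  have [|k [k0 hk]] := @fin_pos_min R _ D; first by move=> l; case: (hD l).
  have [r [r0 hr]] := chart_set_open HM Vy; have [q [q0 qk qr]] := pos_min2 k0 r0.
  exists q; split=> // y hy; have [x' Ux' xE] : chart_set U phi j y by apply: hr; exact: cube_le hy.
  exists x' => //; split=> //; rewrite /preimage /= -(hg j x' Ux') xE; apply: hd => l.
  by have [_ h'] := hD l; apply: h'; apply: cube_le hy; exact: le_trans qk (hk l).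
- move=> O oO.
  pose quot i (z : 'rV[R]_n) : 'rV[R]_m := \row_k (z ord0 (e i (Some k)) * (z ord0 (e i None))^-1).
  have quotE i x : U i x -> quot i (g x) = phi i x.
    by move=> Ux; apply/rowP => k; rewrite mxE !gE phiE.
  (* On the image of [g], positivity of the coordinate [e i None] says that the point lies in [U i],
     and the quotient recovers its chart value. The set is open because [quot i] is continuous where
     its denominator is positive. *)
  exists [set z : 'rV[R]_n | exists i, 0 < z ord0 (e i None) /\ (phi i @` (O `&` U i)) (quot i z)]; split.
    apply/isopenP => z [i [z0 hz]].
    have /isopenP/(_ _ hz)[d [d0 hd]] := oO i.
    have cq k : contV (fun z => quot i z ord0 k) z.
      have -> : (fun z => quot i z ord0 k) = fun z => z ord0 (e i (Some k)) * (z ord0 (e i None))^-1.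
        by apply/funext => w; rewrite mxE.
      apply: hasD_contV (hasD_mul (hasD_coord z _) (hasD_inv _ (hasD_coord z _))).
      exact: lt0r_neq0.
    have [D hD] := choice (fun k => cq k d d0).
    have [|k [k0 hk]] := @fin_pos_min R _ D; first by move=> l; case: (hD l).
    have [q [q0 qk qz]] := pos_min2 k0 z0.
    exists q; split=> // w hw; exists i; split.
      by have := hw (e i None); rewrite ltr_norml => /andP[h1 _]; lra.
    by apply: hd => l; have [_ h'] := hD l; apply: h'; apply: cube_le hw; exact: le_trans qk (hk l).
  apply/seteqP; split=> [_ [x Ox <-]|_ [[x _ <-] [i [gx [x' [Ox' Ux'] xE]]]]].
    split; first by exists x.
    have [i Ux] := cov x; exists i; rewrite gE quotE//; split; first exact/Gpos.
    by exists x.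
  have Ux : U i x by apply/Gpos; rewrite -gE.
  exists x => //; rewrite -(phi_inj HM Ux' Ux)//; by rewrite xE quotE.
Qed.
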